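(* Let $E$ be a Hermite--Biehler function with no real zeros and let $\mathcal{H}(E)$ be the corresponding de Branges space. Then the following are equivalent: (i) there exists a representing Fock weight $W$ for $\mathcal{H}(E)$ that depends only on the imaginary part, i.e. $W(z)=W(\operatorname{Im} z)$, $z\in\mathbb{C}$; (ii) $\mathcal{H}(E)=PW_a$ for some $a>0$ (equality as sets, with equivalence of norms).
   Context: $\mathbb{C}^{+}$ is the open upper half-plane, and $E^\sharp(z)=\overline{E(\overline z)}$. An entire function $E$ is in the Hermite--Biehler class if $|E(z)|>|E^\sharp(z)|$ for all $z\in\mathbb{C}^+$; it is always assumed that $E$ has no zeros on $\mathbb{R}$. The de Branges space is $\mathcal{H}(E)=\{F \text{ entire}: F/E,\ F^\sharp/E\in H^2(\mathbb{C}^+)\}$, where $H^2(\mathbb{C}^+)$ is the Hardy space of the upper half-plane, with norm $\|F\|_E^2=\int_{\mathbb{R}}|F(x)/E(x)|^2dx$. A weight is a measurable function $W:\mathbb{C}\to(0,\infty)$ with $\inf_K W>0$ for every compact $K\subset\mathbb{C}$; the Fock-type space is $\mathcal{F}_W=\{F\text{ entire}: \|F\|^2_{\mathcal{F}_W}=\int_{\mathbb{C}}|F(z)W(z)|^2dm(z)<\infty\}$, where $m$ is area Lebesgue measure. A weight $W$ is a representing Fock weight for $\mathcal{H}(E)$ if $\mathcal{H}(E)=\mathcal{F}_W$ as sets, with equivalence of norms. The Paley--Wiener space $PW_a$ consists of the entire functions of exponential type at most $a$ that are square integrable on $\mathbb{R}$, with the $L^2(\mathbb{R})$-norm. *)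

(* Defs.v *)
From HB Require Import structures.
From mathcomp Require Import all_boot all_order all_algebra.
From mathcomp Require Import all_classical all_reals all_analysis.
From mathcomp Require Import complex.

Set Implicit Arguments.
Unset Strict Implicit.
Unset Printing Implicit Defensive.

Import Order.TTheory GRing.Theory Num.Theory.
Import numFieldNormedType.Exports.

Local Open Scope classical_set_scope.
Local Open Scope ring_scope.
Local Open Scope complex_scope.

(* Complex differentiability at [z]: the increment of [derivable] ranges over
   the scalar field, which is [R[i]] here. *)
Definition cdifferentiable (R : realType) (F : R[i] -> R[i]) (z : R[i]) : Prop :=
  derivable (F : R[i]^o -> R[i]^o) z 1.

Definition entire (R : realType) (F : R[i] -> R[i]) : Prop :=
  forall z, cdifferentiable F z.

Definition sharp (R : realType) (F : R[i] -> R[i]) : R[i] -> R[i] :=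
  fun z => (F z^*)^*.

Definition hermite_biehler (R : realType) (E : R[i] -> R[i]) : Prop :=
  entire E /\ forall z, 0 < complex.Im z -> `|sharp E z| < `|E z|.

(* [normc] is the modulus with values in [R]; [`|z|] has values in [R[i]]. *)
Notation normc := ComplexField.Normc.normc.

Notation leb R := (@lebesgue_measure R).

(* The Hardy space H^2 of the open upper half-plane; only the values of [f] at
   points with positive imaginary part matter. *)
Definition hardy2 (R : realType) : set (R[i] -> R[i]) :=
  [set f | (forall z, 0 < complex.Im z -> cdifferentiable f z) /\
    (ereal_sup [set (\int[leb R]_x (normc (f (x +i* y)) ^+ 2)%:E)%E
               | y in [set y : R | (0 < y)%R]] < +oo)%E].

Definition de_branges (R : realType) (E : R[i] -> R[i]) : set (R[i] -> R[i]) :=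
  [set F | [/\ entire F, hardy2 (fun z => F z / E z)
             & hardy2 (fun z => sharp F z / E z)]].

Definition de_branges_norm (R : realType) (E F : R[i] -> R[i]) : \bar R :=
  sqrte (\int[leb R]_x (normc (F x%:C / E x%:C) ^+ 2)%:E)%E.

(* [lebesgue_measure] and its product with itself are measures on the Borel
   sets; the Caratheodory extension completes the latter to Lebesgue area measure
   on the Lebesgue measurable subsets of [R * R], identified with the complex
   plane by [to_complex]. *)
Definition borel_area (R : realType) :
    {measure set (measurableTypeR R * measurableTypeR R) -> \bar R} :=
  (leb R \x leb R)%E.

Definition plane (R : realType) := caratheodory_type ((borel_area R)^*)%mu.

Definition area (R : realType) : {measure set (plane R) -> \bar R} :=
  @completed_measure_extension _ _ _ (borel_area R).

Definition to_complex (R : realType) (p : plane R) : R[i] := p.1 +i* p.2.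

Definition weight (R : realType) (W : R[i] -> R) : Prop :=
  [/\ forall z, 0 < W z,
      measurable_fun [set: plane R] (W \o @to_complex R)
    & forall K : set R[i]^o, compact K ->
        (0 < ereal_inf [set (W z)%:E | z in K])%E].

Definition fock_norm (R : realType) (W : R[i] -> R) (F : R[i] -> R[i]) : \bar R :=
  sqrte (\int[area R]_p
    ((normc (F (to_complex p)) * W (to_complex p)) ^+ 2)%:E)%E.

Definition fock (R : realType) (W : R[i] -> R) : set (R[i] -> R[i]) :=
  [set F | entire F /\ (fock_norm W F < +oo)%E].

Definition exp_type_le (R : realType) (a : R) (F : R[i] -> R[i]) : Prop :=
  forall e : R, 0 < e -> exists C : R,
    forall z, normc (F z) <= C * expR ((a + e) * normc z).

Definition L2_norm_on_line (R : realType) (F : R[i] -> R[i]) : \bar R :=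
  sqrte (\int[leb R]_x (normc (F x%:C) ^+ 2)%:E)%E.

Definition paley_wiener (R : realType) (a : R) : set (R[i] -> R[i]) :=
  [set F | [/\ entire F, exp_type_le a F & (L2_norm_on_line F < +oo)%E]].

Definition same_space (R : realType)
    (A : set (R[i] -> R[i])) (normA : (R[i] -> R[i]) -> \bar R)
    (B : set (R[i] -> R[i])) (normB : (R[i] -> R[i]) -> \bar R) : Prop :=
  A = B /\
  exists c C : R, [/\ 0 < c, 0 < C &
    forall F, A F -> (c%:E * normA F <= normB F <= C%:E * normA F)%E].

Definition representing_fock_weight (R : realType) (E : R[i] -> R[i])
    (W : R[i] -> R) : Prop :=
  weight W /\
  same_space (de_branges E) (de_branges_norm E) (fock W) (fock_norm W).

(* Main.v *)
(** Let L(F) be the squared L^2 norm of F on the real line and N(F) its squared Fock norm; for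
    a weight W(Im z), N(F) is the integral over y of W(y)^2 times the squared L^2 norm of F on
    the line Im z = y.

    For (ii) => (i) take W(y)^2 = e^{-2a|y|} / (1 + y^2). The Plancherel-Polya inequality gives
    N <= C L on PW_a, and the mean value inequality for |F|^2 gives L <= C N and the type of F.

    For (i) => (ii), N is invariant under real translations. Translates of a reproducing kernel
    without real zeros show that |E|^{-2} has bounded integrals over intervals of a fixed length;
    averaging the norm of H(E) over real translations then gives N ~ L. Consequently H(E) is
    invariant under differentiation and, by Taylor's formula, under vertical translations. Let r
    be the optimal rate in L(F(. + iy)) <= C e^{2r|y|} L(F). Functions that almost attain this
    rate show that W(y)^2 e^{2r|y|} is integrable, whence PW_r is contained in H(E), and the
    growth bound gives the converse inclusion. Liouville's theorem excludes r = 0. *)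
Require Import Defs.
From HB Require Import structures.
From mathcomp Require Import all_boot all_order all_algebra.
From mathcomp Require Import all_classical all_reals all_analysis.
From mathcomp Require Import complex ring lra measurable_realfun.

Set Implicit Arguments.
Unset Strict Implicit.
Unset Printing Implicit Defensive.

Import Order.TTheory GRing.Theory Num.Theory.
Import numFieldNormedType.Exports.

Local Open Scope classical_set_scope.
Local Open Scope ring_scope.
Local Open Scope complex_scope.

(** No Fourier transform is used. The constants in Cauchy's formula and in the mean value inequality
    are crude, because only equivalence of norms is at stake. Two estimates are sharp: the maximum
    principle, whose constant 1 comes from taking powers, and the bound [M exp(a |y|)] on the
    imaginary axis for functions of type [a], on which the Plancherel-Polya inequality rests. The
    weight is measurable only for the completed area measure, so [W(Im z)] must first be replaced by
    a Borel function of one variable. In (i) => (ii) there is no explicit function, such as an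
    exponential, that attains the rate r. Its substitute is a function that grows at a rate l < r
    during J steps. The estimate N <= C L for it and for its image under [sharp] bounds the integral
    of W(y)^2 e^{2l|y|} over [-J, J] uniformly in J, and the choice l = r - 1/(J + 1) costs only a
    constant factor there. W is not assumed even: the symmetry of the growth bounds comes from the
    involution [sharp], which preserves H(E) and L. *)

(** * The modulus, and complex derivatives in epsilon form *)

Section complex_derivative.
Context {R : realType}.
Implicit Types (F G : R[i] -> R[i]) (z w h d : R[i]).

Lemma normc_ge0 z : 0 <= normc z.
Proof. by case: z => a b; rewrite sqrtr_ge0. Qed.

Lemma normcD z w : normc (z + w) <= normc z + normc w.
Proof. exact: le_normcD. Qed.

Lemma normcB z w : normc (z - w) <= normc z + normc w.
Proof. by rewrite (le_trans (normcD _ _))// normcN. Qed.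

Lemma normc_distC z w : normc (z - w) = normc (w - z).
Proof. by rewrite -opprB normcN. Qed.

Lemma normcM z w : normc (z * w) = normc z * normc w.
Proof. exact: Normc.normcM. Qed.

Lemma normcX z n : normc (z ^+ n) = normc z ^+ n.
Proof.
elim: n => [|n IH]; first by rewrite !expr0 Normc.normc1.
by rewrite !exprS normcM IH.
Qed.

Lemma normcV z : normc z^-1 = (normc z)^-1.
Proof. exact: Normc.normcV. Qed.

Lemma normcJ z : normc z^* = normc z.
Proof. by case: z => a b /=; rewrite sqrrN. Qed.

Lemma normc_real (x : R) : normc x%:C = `|x|.
Proof. by rewrite /= expr0n addr0 sqrtr_sqr. Qed.

Lemma normc_gt0 z : z != 0 -> 0 < normc z.
Proof.
move=> z0; rewrite lt_neqAle normc_ge0 andbT eq_sym.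
by apply: contra z0 => /eqP/Normc.eq0_normc ->.
Qed.

Lemma normcE z : `|z| = (normc z)%:C.
Proof. by case: z => a b; rewrite normc_def. Qed.

Lemma sqr_normcE z : normc z ^+ 2 = complex.Re z ^+ 2 + complex.Im z ^+ 2.
Proof. by case: z => a b /=; rewrite sqr_sqrtr ?addr_ge0 ?sqr_ge0. Qed.

Lemma normc_Re z : `|complex.Re z| <= normc z.
Proof.
by case: z => a b /=; rewrite -sqrtr_sqr ler_wsqrtr// lerDl sqr_ge0.
Qed.

Lemma normc_Im z : `|complex.Im z| <= normc z.
Proof.
by case: z => a b /=; rewrite -sqrtr_sqr ler_wsqrtr// lerDr sqr_ge0.
Qed.

Lemma normc_le_ReIm z : normc z <= `|complex.Re z| + `|complex.Im z|.
Proof.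
rewrite -(@ler_pXn2r _ 2) ?nnegrE ?normc_ge0 ?addr_ge0// sqr_normcE sqrrD.
by rewrite !real_normK ?num_real// lerD2r lerDl mulrn_wge0// mulr_ge0.


Qed.

Lemma lec_real (x y : R) : (x%:C <= y%:C :> R[i]) = (x <= y).
Proof. by rewrite lecE /= eqxx. Qed.

Lemma ltc_real (x y : R) : (x%:C < y%:C :> R[i]) = (x < y).
Proof. by rewrite ltcE /= eqxx. Qed.

Definition cder F z d := forall e : R, 0 < e -> exists2 D : R, 0 < D &
  forall h, normc h < D -> normc (F (z + h) - F z - d * h) <= e * normc h.

Lemma cdifferentiableP F z : cdifferentiable F z <-> exists d, cder F z d.
Proof.
split.
  move=> /cvg_ex[/= d Fd]; exists d => e e0.
  move/cvgrPdist_le : Fd => /(_ e%:C).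
  rewrite ltc_real => /(_ e0).
  rewrite /dnbhs near_withinE => /nbhs_ballP[D /= D0 HD].
  have [D1 D10 DE] : exists2 D1 : R, 0 < D1 & D = D1%:C.
    move: D D0 {HD} => [a b]; rewrite ltcE /= => /andP[/eqP -> a0].
    by exists a.
  exists D1 => // h hD1.
  have [->|h0] := eqVneq h 0.
    by rewrite addr0 subrr mulr0 subr0 Normc.normc0 mulr0.
  have := HD h; rewrite -ball_normE /= sub0r normrN normcE DE ltc_real => /(_ hD1 h0).
  rewrite normcE lec_real => H.
  rewrite -ler_pdivrMr ?normc_gt0// -normcV -normcM (le_trans _ H)//.
  rewrite normc_distC le_eqVlt; apply/orP; left; apply/eqP; congr (normc _).
  rewrite /= mulrDl mulNr mulfK//; congr (_ - _).
  by rewrite /GRing.scale/= mulr1 mulrC [h + z]addrC.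
move=> [d Fd]; apply/cvg_ex; exists d; apply/cvgrPdist_le => e.
case: e => a b; rewrite ltcE /= => /andP[/eqP-> a0].
have [D D0 HD] := Fd a a0.
rewrite /dnbhs near_withinE; apply/nbhs_ballP.
exists D%:C => /=; first by rewrite ltc_real.
move=> h; rewrite -ball_normE /= sub0r normrN normcE ltc_real => hD h0.
rewrite normcE lec_real -(ler_pM2r (normc_gt0 h0)) -normcM mulrBl normc_distC.
rewrite (le_trans _ (HD _ hD))// le_eqVlt; apply/orP; left; apply/eqP; congr (normc _).
rewrite /GRing.scale/= mulr1 mulrAC mulVf// mul1r.
by rewrite [h + z]addrC.
Qed.

Lemma cder_cont F z d : cder F z d ->
  forall e : R, 0 < e -> exists2 D : R, 0 < D &
  forall h, normc h < D -> normc (F (z + h) - F z) <= e.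
Proof.
move=> Fd e e0; have [D D0 HD] := Fd 1 ltr01.
have N0 : 0 < 1 + normc d by rewrite ltr_pwDl// normc_ge0.
exists (Num.min D (e / (1 + normc d))); first by rewrite lt_min D0 divr_gt0.
move=> h; rewrite lt_min => /andP[hD he].
rewrite (_ : _ - _ = (F (z + h) - F z - d * h) + d * h); last by rewrite subrK.
rewrite (le_trans (normcD _ _))// (le_trans (lerD (HD _ hD) (lexx _)))//.
by rewrite normcM -mulrDl -ler_pdivlMl// mulrC ltW.
Qed.

Lemma cderD F G z d d' : cder F z d -> cder G z d' ->
  cder (fun w => F w + G w) z (d + d').
Proof.
move=> Fd Gd e e0; have e20 : 0 < e / 2 by rewrite divr_gt0.
have [D D0 HD] := Fd _ e20; have [D' D'0 HD'] := Gd _ e20.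
exists (Num.min D D'); first by rewrite lt_min D0.
move=> h; rewrite lt_min => /andP[/HD h1 /HD' h2].
rewrite (_ : _ - _ = (F (z + h) - F z - d * h) + (G (z + h) - G z - d' * h)); last by ring.
by rewrite (le_trans (normcD _ _))// (le_trans (lerD h1 h2))// -mulrDl -splitr.
Qed.

Lemma cder_cst c z : cder (fun=> c) z 0.
Proof.
by move=> e e0; exists 1 => // h _; rewrite subrr mul0r subr0 Normc.normc0 mulr_ge0 ?normc_ge0// ltW.
Qed.

Lemma cder_id z : cder id z 1.
Proof.
move=> e e0; exists 1 => // h _.
by rewrite mul1r [z + h]addrC addrK subrr Normc.normc0 mulr_ge0 ?normc_ge0// ltW.
Qed.

Lemma cderM F G z d d' : cder F z d -> cder G z d' ->
  cder (fun w => F w * G w) z (d * G z + F z * d').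
Proof.
move=> Fd Gd e e0.
(* The factor 3 pays for the three error terms of the product, each of which will be at most
   [e * normc h / 3]. *)
pose M : R := 3 * (1 + normc (F z) + normc (G z) + normc d + e).
have M0 : 0 < M.
  by rewrite mulr_gt0// ltr_wpDl ?normc_ge0// !addr_ge0 ?normc_ge0.
have eM0 : 0 < e / M by rewrite divr_gt0.
have [D D0 HD] := Fd _ eM0; have [D' D'0 HD'] := Gd _ eM0.
have [D2 D20 HD2] := cder_cont Gd eM0.
exists (Num.min D (Num.min D' D2)); first by rewrite !lt_min D0 D'0.
move=> h; rewrite !lt_min => /and3P[/HD h1 /HD' h2 /HD2 h3].
rewrite (_ : _ - _ = (F (z + h) - F z - d * h) * (G z + (G (z + h) - G z)) +
  F z * (G (z + h) - G z - d' * h) + d * h * (G (z + h) - G z)); last by ring.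
have q : forall x : R, x * 3 <= M -> e / M * normc h * x <= e * normc h / 3.
  move=> x xM; rewrite mulrAC [e / M * x]mulrAC [e * normc h / 3]mulrAC ler_wpM2r ?normc_ge0//.
  by rewrite ler_pdivrMr//; nra.
have nF := normc_ge0 (F z); have nG := normc_ge0 (G z); have nd := normc_ge0 d.
have nh := normc_ge0 h.
have eM1 : e / M <= e by rewrite ler_pdivrMr// ler_peMr ?(ltW e0)// /M; lra.
rewrite (_ : e * _ = e * normc h / 3 + e * normc h / 3 + e * normc h / 3); last by field.
rewrite (le_trans (normcD _ _))// lerD//; first rewrite (le_trans (normcD _ _))// lerD//.
- rewrite normcM (le_trans _ (q (normc (G z) + e) _))//; last by rewrite /M; lra.
  rewrite ler_pM ?normc_ge0// (le_trans (normcD _ _))// lerD//.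
  exact: le_trans h3 eM1.
- rewrite normcM mulrC (le_trans _ (q (normc (F z)) _))//; last by rewrite /M; lra.
  by rewrite ler_wpM2r.
- rewrite !normcM (le_trans _ (q (normc d) _))//; last by rewrite /M; lra.
  by rewrite -mulrA mulrC ler_wpM2r// mulrC ler_wpM2r.
Qed.

Lemma cder_comp F G z d d' : cder G z d -> cder F (G z) d' ->
  cder (fun w => F (G w)) z (d' * d).
Proof.
move=> Gd Fd e e0.
have nd := normc_ge0 d; have nd' := normc_ge0 d'.
pose M : R := 2 * (1 + normc d + normc d').
have M0 : 0 < M by rewrite /M; lra.
have eM0 : 0 < e / M by rewrite divr_gt0.
have [D D0 HD] := Fd _ eM0; have [D' D'0 HD'] := Gd _ eM0.
have [D3 D30 HD3] := Gd _ ltr01.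
have D0' : 0 < D / 2 by rewrite divr_gt0.
have [D2 D20 HD2] := cder_cont Gd D0'.
exists (Num.min D' (Num.min D2 D3)); first by rewrite !lt_min D'0 D20.
move=> h; rewrite !lt_min => /and3P[/HD' h1 /HD2 h2 /HD3 h3].
have := HD (G (z + h) - G z).
rewrite (le_lt_trans h2) ?ltr_pdivrMr ?ltr_pMr ?ltr1n// => /(_ isT).
rewrite [G z + _]addrC subrK => h4.
rewrite (_ : _ - _ = (F (G (z + h)) - F (G z) - d' * (G (z + h) - G z)) +
   d' * (G (z + h) - G z - d * h)); last by ring.
have q : forall x : R, x * 2 <= M -> e / M * normc h * x <= e * normc h / 2.
  move=> x xM; rewrite mulrAC [e / M * x]mulrAC [e * normc h / 2]mulrAC ler_wpM2r ?normc_ge0//.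
  by rewrite ler_pdivrMr//; nra.
rewrite [leRHS]splitr (le_trans (normcD _ _))// lerD//.
- rewrite (le_trans h4)//; rewrite (le_trans _ (q (1 + normc d) _))//; last by rewrite /M; lra.
  rewrite -[leRHS]mulrA ler_wpM2l ?(ltW eM0)// mulrDr mulr1.
  rewrite (_ : _ - _ = (G (z + h) - G z - d * h) + d * h); last by rewrite subrK.
  by rewrite mul1r in h3; rewrite (le_trans (normcD _ _))// normcM lerD// mulrC.
- rewrite normcM mulrC (le_trans _ (q (normc d') _))//; last by rewrite /M; lra.
  by rewrite ler_wpM2r ?normc_ge0.
Qed.

Lemma cderV z : z != 0 -> cder (fun w => w^-1) z (- (z ^+ 2)^-1).
Proof.
move=> z0 e e0; have nz := normc_gt0 z0.
pose D := Num.min (normc z / 2) (e * (normc z ^+ 3) / 2).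
exists D; first by rewrite lt_min !divr_gt0// mulr_gt0// exprn_gt0.
move=> h; rewrite lt_min => /andP[h1 h2].
have nzh : normc z / 2 <= normc (z + h).
  have : normc z <= normc (z + h) + normc h by rewrite -{1}[z](addrK h) normcB.
  lra.
have zh0 : z + h != 0.
  apply/eqP => zh; move: nzh; rewrite zh Normc.normc0; lra.
(* The remainder of the inverse is explicit. The first bound in [D] keeps [normc (z + h)] above
   [normc z / 2]; the second then makes the remainder at most [e * normc h]. *)
rewrite (_ : _ - _ = h ^+ 2 * (z ^+ 2 * (z + h))^-1); last first.
  by field; rewrite zh0 z0.
rewrite normcM normcX normcV normcM normcX expr2 -mulrA mulrC ler_wpM2r ?normc_ge0//.
rewrite ler_pdivrMr ?mulr_gt0 ?exprn_gt0 ?normc_gt0//.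
apply: (le_trans (ltW h2)); rewrite -mulrA ler_pM2l// exprSr -mulrA.
by rewrite ler_pM2l ?exprn_gt0.
Qed.

Lemma cder_near F G z d (r : R) : 0 < r ->
  (forall h, normc h < r -> F (z + h) = G (z + h)) -> cder F z d -> cder G z d.
Proof.
move=> r0 FG Fd e e0; have [D D0 HD] := Fd _ e0.
exists (Num.min D r); first by rewrite lt_min D0.
move=> h; rewrite lt_min => /andP[hD hr].
rewrite -FG// -[X in G X]addr0 -FG ?Normc.normc0// addr0; exact: HD.
Qed.

Lemma cder_eq F z d d' : cder F z d -> d = d' -> cder F z d'.
Proof. by move=> + <-. Qed.

Lemma cder_sharp F z d : cder F z^* d -> cder (sharp F) z d^*.
Proof.
move=> Fd e e0; have [D D0 HD] := Fd _ e0; exists D => // h hD.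
have := HD h^*; rewrite normcJ => /(_ hD) H.
by rewrite /sharp rmorphD -(normcJ (_ - _)) !rmorphB rmorphM /= !conjcK.
Qed.

Lemma cderN F z d : cder F z d -> cder (fun w => - F w) z (- d).
Proof.
move=> Fd; have := cderM (cder_cst (-1) z) Fd.
rewrite mul0r add0r mulN1r; apply: (@cder_near _ _ _ _ 1) => // h _.
by rewrite mulN1r.
Qed.

Lemma cderB F G z d d' : cder F z d -> cder G z d' ->
  cder (fun w => F w - G w) z (d - d').
Proof. by move=> Fd Gd; apply: cderD => //; exact: cderN. Qed.

Lemma cderX F z d n : cder F z d ->
  exists d', cder (fun w => F w ^+ n) z d'.
Proof.
move=> Fd; elim: n => [|n [d' IH]]; first by exists 0; exact: cder_cst.
exists (d * F z ^+ n + F z * d').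
by apply: (cder_near ltr01 _ (cderM Fd IH)) => h _; rewrite exprS.
Qed.

End complex_derivative.

(** * Integrals of continuous complex-valued functions over segments *)

Section complex_integral.
Context {R : realType}.
Implicit Types (f g : R -> R[i]) (a b c : R).

(** Continuity is two-sided even at the endpoints: the integrands are restrictions of functions that
    are continuous near the segment, and no subspace topology is needed. *)
Definition ccont f a b := forall t, a <= t <= b -> forall e : R, 0 < e ->
  exists2 D : R, 0 < D & forall s, `|s| < D -> normc (f (t + s) - f t) <= e.

Lemma ccontS f a b a' b' : a <= a' -> b' <= b -> ccont f a b -> ccont f a' b'.
Proof.
move=> aa bb fc t /andP[h1 h2]; apply: fc.
by rewrite (le_trans aa)//= (le_trans h2).
Qed.

Lemma ccontP f a b : ccont f a b <-> forall t, a <= t <= b ->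
  {for t, continuous (fun t => complex.Re (f t))} /\
  {for t, continuous (fun t => complex.Im (f t))}.
Proof.
split=> fc t tab.
  split; apply/cvgrPdist_le => e e0; have [D D0 HD] := fc _ tab _ e0;
  apply/nbhs_ballP; exists D => // s; rewrite /ball /= distrC => /HD;
  rewrite [t + _]addrC subrK => H; rewrite distrC (le_trans _ H)//.
    by rewrite (le_trans _ (normc_Re _))// raddfB.
  by rewrite (le_trans _ (normc_Im _))// raddfB.
move=> e e0; have [/cvgrPdist_le cr /cvgrPdist_le ci] := fc _ tab.
have e20 : 0 < e / 2 by rewrite divr_gt0.
have /nbhs_ballP[D D0 HD] := cr _ e20; have /nbhs_ballP[D' D'0 HD'] := ci _ e20.
exists (Num.min D D'); first by rewrite lt_min D0.
move=> s; rewrite lt_min => /andP[h1 h2].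
rewrite (le_trans (normc_le_ReIm _))// [leRHS]splitr lerD// raddfB /= distrC.
  by apply: HD; rewrite /ball /= opprD addNKr normrN.
by apply: HD'; rewrite /ball /= opprD addNKr normrN.
Qed.

Lemma ccont_cst (k : R[i]) a b : ccont (fun=> k) a b.
Proof. by move=> t _ e e0; exists 1 => // s _; rewrite subrr Normc.normc0 ltW. Qed.

Lemma ccontD f g a b : ccont f a b -> ccont g a b -> ccont (fun t => f t + g t) a b.
Proof.
move=> fc gc t tab e e0; have e20 : 0 < e / 2 by rewrite divr_gt0.
have [D D0 HD] := fc _ tab _ e20; have [D' D'0 HD'] := gc _ tab _ e20.
exists (Num.min D D'); first by rewrite lt_min D0.
move=> s; rewrite lt_min => /andP[/HD h1 /HD' h2].
rewrite (_ : _ - _ = (f (t + s) - f t) + (g (t + s) - g t)); last by ring.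
by rewrite (le_trans (normcD _ _))// [leRHS]splitr lerD.
Qed.

Lemma ccontM f g a b : ccont f a b -> ccont g a b -> ccont (fun t => f t * g t) a b.
Proof.
move=> fc gc t tab e e0.
pose M := 1 + normc (f t) + normc (g t) + e.
have nf := normc_ge0 (f t); have ng := normc_ge0 (g t).
have M0 : 0 < M by rewrite /M; lra.
have e20 : 0 < e / (2 * M) by rewrite divr_gt0// mulr_gt0.
have [D D0 HD] := fc _ tab _ e20; have [D' D'0 HD'] := gc _ tab _ e20.
exists (Num.min D D'); first by rewrite lt_min D0.
move=> s; rewrite lt_min => /andP[/HD h1 /HD' h2].
rewrite (_ : _ - _ = (f (t + s) - f t) * (g t + (g (t + s) - g t)) + f t * (g (t + s) - g t)); last by ring.
rewrite (le_trans (normcD _ _))// [leRHS]splitr lerD// normcM.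
- rewrite (_ : e / 2 = e / (2 * M) * M); last by field; rewrite gt_eqF.
  rewrite ler_pM ?normc_ge0// (le_trans (normcD _ _))//.
  have : e / (2 * M) <= e.
    by rewrite ler_pdivrMr ?mulr_gt0// ler_peMr ?(ltW e0)//; rewrite /M; lra.
  by rewrite /M => h; move: h2; rewrite /M; lra.
- rewrite (_ : e / 2 = M * (e / (2 * M))); last by field; rewrite gt_eqF.
  by rewrite ler_pM ?normc_ge0//; rewrite /M; lra.
Qed.

Lemma ccontN f a b : ccont f a b -> ccont (fun t => - f t) a b.
Proof.
move=> fc t tab e e0; have [D D0 HD] := fc _ tab _ e0; exists D => // s /HD.
by rewrite -opprD normcN.
Qed.

Lemma ccontB f g a b : ccont f a b -> ccont g a b -> ccont (fun t => f t - g t) a b.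
Proof. by move=> fc gc; apply: ccontD => //; exact: ccontN. Qed.

Lemma ccont_real (h : R -> R) a b : continuous h -> ccont (fun t => (h t)%:C) a b.
Proof.
move=> ch; apply/ccontP => t _; split => /=; first exact: ch.
exact: cvg_cst.
Qed.

Lemma ccont_comp (F : R[i] -> R[i]) f a b :
  (forall t, a <= t <= b -> exists d, cder F (f t) d) -> ccont f a b ->
  ccont (fun t => F (f t)) a b.
Proof.
move=> Fd fc t tab e e0; have [d /cder_cont/(_ _ e0)[D D0 HD]] := Fd _ tab.
have D20 : 0 < D / 2 by rewrite divr_gt0.
have [D' D'0 HD'] := fc _ tab _ D20; exists D' => // s /HD' h.
have := HD (f (t + s) - f t); rewrite [f t + _]addrC subrK; apply.
by rewrite (le_lt_trans h)// ltr_pdivrMr// ltr_pMr// ltr1n.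
Qed.

Lemma ccont_segment (z w : R[i]) a b : ccont (fun t => z + t%:C * w) a b.
Proof. by apply: ccontD; [exact: ccont_cst|apply: ccontM; [apply: (@ccont_real id) => x; exact: cvg_id|exact: ccont_cst]]. Qed.

Lemma ccont_ext f g a b : f =1 g -> ccont f a b -> ccont g a b.
Proof. by move=> /funext ->. Qed.

Definition RI a b (h : R -> R) : R := \int[leb R]_(t in `[a, b]) h t.

Lemma cont_integrable (h : R -> R) a b :
  (forall t, a <= t <= b -> {for t, continuous h}) ->
  (leb R).-integrable `[a, b] (EFin \o h).
Proof.
move=> hc; apply: continuous_compact_integrable; first exact: segment_compact.
apply: continuous_in_subspaceT => t; rewrite inE /= in_itv /=; exact: hc.
Qed.

Lemma RI_split (h : R -> R) a c b : a <= c -> c <= b ->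
  (forall t, a <= t <= b -> {for t, continuous h}) ->
  RI a b h = RI a c h + RI c b h.
Proof.
move=> ac cb hc; have hi := cont_integrable hc.
rewrite /RI; have := @Rintegral_itvB _ h (BLeft a) (BRight b) c hi.
rewrite !bnd_simp => /(_ ac cb) E.
rewrite -[X in _ = _ + X]Rintegral_itv_obnd_cbnd -?E 1?[RHS]addrC ?subrK//.
apply: integrableS hi => //.
by apply: subset_itvr; rewrite bnd_simp.
Qed.

Lemma RI_cst a b (r : R) : a <= b -> RI a b (fun=> r) = (b - a) * r.
Proof.
move=> ab; rewrite /RI Rintegral_cst//= lebesgue_measure_itv /= lte_fin mulrC.
case: ltP => //= ba; suff -> : b = a by rewrite subrr.
by apply/eqP; rewrite eq_le ba ab.
Qed.

Definition cint a b f : R[i] :=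
  RI a b (fun t => complex.Re (f t)) +i* RI a b (fun t => complex.Im (f t)).

Lemma ccont_Re f a b : ccont f a b -> forall t, a <= t <= b ->
  {for t, continuous (fun t => complex.Re (f t))}.
Proof. by move=> /ccontP fc t /fc[]. Qed.

Lemma ccont_Im f a b : ccont f a b -> forall t, a <= t <= b ->
  {for t, continuous (fun t => complex.Im (f t))}.
Proof. by move=> /ccontP fc t /fc[]. Qed.

Lemma cint_split f a c b : a <= c -> c <= b -> ccont f a b ->
  cint a b f = cint a c f + cint c b f.
Proof.
move=> ac cb fc; rewrite /cint (RI_split ac cb (ccont_Re fc)).
by rewrite (RI_split ac cb (ccont_Im fc)).
Qed.

Lemma cint_eq f g a b : (forall t, a <= t <= b -> f t = g t) ->
  cint a b f = cint a b g.
Proof.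
move=> fg; rewrite /cint /RI; congr (_ +i* _); apply: eq_Rintegral => t;
  by rewrite inE /= in_itv /= => /fg ->.
Qed.

Lemma cintD f g a b : ccont f a b -> ccont g a b ->
  cint a b (fun t => f t + g t) = cint a b f + cint a b g.
Proof.
move=> fc gc; rewrite /cint /RI.
have -> : (fun t => complex.Re (f t + g t)) = (fun t => complex.Re (f t) + complex.Re (g t)).
  by apply/funext => t; rewrite raddfD.
have -> : (fun t => complex.Im (f t + g t)) = (fun t => complex.Im (f t) + complex.Im (g t)).
  by apply/funext => t; rewrite raddfD.
rewrite RintegralD// ?RintegralD//; apply: cont_integrable.
- exact: ccont_Im.
- exact: ccont_Im.
- exact: ccont_Re.
- exact: ccont_Re.
Qed.

Lemma cintZ (k : R[i]) f a b : ccont f a b ->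
  cint a b (fun t => k * f t) = k * cint a b f.
Proof.
move=> fc; rewrite /cint /RI; case: k => u v.
have ir := cont_integrable (ccont_Re fc); have ii := cont_integrable (ccont_Im fc).
have -> : (fun t => complex.Re ((u +i* v) * f t)) = (fun t => u * complex.Re (f t) - v * complex.Im (f t)).
  by apply/funext => t; case: (f t).
have -> : (fun t => complex.Im ((u +i* v) * f t)) = (fun t => u * complex.Im (f t) + v * complex.Re (f t)).
  by apply/funext => t; case: (f t).
have iZ : forall (r : R) h, (leb R).-integrable `[a, b] (EFin \o h) ->
    (leb R).-integrable `[a, b] (EFin \o (fun t => r * h t)).
  by move=> r h ih; exact: (integrableZl _ _ ih).
rewrite RintegralB ?RintegralD ?RintegralZl//; try exact: iZ.
Qed.

Lemma cintN f a b : ccont f a b -> cint a b (fun t => - f t) = - cint a b f.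
Proof.
by move=> fc; rewrite -mulN1r -cintZ//; apply: cint_eq => t _; rewrite mulN1r.
Qed.

Lemma cintB f g a b : ccont f a b -> ccont g a b ->
  cint a b (fun t => f t - g t) = cint a b f - cint a b g.
Proof.
by move=> fc gc; rewrite cintD ?cintN//; exact: ccontN.
Qed.

Lemma cint_cst a b (k : R[i]) : a <= b -> cint a b (fun=> k) = (b - a)%:C * k.
Proof.
by move=> ab; rewrite /cint !RI_cst//; case: k => u v; simpc.
Qed.

(** The factor 2 comes from bounding real and imaginary parts separately; every later use tolerates
    it. *)
Lemma normc_cint_le f a b (M : R) : a <= b -> ccont f a b ->
  (forall t, a <= t <= b -> normc (f t) <= M) ->
  normc (cint a b f) <= 2 * (b - a) * M.
Proof.
move=> ab fc fM; rewrite (le_trans (normc_le_ReIm _))// -mulrA mulr2n mulrDl mul1r.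
have H (h : R -> R) : (forall t, a <= t <= b -> {for t, continuous h}) ->
    (forall t, a <= t <= b -> `|h t| <= M) -> `|RI a b h| <= (b - a) * M.
  move=> hc hM; rewrite -RI_cst// (le_trans (le_normr_Rintegral _ _))//.
    exact: cont_integrable.
  apply: le_Rintegral => //.
  - by apply: cont_integrable => t /hc ht; apply: continuous_comp => //; exact: norm_continuous.
  - by apply: cont_integrable => t _; exact: cvg_cst.
apply: lerD; apply: H.
- exact: ccont_Re.
- by move=> t /fM; apply: le_trans; exact: normc_Re.
- exact: ccont_Im.
- by move=> t /fM; apply: le_trans; exact: normc_Im.
Qed.

(** Unlike the bound by a supremum, this one can be integrated over a family of contours, as the
    mean value inequality requires. *)
Lemma normc_cint_int f a b : a <= b -> ccont f a b ->
  ((normc (cint a b f))%:E <= 2%:E * \int[leb R]_(t in `[a, b]) (normc (f t))%:E)%E.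
Proof.
move=> ab fc; rewrite (@le_trans _ _ (`|complex.Re (cint a b f)| + `|complex.Im (cint a b f)|)%:E)//.
  by rewrite lee_fin normc_le_ReIm.
rewrite EFinD (_ : 2%:E = 1 + 1)%E// ge0_muleDl// !mul1e.
have mn0 : measurable_fun (T:=measurableTypeR R) (U := measurableTypeR R) `[a, b] (fun t => normc (f t)).
  have -> : (fun t => normc (f t)) = (fun t => Num.sqrt (complex.Re (f t) ^+ 2 + complex.Im (f t) ^+ 2)).
    by apply/funext => t; case: (f t).
  apply: (@measurableT_comp _ _ _ _ _ _ (@Num.sqrt R)).
    exact: (measurable_realfun.continuous_measurable_fun (@sqrt_continuous R)).
  by apply: measurable_funD; apply: measurable_funX; apply/measurable_EFinP;
    apply: measurable_int; apply: cont_integrable;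
    [exact: ccont_Re|exact: ccont_Im].
have mn : measurable_fun (T:=measurableTypeR R) (U := \bar R) `[a, b] (EFin \o (fun t => normc (f t))).
  exact/measurable_EFinP.
have H (h : R -> R) : (forall t, a <= t <= b -> {for t, continuous h}) ->
    (forall t, a <= t <= b -> `|h t| <= normc (f t)) ->
    (`|RI a b h|%:E <= \int[leb R]_(t in `[a, b]) (normc (f t))%:E)%E.
  move=> hc hM; have ih := cont_integrable hc.
  rewrite EFin_normr_Rintegral//; apply: (le_trans (le_abse_integral _ _ _)) => //.
    exact: measurable_int ih.
  apply: ge0_le_integral => //.
  by apply: measurableT_comp => //; exact: measurable_int ih.
apply: leeD; apply: H.
- exact: ccont_Re.
- by move=> t _; exact: normc_Re.
- exact: ccont_Im.
- by move=> t _; exact: normc_Im.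
Qed.

Lemma RI_id a b : a <= b -> RI a b id = (b ^+ 2 - a ^+ 2) / 2.
Proof.
rewrite le_eqVlt => /predU1P[->|ab].
  by rewrite subrr mul0r /RI set_itv1 Rintegral_set1.
rewrite /RI /Rintegral (@continuous_FTC2 _ id (fun x => x ^+ 2 / 2))//.
- by rewrite /= mulrBl.
- by apply: continuous_subspaceT => x; exact: cvg_id.
- split.
  + by move=> x _; apply: derivableM => //; exact: exprn_derivable.
  + apply: cvg_at_right_filter; apply: cvgM; last exact: cvg_cst.
    exact: exprn_continuous.
  + apply: cvg_at_left_filter; apply: cvgM; last exact: cvg_cst.
    exact: exprn_continuous.
- move=> x _; rewrite derive1E; apply: derive_val; apply: is_derive_eq.
  by rewrite /GRing.scale /=; field.
Qed.

Lemma cint_real (h : R -> R) a b : cint a b (fun t => (h t)%:C) = (RI a b h)%:C.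
Proof.
rewrite /cint /=; congr (_ +i* _); rewrite /RI /Rintegral.
by rewrite (_ : (fun=> 0%:E) = cst 0%E)// integral0.
Qed.

End complex_integral.

(** * Induction on rectangles by bisection *)

Section rectangles.
Context {R : realType}.
Implicit Types (a b c d : R).

Lemma bisect_le a b : a <= b -> a <= (a + b) / 2 /\ (a + b) / 2 <= b.
Proof. by move=> ab; split; lra. Qed.

(** Compactness in the form of nested bisection: a rectangle without [P] has a quarter without [P],
    and these shrink to a point where the local hypothesis applies. Degenerate rectangles are
    allowed, so it also serves for intervals. *)
Lemma rectangle_induction (P : R -> R -> R -> R -> Prop) a b c d :
  a <= b -> c <= d ->
  (forall a b c d, a <= b -> c <= d ->
    P a ((a + b) / 2) c ((c + d) / 2) -> P ((a + b) / 2) b c ((c + d) / 2) ->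
    P a ((a + b) / 2) ((c + d) / 2) d -> P ((a + b) / 2) b ((c + d) / 2) d ->
    P a b c d) ->
  (forall x y, a <= x <= b -> c <= y <= d -> exists2 D, 0 < D &
     forall a' b' c' d', a <= a' -> a' <= x -> x <= b' -> b' <= b ->
       c <= c' -> c' <= y -> y <= d' -> d' <= d ->
       b' - a' < D -> d' - c' < D -> P a' b' c' d') ->
  P a b c d.
Proof.
move=> ab cd Hsplit Hloc; apply: contrapT => nP.
pose T := (R * R * R * R)%type.
pose bad (q : T) := let: (a, b, c, d) := q in [/\ a <= b, c <= d & ~ P a b c d].
pose sub (q q' : T) := let: (a, b, c, d) := q in let: (a', b', c', d') := q' in
  [/\ a <= a', b' <= b, c <= c', d' <= d &
     b' - a' = (b - a) / 2 /\ d' - c' = (d - c) / 2].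
(* The implication under the existential makes the successor total, so that it can be chosen as a
   function and iterated. *)
have next q : exists q', bad q -> bad q' /\ sub q q'.
  case: (pselect (bad q)) => [|?]; last by exists q.
  move: q => [[[a1 b1] c1] d1] [ab1 cd1 nP1].
  have [h1 h2] := bisect_le ab1; have [h3 h4] := bisect_le cd1.
  apply: contrapT => H; apply: nP1; apply: Hsplit => //;
    apply: contrapT => nP1; apply: H.
  - by exists (a1, (a1 + b1) / 2, c1, (c1 + d1) / 2) => _; split => //; split => //; split; lra.
  - by exists ((a1 + b1) / 2, b1, c1, (c1 + d1) / 2) => _; split => //; split => //; split; lra.
  - by exists (a1, (a1 + b1) / 2, (c1 + d1) / 2, d1) => _; split => //; split => //; split; lra.
  - by exists ((a1 + b1) / 2, b1, (c1 + d1) / 2, d1) => _; split => //; split => //; split; lra.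
have [nxt Hnxt] := choice next.
pose u n := iter n nxt (a, b, c, d).
have ubad n : bad (u n).
  by elim: n => [|n IH]; [split|exact: (Hnxt _ IH).1].
pose A n := (u n).1.1.1; pose B n := (u n).1.1.2; pose C n := (u n).1.2; pose D n := (u n).2.
have uE n : u n = (A n, B n, C n, D n) by rewrite /A /B /C /D; case: (u n) => [[[]]].
have AB n : A n <= B n by have := ubad n; rewrite uE => -[].
have CD n : C n <= D n by have := ubad n; rewrite uE => -[].
have nPn n : ~ P (A n) (B n) (C n) (D n) by have := ubad n; rewrite uE => -[].
have step n : [/\ A n <= A n.+1, B n.+1 <= B n, C n <= C n.+1, D n.+1 <= D n &
     B n.+1 - A n.+1 = (B n - A n) / 2 /\ D n.+1 - C n.+1 = (D n - C n) / 2].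
  by have := (Hnxt _ (ubad n)).2; rewrite -[nxt _]/(u n.+1) !uE.
have mA : {homo A : m n / (m <= n)%N >-> m <= n}.
  by apply: homo_leq => // [x y z|n]; [exact: le_trans|have [] := step n].
have mC : {homo C : m n / (m <= n)%N >-> m <= n}.
  by apply: homo_leq => // [x y z|n]; [exact: le_trans|have [] := step n].
have mB : {homo B : m n / (m <= n)%N >-> n <= m}.
  by apply: (homo_leq (r := fun x y => y <= x)) => // [x y z|n]; [move=> yx zy; exact: le_trans zy yx|have [] := step n].
have mD : {homo D : m n / (m <= n)%N >-> n <= m}.
  by apply: (homo_leq (r := fun x y => y <= x)) => // [x y z|n]; [move=> yx zy; exact: le_trans zy yx|have [] := step n].
have AmBn m n : A m <= B n.
  case: (leqP m n) => mn; first by rewrite (le_trans (mA _ _ mn)).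
  by rewrite (le_trans (AB m))// mB// ltnW.
have CmDn m n : C m <= D n.
  case: (leqP m n) => mn; first by rewrite (le_trans (mC _ _ mn)).
  by rewrite (le_trans (CD m))// mD// ltnW.
(* The nested bad rectangles share the point [(x, y)]; one of them is small enough for the local
   hypothesis there. *)
pose x := sup (range A); pose y := sup (range C).
have xA n : A n <= x by apply: ub_le_sup; [exists (B 0%N) => _ [m _ <-]|exists n].
have yC n : C n <= y by apply: ub_le_sup; [exists (D 0%N) => _ [m _ <-]|exists n].
have xB n : x <= B n by apply: ge_sup; [exists (A 0%N); exists 0%N|move=> _ [m _ <-]].
have yD n : y <= D n by apply: ge_sup; [exists (C 0%N); exists 0%N|move=> _ [m _ <-]].
have [|| del del0 Hdel] := Hloc x y; [by rewrite (xA 0%N) (xB 0%N)|by rewrite (yC 0%N) (yD 0%N)|].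
have size n : B n - A n = (b - a) / 2 ^+ n /\ D n - C n = (d - c) / 2 ^+ n.
  elim: n => [|n [IH1 IH2]]; first by rewrite expr0 !divr1.
  have [_ _ _ _ [-> ->]] := step n; rewrite IH1 IH2 exprSr invfM !mulrA.
  by split; rewrite mulrAC.
(* Since [n < 2 ^ n], both sides are shorter than [del] after [n] bisections. *)
pose n := (Num.truncn (((b - a) + (d - c)) / del)).+1.
have n0 : 0 < 2 ^+ n :> R by rewrite exprn_gt0.
have hn : (b - a) + (d - c) < del * 2 ^+ n.
  rewrite mulrC -ltr_pdivrMr// (@lt_le_trans _ _ n%:R)// ?truncnS_gt//.
  by rewrite -natrX ler_nat ltnW// ltn_expl.
apply: (nPn n); apply: Hdel => //.
- exact: (mA 0%N).
- exact: (mB 0%N).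
- exact: (mC 0%N).
- exact: (mD 0%N).
- by rewrite (size n).1 ltr_pdivrMr//; lra.
- by rewrite (size n).2 ltr_pdivrMr//; lra.
Qed.

End rectangles.

(** * Contour integrals over rectangles and Goursat's theorem *)

Section contour.
Context {R : realType}.
Implicit Types (a b c d x y : R) (f g : R[i] -> R[i]).

(** Continuity is asked on the four sides only, because the Cauchy kernels have a pole inside. *)
Definition frame f a b c d := [/\
  ccont (fun t => f (t +i* c)) a b, ccont (fun t => f (t +i* d)) a b,
  ccont (fun t => f (a +i* t)) c d & ccont (fun t => f (b +i* t)) c d].

(** Counterclockwise: bottom, right, top, left; the factors ['i] are the derivative of the
    parametrisation of the vertical sides. *)
Definition contour f a b c d : R[i] :=
  cint a b (fun t => f (t +i* c)) + 'i * cint c d (fun t => f (b +i* t))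
  - cint a b (fun t => f (t +i* d)) - 'i * cint c d (fun t => f (a +i* t)).

Lemma complex_split x y : x +i* y = x%:C + y%:C * 'i :> R[i].
Proof. by simpc. Qed.

Lemma ccont_horizontal f a b y :
  (forall x, a <= x <= b -> exists k, cder f (x +i* y) k) ->
  ccont (fun t => f (t +i* y)) a b.
Proof.
move=> fd; apply: ccont_comp => //; apply: (@ccont_ext _ (fun t => (0 +i* y) + t%:C * 1)).
  by move=> t; simpc.
exact: ccont_segment.
Qed.

Lemma ccont_vertical f c d x :
  (forall y, c <= y <= d -> exists k, cder f (x +i* y) k) ->
  ccont (fun t => f (x +i* t)) c d.
Proof.
move=> fd; apply: ccont_comp => //; apply: (@ccont_ext _ (fun t => (x +i* 0) + t%:C * 'i)).
  by move=> t; simpc.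
exact: ccont_segment.
Qed.

Definition cder_on f a b c d := forall x y, a <= x <= b -> c <= y <= d ->
  exists k, cder f (x +i* y) k.

Lemma cder_onS f a b c d a' b' c' d' : a <= a' -> b' <= b -> c <= c' -> d' <= d ->
  cder_on f a b c d -> cder_on f a' b' c' d'.
Proof.
move=> aa bb cc dd fd x y /andP[h1 h2] /andP[h3 h4]; apply: fd.
  by rewrite (le_trans aa)//= (le_trans h2).
by rewrite (le_trans cc)//= (le_trans h4).
Qed.

Lemma cder_on_frame f a b c d : a <= b -> c <= d -> cder_on f a b c d -> frame f a b c d.
Proof.
move=> ab cd fd; split.
- by apply: ccont_horizontal => x xab; apply: fd => //; rewrite lexx.
- by apply: ccont_horizontal => x xab; apply: fd => //; rewrite lexx cd.
- by apply: ccont_vertical => y ycd; apply: fd => //; rewrite lexx.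
- by apply: ccont_vertical => y ycd; apply: fd => //; rewrite lexx ab.
Qed.

Lemma contourB f g a b c d : frame f a b c d -> frame g a b c d ->
  contour (fun z => f z - g z) a b c d = contour f a b c d - contour g a b c d.
Proof.
by move=> [f1 f2 f3 f4] [g1 g2 g3 g4]; rewrite /contour !cintB//; ring.
Qed.

Lemma contourZ k f a b c d : frame f a b c d ->
  contour (fun z => k * f z) a b c d = k * contour f a b c d.
Proof.
by move=> [f1 f2 f3 f4]; rewrite /contour !cintZ//; ring.
Qed.

Lemma contour_vsplit f a m b c d : a <= m -> m <= b ->
  ccont (fun t => f (t +i* c)) a b -> ccont (fun t => f (t +i* d)) a b ->
  contour f a b c d = contour f a m c d + contour f m b c d.
Proof.
by move=> am mb fc fd; rewrite /contour (cint_split am mb fc) (cint_split am mb fd); ring.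
Qed.

Lemma contour_hsplit f a b c m d : c <= m -> m <= d ->
  ccont (fun t => f (a +i* t)) c d -> ccont (fun t => f (b +i* t)) c d ->
  contour f a b c d = contour f a b c m + contour f a b m d.
Proof.
by move=> am mb fc fd; rewrite /contour (cint_split am mb fc) (cint_split am mb fd); ring.
Qed.

Lemma normc_i : normc ('i : R[i]) = 1.
Proof. by rewrite /= expr0n expr1n add0r sqrtr1. Qed.

Lemma normc_contour_le f a b c d (M : R) : a <= b -> c <= d -> frame f a b c d ->
  (forall t, a <= t <= b -> normc (f (t +i* c)) <= M /\ normc (f (t +i* d)) <= M) ->
  (forall t, c <= t <= d -> normc (f (a +i* t)) <= M /\ normc (f (b +i* t)) <= M) ->
  normc (contour f a b c d) <= 4 * ((b - a) + (d - c)) * M.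
Proof.
move=> ab cd [f1 f2 f3 f4] h1 h2; rewrite /contour.
have q1 := normc_cint_le ab f1 (fun t ht => (h1 t ht).1).
have q2 := normc_cint_le ab f2 (fun t ht => (h1 t ht).2).
have q3 := normc_cint_le cd f3 (fun t ht => (h2 t ht).1).
have q4 := normc_cint_le cd f4 (fun t ht => (h2 t ht).2).
rewrite (le_trans (normcB _ _))// normcM normc_i mul1r.
rewrite (_ : 4 * _ * M = 2 * (b - a) * M + 2 * (d - c) * M + 2 * (b - a) * M + 2 * (d - c) * M); last by ring.
rewrite lerD// (le_trans (normcB _ _))// lerD// (le_trans (normcD _ _))// lerD//.
by rewrite normcM normc_i mul1r.
Qed.

Lemma contour_id a b c d : a <= b -> c <= d -> contour id a b c d = 0.
Proof.
move=> ab cd.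
have cid p q : ccont (fun t : R => t%:C) p q by apply: (@ccont_real _ id) => x; exact: cvg_id.
have h y : cint a b (fun t => t +i* y) = ((b ^+ 2 - a ^+ 2) / 2)%:C + (b - a)%:C * (y%:C * 'i).
  rewrite (cint_eq (g := fun t => t%:C + y%:C * 'i)); last by move=> t _; exact: complex_split.
  rewrite cintD//; last exact: ccont_cst.
  by rewrite (cint_real id) RI_id// cint_cst.
have v x : cint c d (fun t => x +i* t) = (d - c)%:C * x%:C + 'i * ((d ^+ 2 - c ^+ 2) / 2)%:C.
  rewrite (cint_eq (g := fun t => x%:C + 'i * t%:C)); last by move=> t _; simpc.
  rewrite cintD//; [|exact: ccont_cst|by apply: ccontM => //; exact: ccont_cst].
  by rewrite cintZ// (cint_real id) RI_id// cint_cst.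
by rewrite /contour !h !v; simpc; congr (_ +i* _); ring.
Qed.

Lemma contour_cst k a b c d : a <= b -> c <= d -> contour (fun=> k) a b c d = 0.
Proof. by move=> ab cd; rewrite /contour !cint_cst//; ring. Qed.

Lemma normc_sub_le x y x' y' a b c d : a <= x <= b -> c <= y <= d ->
  a <= x' <= b -> c <= y' <= d ->
  normc ((x' +i* y') - (x +i* y) : R[i]) <= (b - a) + (d - c).
Proof.
move=> /andP[h1 h2] /andP[h3 h4] /andP[h5 h6] /andP[h7 h8].
rewrite (le_trans (normc_le_ReIm _))//= lerD// ler_norml; apply/andP; split; lra.
Qed.

(** A bound by [e] times the squared half-perimeter is inherited from the four quarters. It holds
    for small rectangles because the affine approximation of [f] has contour integral 0. *)
Lemma goursat f a b c d : a <= b -> c <= d -> cder_on f a b c d ->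
  contour f a b c d = 0.
Proof.
move=> ab cd fd.
suff H e : 0 < e -> normc (contour f a b c d) <= e * ((b - a) + (d - c)) ^+ 2.
  apply: Normc.eq0_normc; apply/eqP; rewrite eq_le normc_ge0 andbT.
  apply/ler_addgt0Pl => e e0; rewrite addr0.
  pose s := 1 + ((b - a) + (d - c)) ^+ 2.
  have s0 : 0 < s by rewrite /s ltr_pwDl// sqr_ge0.
  rewrite (le_trans (H (e / s) _)) ?divr_gt0// mulrAC ler_pdivrMr// ler_pM2l//.
  by rewrite /s lerDr.
move=> e0.
(* The inclusions belong to the predicate, because the induction ranges over all rectangles and [f]
   is known only on the given one. *)
pose P a' b' c' d' := a <= a' -> b' <= b -> c <= c' -> d' <= d ->
  normc (contour f a' b' c' d') <= e * ((b' - a') + (d' - c')) ^+ 2.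
suff : P a b c d by apply.
apply: rectangle_induction => //.
  move=> a1 b1 c1 d1 ab1 cd1 H1 H2 H3 H4 aa bb cc dd.
  have [h1 h2] := bisect_le ab1; have [h3 h4] := bisect_le cd1.
  set m := (a1 + b1) / 2; set n := (c1 + d1) / 2.
  have fd1 := cder_onS aa bb cc dd fd.
  have [f1 f2 f3 f4] := cder_on_frame ab1 cd1 fd1.
  have fdm : ccont (fun t : R => f (m +i* t)) c1 d1.
    by apply: ccont_vertical => y ycd; apply: fd1 => //; rewrite h1 h2.
  rewrite (contour_vsplit h1 h2)// !(contour_hsplit h3 h4)//.
  have {}H1 := H1 aa (le_trans h2 bb) cc (le_trans h4 dd).
  have {}H2 := H2 (le_trans aa h1) bb cc (le_trans h4 dd).
  have {}H3 := H3 aa (le_trans h2 bb) (le_trans cc h3) dd.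
  have {}H4 := H4 (le_trans aa h1) bb (le_trans cc h3) dd.
  (* Each quarter has half the half-perimeter [s], and [4 (s / 2)^2 = s^2]. *)
  have -> : e * (b1 - a1 + (d1 - c1)) ^+ 2 =
    e * (m - a1 + (n - c1)) ^+ 2 + e * (m - a1 + (d1 - n)) ^+ 2 +
    (e * (b1 - m + (n - c1)) ^+ 2 + e * (b1 - m + (d1 - n)) ^+ 2).
    by rewrite /m /n; field.
  by rewrite (le_trans (normcD _ _))// lerD// (le_trans (normcD _ _))// lerD.
move=> x y xab ycd; have [k fk] := fd _ _ xab ycd.
have e40 : 0 < e / 4 by rewrite divr_gt0.
have [D D0 HD] := fk _ e40; exists (D / 2); first by rewrite divr_gt0.
move=> a1 b1 c1 d1 aa h1 h2 bb cc h3 h4 dd s1 s2 _ _ _ _.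
have ab1 := le_trans h1 h2; have cd1 := le_trans h3 h4.
have fr := cder_on_frame ab1 cd1 (cder_onS aa bb cc dd fd).
pose z : R[i] := x +i* y.
pose g w := f z + k * (w - z).
have frA (l m : R[i]) : frame (fun w => l + m * w) a1 b1 c1 d1.
  apply: cder_on_frame => // u v _ _; exists (0 + (0 * (u +i* v) + m * 1)).
  by apply: cderD; [exact: cder_cst|apply: cderM; [exact: cder_cst|exact: cder_id]].
have gE : g = fun w => (f z - k * z) + k * w by apply/funext => w; rewrite /g; ring.
have frg : frame g a1 b1 c1 d1 by rewrite gE.
have Jg : contour g a1 b1 c1 d1 = 0.
  have E : g = fun w => k * w - (k * z - f z) by apply/funext => w; rewrite /g; ring.
  rewrite E contourB.
  - rewrite contourZ ?contour_id ?contour_cst ?mulr0 ?subr0//.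
    by have := frA 0 1; under [X in frame X]eq_fun do rewrite add0r mul1r.
  - by have := frA 0 k; under [X in frame X]eq_fun do rewrite add0r.
  - by have := frA (k * z - f z) 0; under [X in frame X]eq_fun do rewrite mul0r addr0.
pose s := (b1 - a1) + (d1 - c1).
have -> : contour f a1 b1 c1 d1 = contour (fun w => f w - g w) a1 b1 c1 d1.
  by rewrite contourB// Jg subr0.
have s0 : 0 <= s by rewrite /s; lra.
have rle u v : a1 <= u <= b1 -> c1 <= v <= d1 ->
    normc (f (u +i* v) - g (u +i* v)) <= e / 4 * s.
  move=> hu hv; have := @normc_sub_le x y u v a1 b1 c1 d1; rewrite h1 h2 h3 h4 => /(_ isT isT hu hv).
  rewrite -/z -/s => hs; have := HD ((u +i* v) - z).
  have -> : z + (u +i* v - z) = u +i* v by rewrite addrC subrK.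
  have -> : f (u +i* v) - f z - k * (u +i* v - z) = f (u +i* v) - g (u +i* v) by rewrite /g; ring.
  move=> H; rewrite (le_trans (H _))//; last by rewrite ler_wpM2l// ltW.
  by rewrite (le_lt_trans hs)// /s; lra.
have -> : e * (b1 - a1 + (d1 - c1)) ^+ 2 = 4 * s * (e / 4 * s) by rewrite /s; field.
apply: normc_contour_le => //.
- case: fr frg => [f1 f2 f3 f4] [g1 g2 g3 g4]; split; exact: ccontB.
- by move=> t ht; split; apply: rle => //; rewrite lexx ?cd1.
- by move=> t ht; split; apply: rle => //; rewrite lexx ?ab1.
Qed.

End contour.

(** * Shrinking a contour to a small square, and the integral of the inverse *)

Section cauchy.
Context {R : realType}.
Implicit Types (a b c d x y : R) (f g F : R[i] -> R[i]) (z w h : R[i]).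

Definition on_frame a b c d z :=
  (a <= complex.Re z <= b) /\ (complex.Im z = c \/ complex.Im z = d) \/
  (c <= complex.Im z <= d) /\ (complex.Re z = a \/ complex.Re z = b).

Lemma normc_contour_on_frame f a b c d (M : R) : a <= b -> c <= d -> frame f a b c d ->
  (forall z, on_frame a b c d z -> normc (f z) <= M) ->
  normc (contour f a b c d) <= 4 * ((b - a) + (d - c)) * M.
Proof.
move=> ab cd fr H; apply: normc_contour_le => // t ht; split; apply: H.
- by left; split => //; left.
- by left; split => //; right.
- by right; split => //; left.
- by right; split => //; right.
Qed.

Lemma on_frame_rect a b c d z : a <= b -> c <= d -> on_frame a b c d z ->
  (a <= complex.Re z <= b) /\ (c <= complex.Im z <= d).
Proof.
by move=> ab cd [[h1 [->|->]]|[h1 [->|->]]]; split => //; rewrite lexx ?ab ?cd.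
Qed.

Lemma contour_ext f g a b c d : a <= b -> c <= d ->
  (forall z, on_frame a b c d z -> f z = g z) ->
  contour f a b c d = contour g a b c d.
Proof.
move=> ab cd fg; rewrite /contour; congr (_ + 'i * _ - _ - 'i * _); apply: cint_eq => t ht; apply: fg.
- by left; split => //; left.
- by right; split => //; right.
- by left; split => //; right.
- by right; split => //; left.
Qed.

Lemma frameM f g a b c d : frame f a b c d -> frame g a b c d ->
  frame (fun z => f z * g z) a b c d.
Proof. by move=> [? ? ? ?] [? ? ? ?]; split; exact: ccontM. Qed.

Lemma frameB f g a b c d : frame f a b c d -> frame g a b c d ->
  frame (fun z => f z - g z) a b c d.
Proof. by move=> [? ? ? ?] [? ? ? ?]; split; exact: ccontB. Qed.

Lemma frame_cder f a b c d : (forall z, on_frame a b c d z -> exists k, cder f z k) ->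
  frame f a b c d.
Proof.
move=> H; split.
- by apply: ccont_horizontal => t ht; apply: H; left; split => //; left.
- by apply: ccont_horizontal => t ht; apply: H; left; split => //; right.
- by apply: ccont_vertical => t ht; apply: H; right; split => //; left.
- by apply: ccont_vertical => t ht; apply: H; right; split => //; right.
Qed.

(* The rectangle minus the small square splits into four rectangles. *)
Lemma contour_excision f a b c d x y (e : R) : 0 < e ->
  a <= x - e -> x + e <= b -> c <= y - e -> y + e <= d ->
  cder_on f a b c (y - e) -> cder_on f a b (y + e) d ->
  cder_on f a (x - e) (y - e) (y + e) -> cder_on f (x + e) b (y - e) (y + e) ->
  contour f a b c d = contour f (x - e) (x + e) (y - e) (y + e).
Proof.
move=> e0 ax xb cy yd Hb Ht Hl Hr.
have ab : a <= b by lra.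
have h1 : y - e <= y + e by lra.
have h2 : x - e <= x + e by lra.
have yd' : y - e <= d by lra.
have xb' : x - e <= b by lra.
have glue u : a <= u <= b -> (u <= x - e) || (x + e <= u) ->
    ccont (fun t => f (u +i* t)) c d.
  move=> hu hux; apply: ccont_vertical => t ht.
  case: (leP t (y - e)) => ty1; first by apply: Hb => //; move/andP: ht => [-> _].
  case: (leP (y + e) t) => ty2; first by apply: Ht => //; move/andP: ht => [_ ->]; rewrite ty2.
  have tt : y - e <= t <= y + e by rewrite !ltW.
  move/andP: hu => [u1 u2].
  by case/orP: hux => hux; [apply: Hl|apply: Hr] => //; rewrite ?u1 ?u2 ?hux.
have vc u : c <= u <= d -> (u <= y - e) || (y + e <= u) ->
    ccont (fun t => f (t +i* u)) a b.
  move=> /andP[u1 u2] huy; apply: ccont_horizontal => t ht.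
  by case/orP: huy => huy; [apply: Hb|apply: Ht] => //; rewrite ?u1 ?u2 ?huy.
have ga := glue a; have gb := glue b.
rewrite (contour_hsplit cy yd'); [|by apply: ga; rewrite ?lexx ?ab ?ax|by apply: gb; rewrite ?lexx ?ab ?xb ?orbT].
rewrite (goursat _ _ Hb)// add0r.
have cs u p q : c <= p -> q <= d -> a <= u <= b -> (u <= x - e) || (x + e <= u) ->
    ccont (fun t => f (u +i* t)) p q.
  by move=> cp qd hu hux; apply: ccontS (glue u hu hux).
rewrite (contour_hsplit h1 yd);
  [|by apply: cs; rewrite ?lexx ?ab ?ax|by apply: cs; rewrite ?lexx ?ab ?xb ?orbT].
rewrite (goursat _ _ Ht)// addr0.
have v1 : ccont (fun t => f (t +i* (y - e))) a b by apply: vc; rewrite ?lexx// cy yd'.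
have v2 : ccont (fun t => f (t +i* (y + e))) a b.
  by apply: vc; rewrite ?lexx ?orbT// yd andbT; lra.
rewrite (contour_vsplit ax xb')// (goursat _ _ Hl)// add0r.
rewrite (contour_vsplit h2 xb); [|exact: ccontS v1|exact: ccontS v2].
by rewrite (goursat _ _ Hr)// addr0.
Qed.

Lemma contour_excision_at f a b c d x y (e : R) : 0 < e ->
  a <= x - e -> x + e <= b -> c <= y - e -> y + e <= d ->
  (forall u v, a <= u <= b -> c <= v <= d -> u +i* v != x +i* y ->
     exists k, cder f (u +i* v) k) ->
  contour f a b c d = contour f (x - e) (x + e) (y - e) (y + e).
Proof.
move=> e0 ax xb cy yd H.
apply: contour_excision => // u v /andP[u1 u2] /andP[v1 v2];
  (apply: H; [lra|lra|]); apply/eqP => -[? ?]; lra.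
Qed.

Lemma cder_inv_sub w z : z != w -> exists k, cder (fun z => (z - w)^-1) z k.
Proof.
move=> zw; have zw0 : z - w != 0 by rewrite subr_eq0.
have hs : cder (fun z => z - w) z (1 - 0) by apply: cderB; [exact: cder_id|exact: cder_cst].
by eexists; exact: (cder_comp hs (cderV zw0)).
Qed.

(** The value is 2 pi i, but the lower bound 4 needs no arctangent: opposite sides combine to the
    integrand [2 e / ((t - x)^2 + e^2)], which is at least [1 / e] on an interval of length [2 e],
    and there are two such pairs. *)
Lemma contour_inv_square x y (e : R) : 0 < e ->
  exists2 k : R, 4 <= k &
    contour (fun z => (z - (x +i* y))^-1) (x - e) (x + e) (y - e) (y + e) = 'i * k%:C.
Proof.
move=> e0; set w : R[i] := x +i* y.
have he : x - e <= x + e by lra.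
have he' : y - e <= y + e by lra.
have [f1 f2 f3 f4] : frame (fun z => (z - w)^-1) (x - e) (x + e) (y - e) (y + e).
  apply: frame_cder => z hz; apply: cder_inv_sub; apply/eqP => zw.
  by move: hz; rewrite zw /w /on_frame /=; case=> -[/andP[h1 h2] [h|h]]; lra.
pose g (x t : R) : R := ((t - x) ^+ 2 + e ^+ 2)^-1.
have gden x1 t : 0 < (t - x1) ^+ 2 + e ^+ 2 by rewrite ltr_wpDl ?sqr_ge0// exprn_gt0.
have gc x1 : continuous (g x1).
  move=> t; apply: cvgV; first by rewrite gt_eqF.
  apply: cvgD; last exact: cvg_cst.
  apply: (@continuous_comp _ _ _ (fun t : R => t - x1) (fun t => t ^+ 2)); last exact: exprn_continuous.
  by apply: cvgB; [exact: cvg_id|exact: cvg_cst].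
have gI x1 : 2 * e * (RI (x1 - e) (x1 + e) (g x1)) >= 2.
  have E : 2 = 2 * e * (((x1 + e) - (x1 - e)) * (2 * e ^+ 2)^-1) by field; rewrite gt_eqF.
  rewrite {}[leLHS]E ler_pM2l ?mulr_gt0// -RI_cst; last by lra.
  apply: le_Rintegral => //.
  - by apply: cont_integrable => t _; exact: cvg_cst.
  - by apply: cont_integrable => t _; exact: gc.
  - move=> t; rewrite /= in_itv /= => /andP[t1 t2].
    rewrite lef_pV2 ?posrE ?mulr_gt0 ?exprn_gt0//.
    by rewrite mulr2n mulrDl mul1r lerD2r; nra.
exists (2 * e * RI (x - e) (x + e) (g x) + 2 * e * RI (y - e) (y + e) (g y)).
  by rewrite (_ : 4 = 2 + 2) ?lerD//; ring.
have i2 : 'i * 'i = -1 :> R[i] by rewrite -expr2 sqr_i.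
have realC (r : R) : r != 0 -> r%:C != 0 :> R[i] by move=> r0; rewrite eq_complex /= eqxx andbT.
have sq (s t : R) : s ^+ 2 + e ^+ 2 = t -> 0 < t ->
  [/\ s%:C - e%:C * 'i != 0 :> R[i], s%:C + e%:C * 'i != 0 :> R[i] &
    (t^-1)%:C = ((s%:C - e%:C * 'i) * (s%:C + e%:C * 'i))^-1 :> R[i]].
  move=> st t0; have E : (s%:C - e%:C * 'i) * (s%:C + e%:C * 'i) = t%:C :> R[i].
    rewrite -st rmorphD !rmorphXn /= (_ : _ * _ = s%:C ^+ 2 - e%:C ^+ 2 * ('i * 'i)); last by ring.
    by rewrite i2; ring.
  have : (s%:C - e%:C * 'i) * (s%:C + e%:C * 'i) != 0 :> R[i] by rewrite E realC// gt_eqF.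
  by rewrite mulf_eq0 negb_or => /andP[-> ->]; split => //; rewrite E -fmorphV.
have gcc x1 p q : ccont (fun t => (g x1 t)%:C) p q by exact: ccont_real.
rewrite /contour; set A := cint _ _ _; set B := cint _ _ _; set C := cint _ _ _; set D := cint _ _ _.
have -> : A + 'i * B - C - 'i * D = (A - C) + 'i * (B - D) by ring.
rewrite /A /B /C /D -!cintB//.
rewrite (cint_eq (g := fun t => (2 * e%:C * 'i) * (g x t)%:C)); last first.
  move=> t _; rewrite /w /g; have [h1 h2 ->] := sq (t - x) _ erefl (gden x t).
  have -> : t +i* (y - e) - (x +i* y) = (t - x)%:C - e%:C * 'i by simpc; congr (_ +i* _); ring.
  have -> : t +i* (y + e) - (x +i* y) = (t - x)%:C + e%:C * 'i by simpc; congr (_ +i* _); ring.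
  by move: (t - x)%:C h1 h2 => s h1 h2; field; rewrite h1 h2.
rewrite [X in _ + 'i * X](cint_eq (g := fun t => (2 * e%:C) * (g y t)%:C)); last first.
  move=> t _; rewrite /w /g; have [h1 h2 ->] := sq (t - y) _ erefl (gden y t).
  have -> : (x + e) +i* t - (x +i* y) = 'i * ((t - y)%:C - e%:C * 'i).
    by simpc; congr (_ +i* _); ring.
  have -> : (x - e) +i* t - (x +i* y) = 'i * ((t - y)%:C + e%:C * 'i).
    by simpc; congr (_ +i* _); ring.
  by move: (t - y)%:C h1 h2 => s h1 h2; field; rewrite h1 h2 neq0Ci.
rewrite !cintZ// !cint_real !rmorphD !rmorphM /= rmorph_nat; ring.
Qed.

End cauchy.

(** * Cauchy's formula and the derivatives of Cauchy integrals *)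

Section cauchy_formula.
Context {R : realType}.
Implicit Types (a b c d x y : R) (f g F : R[i] -> R[i]) (z w h : R[i]).

Definition inside a b c d w :=
  (a < complex.Re w < b) /\ (c < complex.Im w < d).

Lemma inside_le a b c d w : inside a b c d w -> a <= b /\ c <= d.
Proof. by move=> [/andP[h1 h2] /andP[h3 h4]]; split; lra. Qed.

Lemma inside_margin a b c d w : inside a b c d w -> exists2 r : R, 0 < r &
  [/\ a <= complex.Re w - r, complex.Re w + r <= b, c <= complex.Im w - r & complex.Im w + r <= d].
Proof.
move=> [/andP[h1 h2] /andP[h3 h4]].
exists (Num.min (Num.min (complex.Re w - a) (b - complex.Re w))
         (Num.min (complex.Im w - c) (d - complex.Im w))).
  by rewrite !lt_min !subr_gt0 h1 h2 h3 h4.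
set r := Num.min _ _.
have : r <= r by []; rewrite {2}/r !le_min => /andP[/andP[r1 r2] /andP[r3 r4]].
by split; lra.
Qed.

Lemma on_frame_dist a b c d w z (r : R) :
  a <= complex.Re w - r -> complex.Re w + r <= b ->
  c <= complex.Im w - r -> complex.Im w + r <= d ->
  on_frame a b c d z -> r <= normc (z - w).
Proof.
move=> h1 h2 h3 h4; case=> -[_ [h|h]].
- rewrite (le_trans _ (normc_Im _))// raddfB /= h -normrN (le_trans _ (ler_norm _))//; lra.
- rewrite (le_trans _ (normc_Im _))// raddfB /= h (le_trans _ (ler_norm _))//; lra.
- rewrite (le_trans _ (normc_Re _))// raddfB /= h -normrN (le_trans _ (ler_norm _))//; lra.
- rewrite (le_trans _ (normc_Re _))// raddfB /= h (le_trans _ (ler_norm _))//; lra.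
Qed.

Lemma on_frame_neq a b c d w z : inside a b c d w -> on_frame a b c d z -> z != w.
Proof.
move=> /inside_margin[r r0 [h1 h2 h3 h4]] /(on_frame_dist h1 h2 h3 h4).
by apply: contraTneq => ->; rewrite subrr Normc.normc0 -ltNge.
Qed.

Lemma contour_inv a b c d w : inside a b c d w -> exists2 k : R, 4 <= k &
  contour (fun z => (z - w)^-1) a b c d = 'i * k%:C.
Proof.
move=> hw; have [r r0 [h1 h2 h3 h4]] := inside_margin hw.
have [k k4 kE] := contour_inv_square (complex.Re w) (complex.Im w) r0.
exists k => //; rewrite -kE.
have <- : w = complex.Re w +i* complex.Im w by case: (w).
rewrite (@contour_excision_at _ _ a b c d (complex.Re w) (complex.Im w) r)// => u v _ _ uv.
by apply: cder_inv_sub; move: uv; case: (w).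
Qed.

(** Near [w] the quotient is bounded by [normc k + 1], so its integral over a square around [w]
    tends to 0 with the side, while excision makes that integral independent of the side. *)
Lemma contour_quotient F a b c d w : inside a b c d w -> cder_on F a b c d ->
  contour (fun z => (F z - F w) / (z - w)) a b c d = 0.
Proof.
move=> hw Fd; have [r r0 [h1 h2 h3 h4]] := inside_margin hw.
have [ab cd] := inside_le hw.
have [k Fk] : exists k, cder F w k.
  case: w hw {h1 h2 h3 h4} => u v [/= /andP[h1 h2] /andP[h3 h4]].
  by apply: Fd; lra.
have [D D0 HD] := Fk _ ltr01.
pose M := normc k + 1.
have M0 : 0 < M by rewrite ltr_wpDl ?normc_ge0.
apply: Normc.eq0_normc; apply/eqP; rewrite eq_le normc_ge0 andbT.
apply/ler_addgt0Pl => e e0; rewrite addr0.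
(* The half-side [s] keeps the square inside the rectangle, keeps its points within [D] of [w]
   (their distance is at most [2 s]), and makes the length estimate [16 * s * M] at most [e]. *)
pose s := Num.min r (Num.min (D / 4) (e / (16 * M))).
have s0 : 0 < s by rewrite !lt_min r0 !divr_gt0// mulr_gt0.
have : s <= s by []; rewrite {2}/s !le_min => /and3P[sr sD se].
have qd u v : a <= u <= b -> c <= v <= d -> u +i* v != w ->
    exists k, cder (fun z => (F z - F w) / (z - w)) (u +i* v) k.
  move=> hu hv uv; have [k1 Fk1] := Fd _ _ hu hv; have [k2 Fk2] := cder_inv_sub uv.
  eexists; apply: cderM; last exact: Fk2.
  by apply: cderB; [exact: Fk1|exact: cder_cst].
have Ew : w = complex.Re w +i* complex.Im w by case: (w).
rewrite (@contour_excision_at _ _ a b c d (complex.Re w) (complex.Im w) s) -?Ew//; try lra.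
have q1 : complex.Re w - s <= complex.Re w + s by lra.
have q2 : complex.Im w - s <= complex.Im w + s by lra.
have sub z : on_frame (complex.Re w - s) (complex.Re w + s) (complex.Im w - s) (complex.Im w + s) z ->
    a <= complex.Re z <= b /\ c <= complex.Im z <= d.
  by move=> /(on_frame_rect q1 q2)[/andP[p1 p2] /andP[p3 p4]]; lra.
have zw z : on_frame (complex.Re w - s) (complex.Re w + s) (complex.Im w - s) (complex.Im w + s) z ->
    z != w.
  apply: on_frame_neq; split; apply/andP; split; lra.
have fr : frame (fun z => (F z - F w) / (z - w)) (complex.Re w - s) (complex.Re w + s)
    (complex.Im w - s) (complex.Im w + s).
  apply: frame_cder => z hz; have [p1 p2] := sub _ hz.
  have Ez : z = complex.Re z +i* complex.Im z by case: (z).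
  by rewrite Ez; apply: qd => //; rewrite -Ez; exact: zw.
apply: (le_trans (normc_contour_on_frame q1 q2 fr (M := M) _)) => [z hz|].
  have zw0 := zw _ hz.
  rewrite normcM normcV ler_pdivrMr ?normc_gt0 ?subr_eq0//.
  have := HD (z - w); rewrite [w + _]addrC subrK mul1r => H.
  rewrite (_ : F z - F w = (F z - F w - k * (z - w)) + k * (z - w)); last by rewrite subrK.
  rewrite (le_trans (normcD _ _))// [M]addrC mulrDl mul1r normcM lerD2r H//.
  have [/andP[p1 p2] /andP[p3 p4]] := on_frame_rect q1 q2 hz.
  rewrite (le_lt_trans (normc_le_ReIm _))// !raddfB /=.
  have a1 : `|complex.Re z - complex.Re w| <= s by rewrite ler_norml; lra.
  have a2 : `|complex.Im z - complex.Im w| <= s by rewrite ler_norml; lra.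
  by lra.
have -> : complex.Re w + s - (complex.Re w - s) + (complex.Im w + s - (complex.Im w - s)) = 4 * s by ring.
have : s * (16 * M) <= e by rewrite -ler_pdivlMr// mulr_gt0.
lra.
Qed.

(* [Cint 1 (fun=> 1)] plays the role of 2 pi i; only its modulus being at least 4 is used. *)
Definition Cint n f a b c d w := contour (fun z => f z / (z - w) ^+ n) a b c d.

Lemma frame_inv_sub a b c d w n : inside a b c d w ->
  frame (fun z => ((z - w) ^+ n)^-1) a b c d.
Proof.
move=> hw; apply: frame_cder => z hz; have zw := on_frame_neq hw hz.
have [k hk] := cder_inv_sub zw; have [k' hk'] := cderX n hk.
by exists k'; apply: (cder_near ltr01 _ hk') => h _; rewrite exprVn.
Qed.

Lemma frame_cst k a b c d : frame (fun=> k : R[i]) a b c d.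
Proof. by split; exact: ccont_cst. Qed.

Lemma frame_cauchy_kernel f a b c d w n : inside a b c d w -> frame f a b c d ->
  frame (fun z => f z / (z - w) ^+ n) a b c d.
Proof. by move=> hw fr; apply: frameM => //; exact: frame_inv_sub. Qed.

Lemma Cint1_neq0 a b c d w : inside a b c d w -> 4 <= normc (Cint 1 (fun=> 1) a b c d w).
Proof.
move=> hw; have [k k4 kE] := contour_inv hw.
rewrite /Cint (_ : (fun _ => _) = (fun z => (z - w)^-1)).
  by rewrite kE normcM normc_i mul1r normc_real (le_trans k4)// ler_norm.
by apply/funext => z; rewrite mul1r expr1.
Qed.

Lemma cauchy_formula F a b c d w : inside a b c d w -> cder_on F a b c d ->
  Cint 1 F a b c d w = F w * Cint 1 (fun=> 1) a b c d w.
Proof.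
move=> hw Fd; have [ab cd] := inside_le hw.
have Ff := cder_on_frame ab cd Fd.
apply/eqP; rewrite -subr_eq0; apply/eqP.
rewrite -contourZ; last by apply: frame_cauchy_kernel => //; exact: frame_cst.
rewrite -contourB.
- rewrite -(contour_quotient hw Fd); apply: contour_ext => // z _.
  by rewrite expr1; ring.
- exact: frame_cauchy_kernel.
- by apply: frameM; [exact: frame_cst|apply: frame_cauchy_kernel => //; exact: frame_cst].
Qed.

Lemma ccont_bounded (f : R -> R[i]) a b : a <= b -> ccont f a b ->
  exists M, forall t, a <= t <= b -> normc (f t) <= M.
Proof.
move=> ab fc.
have B (h : R -> R) : (forall t, a <= t <= b -> {for t, continuous h}) ->
    exists M, forall t, a <= t <= b -> `|h t| <= M.
  move=> hc; have nc : {within `[a, b], continuous (fun t => `|h t|)}.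
    apply: continuous_in_subspaceT => t; rewrite inE /= in_itv /= => /hc ht.
    by apply: continuous_comp => //; exact: norm_continuous.
  have [m _ hm] := EVT_max ab nc; exists `|h m| => t ht; apply: hm.
  by rewrite in_itv.
have [M1 H1] := B _ (ccont_Re fc); have [M2 H2] := B _ (ccont_Im fc).
exists (M1 + M2) => t ht; rewrite (le_trans (normc_le_ReIm _))// lerD//; [exact: H1|exact: H2].
Qed.

Lemma frame_bounded f a b c d : a <= b -> c <= d -> frame f a b c d ->
  exists2 M, 0 <= M & forall z, on_frame a b c d z -> normc (f z) <= M.
Proof.
move=> ab cd [/(ccont_bounded ab)[M1 H1] /(ccont_bounded ab)[M2 H2]
  /(ccont_bounded cd)[M3 H3] /(ccont_bounded cd)[M4 H4]].
exists (Num.max 0 (Num.max (Num.max M1 M2) (Num.max M3 M4))).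
  by rewrite le_max lexx.
by move=> [x y] [[/= h [->|->]]|[/= h [->|->]]]; rewrite !le_max ?(H1 _ h) ?(H2 _ h) ?(H3 _ h) ?(H4 _ h) ?orbT.
Qed.

(** Differentiation under the integral sign: a remainder quadratic in [h] and uniform on the frame
    survives integration. *)
Lemma cder_contour (K : R[i] -> R[i] -> R[i]) (K1 : R[i] -> R[i]) a b c d w (r C : R) :
  a <= b -> c <= d -> 0 < r -> 0 <= C ->
  (forall h, normc h < r -> frame (fun z => K z (w + h)) a b c d) -> frame K1 a b c d ->
  (forall z h, on_frame a b c d z -> normc h < r ->
     normc (K z (w + h) - K z w - h * K1 z) <= C * normc h ^+ 2) ->
  cder (fun w => contour (fun z => K z w) a b c d) w (contour K1 a b c d).
Proof.
move=> ab cd r0 C0 Kf K1f HK e e0.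
have Kf0 := Kf 0; rewrite Normc.normc0 addr0 in Kf0; have {}Kf0 := Kf0 r0.
pose s := 4 * ((b - a) + (d - c)) * C + 1.
have s0 : 0 < s by rewrite ltr_wpDl// !mulr_ge0//; lra.
exists (Num.min r (e / s)); first by rewrite lt_min r0 divr_gt0.
move=> h; rewrite lt_min => /andP[hr hs].
have Kfh := Kf _ hr.
have hK1 : frame (fun z => h * K1 z) a b c d by apply: frameM => //; exact: frame_cst.
rewrite -contourB// [contour K1 _ _ _ _ * h]mulrC -contourZ// -contourB//; last exact: frameB.
apply: (le_trans (normc_contour_on_frame ab cd (M := C * normc h ^+ 2) _ _)).
- by apply: frameB => //; exact: frameB.
- by move=> z hz; exact: HK.
rewrite expr2 !mulrA ler_wpM2r ?normc_ge0//.
rewrite (@le_trans _ _ (s * normc h))// ?ler_wpM2r ?normc_ge0// ?lerDl//.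
by rewrite mulrC -ler_pdivlMr// ltW.
Qed.

Lemma inside_near a b c d w : inside a b c d w -> exists2 r : R, 0 < r &
  forall h, normc h < r -> inside a b c d (w + h) /\
    forall z, on_frame a b c d z -> r <= normc (z - w) /\ r <= normc (z - w - h).
Proof.
move=> hw; have [r r0 [h1 h2 h3 h4]] := inside_margin hw.
have r20 : 0 < r / 2 by rewrite divr_gt0.
exists (r / 2) => // h hr.
have := normc_Re h; have := normc_Im h; rewrite !ler_norml => /andP[i1 i2] /andP[e1 e2].
split; first by split; rewrite raddfD /=; lra.
move=> z hz; have := on_frame_dist h1 h2 h3 h4 hz => rz; split; first by lra.
have : normc (z - w) <= normc (z - w - h) + normc h by rewrite -{1}(subrK h (z - w)) normcD.
by lra.
Qed.

Lemma cder_Cint1 f a b c d w : inside a b c d w -> frame f a b c d ->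
  cder (Cint 1 f a b c d) w (Cint 2 f a b c d w).
Proof.
move=> hw fr; have [ab cd] := inside_le hw.
have [M M0 HM] := frame_bounded ab cd fr.
have [r r0 Hr] := inside_near hw.
apply: (@cder_contour _ _ a b c d w r (M / r ^+ 3)) => //.
- by rewrite divr_ge0// exprn_ge0// ltW.
- by move=> h /Hr[hi _]; exact: frame_cauchy_kernel.
- exact: frame_cauchy_kernel.
move=> z h hz hr; have [_ /(_ _ hz)[r1 r2]] := Hr _ hr.
have u0 : z - w != 0 by apply/eqP => E; move: r1; rewrite E Normc.normc0; lra.
have v0 : z - w - h != 0 by apply/eqP => E; move: r2; rewrite E Normc.normc0; lra.
(* The exact second-order remainder of [1 / (z - w)] in [w]; both factors of its denominator stay
   away from 0 on the frame. *)
rewrite (_ : _ - _ - _ = f z * (h ^+ 2 / ((z - w) ^+ 2 * (z - w - h)))); last first.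
  by rewrite opprD addrA !expr1; field; rewrite u0 v0.
rewrite normcM -[leRHS]mulrA [X in _ <= _ * X]mulrC ler_pM ?normc_ge0 ?HM// normcM normcX.
rewrite ler_wpM2l ?exprn_ge0 ?normc_ge0// normcV normcM normcX.
rewrite lef_pV2 ?posrE ?mulr_gt0 ?exprn_gt0 ?normc_gt0// exprSr ler_pM ?exprn_ge0 ?(ltW r0)//.
by rewrite ler_pXn2r ?nnegrE ?normc_ge0 ?(ltW r0).
Qed.

Lemma cder_Cint2 f a b c d w : inside a b c d w -> frame f a b c d ->
  exists k, cder (Cint 2 f a b c d) w k.
Proof.
move=> hw fr; have [ab cd] := inside_le hw.
have [M M0 HM] := frame_bounded ab cd fr.
have [r r0 Hr] := inside_near hw.
exists (contour (fun z => f z * (2 / (z - w) ^+ 3)) a b c d).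
apply: (@cder_contour _ _ a b c d w r (M * (5 / r ^+ 4))) => //.
- by rewrite mulr_ge0// divr_ge0// exprn_ge0// ltW.
- by move=> h /Hr[hi _]; exact: frame_cauchy_kernel.
- by apply: frameM => //; apply: frameM; [exact: frame_cst|exact: frame_inv_sub].
move=> z h hz hr; have [_ /(_ _ hz)[r1 r2]] := Hr _ hr.
have u0 : z - w != 0 by apply/eqP => E; move: r1; rewrite E Normc.normc0; lra.
have v0 : z - w - h != 0 by apply/eqP => E; move: r2; rewrite E Normc.normc0; lra.
rewrite (_ : _ - _ - _ = f z * ((2 * (z - w - h) + (z - w)) / ((z - w) ^+ 3 * (z - w - h) ^+ 2) * h ^+ 2)); last first.
  by rewrite opprD addrA; field; rewrite u0 v0.
rewrite normcM -[leRHS]mulrA ler_pM ?normc_ge0 ?HM// normcM normcX.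
rewrite ler_wpM2r ?exprn_ge0 ?normc_ge0// normcM normcV normcM !normcX.
set A := normc (z - w) in r1 *; set B := normc (z - w - h) in r2 *.
have A0 : 0 < A by lra. have B0 : 0 < B by lra.
have N : normc (2 * (z - w - h) + (z - w)) <= 2 * B + A.
  rewrite (le_trans (normcD _ _))// lerD2r normcM (_ : normc 2 = 2)//.
  by rewrite -(rmorph_nat (real_complex R)) normc_real ger0_norm.
rewrite ler_pdivrMr ?mulr_gt0 ?exprn_gt0//; apply: (le_trans N).
rewrite mulrAC ler_pdivlMr ?exprn_gt0//.
have rA n : r ^+ n <= A ^+ n by rewrite lerXn2r ?nnegrE ?(ltW r0) ?(ltW A0).
have rB n : r ^+ n <= B ^+ n by rewrite lerXn2r ?nnegrE ?(ltW r0) ?(ltW B0).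
have rn n : 0 <= r ^+ n by rewrite exprn_ge0 ?(ltW r0).
have a1 : B * r ^+ 4 <= A ^+ 3 * B ^+ 2.
  rewrite (_ : B * r ^+ 4 = r ^+ 3 * (B * r)); last by ring.
  by rewrite ler_pM ?mulr_ge0 ?(ltW r0) ?(ltW B0)// expr2 ler_pM2l.
have a2 : A * r ^+ 4 <= A ^+ 3 * B ^+ 2.
  rewrite (_ : A * r ^+ 4 = (A * r ^+ 2) * r ^+ 2); last by ring.
  by rewrite [A ^+ 3]exprS -mulrA -[leRHS]mulrA ler_pM2l// ler_pM.
have a3 : 0 <= A ^+ 3 * B ^+ 2 by rewrite mulr_ge0 ?exprn_ge0 ?(ltW A0) ?(ltW B0).
lra.
Qed.

End cauchy_formula.

(** * Entire functions: Cauchy estimate, removable singularities, maximum principle, Taylor's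
    formula *)

Section entire_functions.
Context {R : realType}.
Implicit Types (a b c d x y : R) (f g F G : R[i] -> R[i]) (z w h : R[i]).

Lemma cder_unique F z k k' : cder F z k -> cder F z k' -> k = k'.
Proof.
move=> Fd Fd'; apply/eqP; rewrite -subr_eq0; apply/eqP; apply: Normc.eq0_normc.
apply/eqP; rewrite eq_le normc_ge0 andbT; apply/ler_addgt0Pl => e e0; rewrite addr0.
have e20 : 0 < e / 2 by rewrite divr_gt0.
have [D D0 HD] := Fd _ e20; have [D' D'0 HD'] := Fd' _ e20.
pose s := Num.min D D' / 2.
have m0 : 0 < Num.min D D' by rewrite lt_min D0.
have s0 : 0 < s by rewrite divr_gt0.
have : s < Num.min D D' by rewrite /s; lra.
have ns : normc s%:C = s by rewrite normc_real gtr0_norm.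
rewrite lt_min -{1 2}ns => /andP[/HD h1 /HD' h2].
rewrite -(ler_pM2r s0) -{1}ns -normcM.
have -> : (k - k') * s%:C = (F (z + s%:C) - F z - k' * s%:C) - (F (z + s%:C) - F z - k * s%:C) by ring.
rewrite (le_trans (normcB _ _))// (le_trans (lerD h2 h1))// ns -mulrDl.
by rewrite -splitr.
Qed.

(* A rigid copy of [entire]: unification must not unfold [derivable]. *)
Variant holo F : Prop := Holo of (forall z, exists k, cder F z k).

Lemma holoP F : holo F <-> forall z, exists k, cder F z k.
Proof. by split=> [[]|]. Qed.

Lemma entireP F : entire F <-> holo F.
Proof.
by split=> [H|/holoP H]; [apply/holoP => z; apply/cdifferentiableP|move=> z; apply/cdifferentiableP].
Qed.

Definition dc F z : R[i] := xget 0 [set k | cder F z k].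

Lemma dcP F z k : cder F z k -> cder F z (dc F z).
Proof. by move=> Fd; rewrite /dc; apply: (@xgetPex _ 0 [set k | cder F z k]); exists k. Qed.

Lemma dcE F z k : cder F z k -> dc F z = k.
Proof. by move=> Fd; exact: cder_unique (dcP Fd) Fd. Qed.

Lemma holo_cder F z : holo F -> cder F z (dc F z).
Proof. by move=> /holoP/(_ z)[d]; exact: dcP. Qed.

Lemma holo_cder_on F a b c d : holo F -> cder_on F a b c d.
Proof. by move=> /holoP eF x y _ _; exact: eF. Qed.

Lemma holo_frame F a b c d : holo F -> frame F a b c d.
Proof. by move=> /holoP eF; apply: frame_cder. Qed.

Lemma holoD F G : holo F -> holo G -> holo (fun z => F z + G z).
Proof. by move=> Fe Ge; apply/holoP => z; eexists; apply: cderD; apply: holo_cder. Qed.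

Lemma holoB F G : holo F -> holo G -> holo (fun z => F z - G z).
Proof. by move=> Fe Ge; apply/holoP => z; eexists; apply: cderB; apply: holo_cder. Qed.

Lemma holoM F G : holo F -> holo G -> holo (fun z => F z * G z).
Proof. by move=> Fe Ge; apply/holoP => z; eexists; apply: cderM; apply: holo_cder. Qed.

Lemma holo_cst k : holo (fun=> k : R[i]).
Proof. by apply/holoP => z; exists 0; exact: cder_cst. Qed.

Lemma holo_id : holo (fun z : R[i] => z).
Proof. by apply/holoP => z; exists 1; exact: cder_id. Qed.

Lemma holo_comp F G : holo F -> holo G -> holo (fun z => F (G z)).
Proof. by move=> Fe Ge; apply/holoP => z; eexists; apply: cder_comp; apply: holo_cder. Qed.

Lemma holoX F n : holo F -> holo (fun z => F z ^+ n).
Proof. by move=> /holoP Fe; apply/holoP => z; have [d /(cderX n)] := Fe z. Qed.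

Lemma holo_sharp F : holo F -> holo (sharp F).
Proof.
by move=> /holoP Fe; apply/holoP => z; have [d Fd] := Fe z^*; exists d^*; exact: cder_sharp.
Qed.

Lemma holo_shift F w : holo F -> holo (fun z => F (z + w)).
Proof.
by move=> Fe; apply: holo_comp => //; apply: holoD; [exact: holo_id|exact: holo_cst].
Qed.

Lemma holo_sum n (F_ : nat -> R[i] -> R[i]) : (forall k, holo (F_ k)) ->
  holo (fun z => \sum_(k < n) F_ k z).
Proof.
move=> Fe; elim: n => [|n IH].
  by under [X in holo X]eq_fun do rewrite big_ord0; exact: holo_cst.
by under [X in holo X]eq_fun do rewrite big_ord_recr; exact: holoD.
Qed.

(** Near [w0] the function is a quotient of two Cauchy integrals, and the quotient rule gives a
    formula for its derivative that is differentiable again. The denominator is really constant;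
    since only a lower bound of its modulus has been proved, its derivative [C2] is carried
    along. *)
Lemma holo_dc F : holo F -> holo (dc F).
Proof.
move=> Fe; apply/holoP => w0.
pose a := complex.Re w0 - 1; pose b := complex.Re w0 + 1.
pose c := complex.Im w0 - 1; pose d := complex.Im w0 + 1.
have hw0 : inside a b c d w0 by rewrite /a /b /c /d; split; apply/andP; split; lra.
have [r r0 Hr] := inside_near hw0.
pose one : R[i] -> R[i] := fun=> 1.
have F1 := holo_frame a b c d Fe.
have one1 : frame one a b c d by exact: frame_cst.
pose C1 := Cint 1 one a b c d; pose CF := Cint 1 F a b c d.
pose C2 := Cint 2 one a b c d; pose CF2 := Cint 2 F a b c d.
have n0 w : inside a b c d w -> C1 w != 0.
  move=> hw; apply/eqP => E; have := Cint1_neq0 hw; rewrite -/one -/C1 E Normc.normc0; lra.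
have FE w : inside a b c d w -> F w = CF w * (C1 w)^-1.
  move=> hw; rewrite /CF (cauchy_formula hw); last exact: holo_cder_on.
  by rewrite -/one -/C1 mulfK// n0.
have derF w : inside a b c d w -> dc F w = CF2 w * (C1 w)^-1 - F w * (C2 w * (C1 w)^-1).
  move=> hw; apply: dcE; have [r' r'0 Hr'] := inside_near hw.
  apply: (@cder_near _ (fun w => CF w * (C1 w)^-1) _ _ _ r') => //.
    by move=> h /Hr'[hh _]; rewrite FE.
  apply: cder_eq.
    apply: cderM; first exact: cder_Cint1.
    exact: (cder_comp (cder_Cint1 hw one1) (cderV (n0 _ hw))).
  rewrite FE//; change (CF2 w * (C1 w)^-1 + CF w * (- (C1 w ^+ 2)^-1 * C2 w) = CF2 w / C1 w - CF w / C1 w * (C2 w / C1 w)).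
  by field; rewrite n0.
have [k1 h1] := cder_Cint2 hw0 F1; have [k2 h2] := cder_Cint2 hw0 one1.
have hV := cder_comp (cder_Cint1 hw0 one1) (cderV (n0 _ hw0)).
eexists; apply: (@cder_near _ (fun w => CF2 w * (C1 w)^-1 - F w * (C2 w * (C1 w)^-1)) _ _ _ r) => //.
  by move=> h /Hr[hh _]; rewrite derF.
apply: cderB; first by apply: cderM; [exact: h1|exact: hV].
apply: cderM; first exact: holo_cder.
by apply: cderM; [exact: h2|exact: hV].
Qed.

Lemma Cint_le f a b c d w n (r M : R) : a <= b -> c <= d -> 0 < r -> inside a b c d w -> frame f a b c d ->
  (forall z, on_frame a b c d z -> normc (f z) <= M) ->
  (forall z, on_frame a b c d z -> r <= normc (z - w)) ->
  normc (Cint n f a b c d w) <= 4 * ((b - a) + (d - c)) * (M / r ^+ n).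
Proof.
move=> ab cd r0 hw fr fM rz; apply: normc_contour_on_frame => //.
  exact: frame_cauchy_kernel.
move=> z hz; rewrite normcM ler_pM ?normc_ge0 ?fM// normcV normcX.
have zr := rz _ hz.
have z0 := lt_le_trans r0 zr.
by rewrite lef_pV2 ?posrE ?exprn_gt0// lerXn2r ?nnegrE ?(ltW r0) ?(ltW z0).
Qed.

(** Solve [CF2 = dc F w * C1 + F w * C2] for the derivative, with [normc C1 >= 4] and the two other
    products at most [16 M / r]. The square of half-side [r] lies in the disc of radius [2 r]. Any
    constant from 8 on would do. *)
Lemma cauchy_estimate F w (r M : R) : holo F -> 0 < r ->
  (forall z, normc (z - w) <= 2 * r -> normc (F z) <= M) ->
  normc (dc F w) <= 20 * M / r.
Proof.
move=> Fe r0 FM.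
pose a := complex.Re w - r; pose b := complex.Re w + r.
pose c := complex.Im w - r; pose d := complex.Im w + r.
have hw : inside a b c d w by rewrite /a /b /c /d; split; apply/andP; split; lra.
have [ab cd] := inside_le hw.
pose one : R[i] -> R[i] := fun=> 1.
have F1 := holo_frame a b c d Fe.
have one1 : frame one a b c d by exact: frame_cst.
set CF2 := Cint 2 F a b c d w; set C2 := Cint 2 one a b c d w.
set C1 := Cint 1 one a b c d w.
have rz z : on_frame a b c d z -> r <= normc (z - w) by apply: on_frame_dist.
have zr z : on_frame a b c d z -> normc (F z) <= M.
  move=> /(on_frame_rect ab cd)[/andP[p1 p2] /andP[p3 p4]]; apply: FM.
  rewrite (le_trans (normc_le_ReIm _))// !raddfB /= mulr2n mulrDl mul1r.
  by apply: lerD; rewrite ler_norml; move: p1 p2 p3 p4; rewrite /a /b /c /d; lra.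
have E : CF2 = dc F w * C1 + F w * C2.
  have [r' r'0 Hr'] := inside_near hw.
  apply: (cder_unique (cder_Cint1 hw F1)).
  apply: (@cder_near _ (fun w => F w * Cint 1 one a b c d w) _ _ _ r') => //.
    by move=> h /Hr'[hh _]; rewrite (cauchy_formula hh (holo_cder_on Fe)).
  by apply: cderM; [exact: holo_cder|exact: cder_Cint1].
have S : 4 * ((b - a) + (d - c)) = 16 * r by rewrite /a /b /c /d; ring.
have B1 : normc CF2 <= 16 * r * (M / r ^+ 2) by rewrite -S; apply: Cint_le.
have B2 : normc C2 <= 16 * r * (1 / r ^+ 2).
  by rewrite -S; apply: Cint_le => // z _; rewrite Normc.normc1.
have B3 : 4 <= normc C1 := Cint1_neq0 hw.
have B4 : normc (F w) <= M by apply: FM; rewrite subrr Normc.normc0 mulr_ge0// ltW.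
have M0 : 0 <= M := le_trans (normc_ge0 _) B4.
have B5 : normc (dc F w) * normc C1 <= normc CF2 + normc (F w) * normc C2.
  by rewrite -!normcM (_ : dc F w * C1 = CF2 - F w * C2) ?normcB// E addrK.
have B6 : normc (F w) * normc C2 <= M * (16 * r * (1 / r ^+ 2)) by rewrite ler_pM ?normc_ge0.
have B7 : normc (dc F w) * 4 <= normc (dc F w) * normc C1 by rewrite ler_wpM2l ?normc_ge0.
have -> : 20 * M / r = (16 * r * (M / r ^+ 2) + M * (16 * r * (1 / r ^+ 2))) / 4 + 12 * M / r.
  by field; rewrite gt_eqF.
have : 0 <= 12 * M / r by rewrite divr_ge0 ?mulr_ge0// ltW.
lra.
Qed.

(** The point is that the difference quotient and a quotient of Cauchy integrals, which is
    differentiable at [w0] as well, agree near [w0]. This will divide the numerator of the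
    reproducing kernel by its zero. *)
Lemma removable F w0 : holo F -> exists2 q, holo q &
  forall z, F z - F w0 = (z - w0) * q z.
Proof.
move=> Fe.
pose a := complex.Re w0 - 1; pose b := complex.Re w0 + 1.
pose c := complex.Im w0 - 1; pose d := complex.Im w0 + 1.
have hw0 : inside a b c d w0 by rewrite /a /b /c /d; split; apply/andP; split; lra.
have [ab cd] := inside_le hw0.
have [r r0 Hr] := inside_near hw0.
pose one : R[i] -> R[i] := fun=> 1.
have F1 := holo_frame a b c d Fe.
have one1 : frame one a b c d by exact: frame_cst.
pose G z := (F z - F w0) / (z - w0).
have G1 : frame G a b c d.
  apply: frameM; first by apply: frameB => //; exact: frame_cst.
  by have := frame_inv_sub 1 hw0.
pose Q w := Cint 1 G a b c d w * (Cint 1 one a b c d w)^-1.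
pose q z := if z == w0 then Q w0 else (F z - F w0) / (z - w0).
have n0 w : inside a b c d w -> Cint 1 one a b c d w != 0.
  move=> hw; apply/eqP => E; have := Cint1_neq0 hw; rewrite -/one E Normc.normc0; lra.
have qQ h : normc h < r -> q (w0 + h) = Q (w0 + h).
  move=> hr; rewrite /q; case: eqVneq => [->//|zw0].
  have [hh _] := Hr _ hr; set z := w0 + h in zw0 hh *.
  apply: (mulIf (n0 _ hh)); rewrite /Q mulfVK ?n0//.
  have zw : z - w0 != 0 by rewrite subr_eq0.
  pose i := (z - w0)^-1.
  have e1 : forall f, frame f a b c d -> frame (fun u => i * (f u / (u - z) ^+ 1)) a b c d.
    by move=> f ff; apply: frameM; [exact: frame_cst|exact: frame_cauchy_kernel].
  have e2 : forall f, frame f a b c d -> frame (fun u => i * (f u / (u - w0) ^+ 1)) a b c d.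
    by move=> f ff; apply: frameM; [exact: frame_cst|exact: frame_cauchy_kernel].
  have FF : frame (fun u => F u - F w0) a b c d by apply: frameB => //; exact: frame_cst.
  have P w : inside a b c d w -> contour (fun u => (F u - F w0) / (u - w) ^+ 1) a b c d =
      (F w - F w0) * Cint 1 one a b c d w.
    move=> hw; apply: (cauchy_formula (F := fun u => F u - F w0) hw).
    by apply: holo_cder_on; apply: holoB => //; exact: holo_cst.
  (* Partial fractions in [u], where [i] is [(z - w0)^-1] and not the imaginary unit. By Cauchy's
     formula the second term contributes [F w0 - F w0 = 0]. *)
  have -> : Cint 1 G a b c d z = contour (fun u => i * ((F u - F w0) / (u - z) ^+ 1) -
      i * ((F u - F w0) / (u - w0) ^+ 1)) a b c d.
    apply: contour_ext => // u hu.
    have u1 := on_frame_neq hh hu; have u2 := on_frame_neq hw0 hu.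
    by rewrite /G /i; field; rewrite !subr_eq0 u1 u2 zw0.
  rewrite contourB ?contourZ; [|exact: frame_cauchy_kernel|exact: frame_cauchy_kernel|exact: e1|exact: e2].
  by rewrite !P// subrr mul0r mulr0 subr0 /i; ring.
exists q; last first.
  move=> z; rewrite /q; case: eqVneq => [->|zw]; first by rewrite !subrr mul0r.
  by rewrite mulrC divfK// subr_eq0.
apply/holoP => z; have [->|zw] := eqVneq z w0.
  eexists; apply: (@cder_near _ Q _ _ _ r) => //.
    by move=> h hr; rewrite qQ.
  apply: cderM; first exact: cder_Cint1.
  exact: (cder_comp (cder_Cint1 hw0 one1) (cderV (n0 _ hw0))).
have [k hk] := cder_inv_sub zw.
have zw0 : 0 < normc (z - w0) by rewrite normc_gt0// subr_eq0.
eexists; apply: (@cder_near _ (fun z => (F z - F w0) * (z - w0)^-1) _ _ _ (normc (z - w0))) => //.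
  move=> h hz; rewrite /q; case: eqVneq => // E.
  by move: hz; rewrite -E opprD addrA subrr sub0r normcN ltxx.
by apply: cderM hk; apply: cderB; [exact: holo_cder|exact: cder_cst].
Qed.

(* Cauchy's formula for [F ^+ n] gives [|F w|^n <= s M^n]; then n tends to infinity. *)
Lemma max_principle F a b c d w (M : R) : holo F -> inside a b c d w ->
  (forall z, on_frame a b c d z -> normc (F z) <= M) -> normc (F w) <= M.
Proof.
move=> Fe hw FM; have [ab cd] := inside_le hw.
have [r r0 [h1 h2 h3 h4]] := inside_margin hw.
have rz z : on_frame a b c d z -> r <= normc (z - w) by apply: on_frame_dist.
have M0 : 0 <= M.
  apply: (le_trans (normc_ge0 (F (a +i* c)))); apply: FM; left => /=; split; last by left.
  by rewrite lexx.
pose s := ((b - a) + (d - c)) / r.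
have Hn n : normc (F w) ^+ n <= s * M ^+ n.
  have Fn : holo (fun z => F z ^+ n) by exact: holoX.
  have E := cauchy_formula hw (holo_cder_on Fn).
  have : normc (Cint 1 (fun z => F z ^+ n) a b c d w) <= 4 * ((b - a) + (d - c)) * (M ^+ n / r ^+ 1).
    apply: Cint_le => //; first exact: holo_frame.
    by move=> z /FM zM; rewrite normcX lerXn2r ?nnegrE ?normc_ge0.
  rewrite E normcM normcX => H.
  have := Cint1_neq0 hw => C4.
  have : normc (F w) ^+ n * 4 <= normc (F w) ^+ n * normc (Cint 1 (fun=> 1) a b c d w).
    by rewrite ler_wpM2l// exprn_ge0// normc_ge0.
  move=> /le_trans/(_ H).
  have -> : 4 * (b - a + (d - c)) * (M ^+ n / r ^+ 1) = s * M ^+ n * 4.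
    by rewrite /s expr1; field; rewrite gt_eqF.
  by rewrite ler_pM2r.
rewrite leNgt; apply/negP => MF.
have s0 : 0 <= s by rewrite divr_ge0 ?(ltW r0)//; lra.
have F0 : 0 < normc (F w) := le_lt_trans M0 MF.
move: M0; rewrite le_eqVlt => /predU1P[M0|M0].
  by have := Hn 1%N; rewrite -M0 !expr1 mulr0 leNgt F0.
pose t := normc (F w) / M - 1.
have t0 : 0 < t by rewrite subr_gt0 ltr_pdivlMr// mul1r.
pose n := (Num.truncn (s / t)).+1.
have := Hn n.
have -> : normc (F w) = (1 + t) * M by rewrite /t addrC subrK divfK// gt_eqF.
rewrite exprMn ler_pM2r ?exprn_gt0// => H.
(* Bernoulli's inequality: for the chosen [n] the power exceeds the bound [s]. *)
have B : 1 + n%:R * t <= (1 + t) ^+ n.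
  elim: (n) => [|m IH]; first by rewrite mul0r addr0 expr0.
  rewrite exprSr (le_trans _ (ler_wpM2r _ IH))//; last by lra.
  rewrite -natr1; have : 0 <= m%:R * t * t by rewrite !mulr_ge0// ltW.
  lra.
have : s < n%:R * t by rewrite -ltr_pdivrMr// truncnS_gt.
lra.
Qed.

(** Bisection replaces the mean value theorem, which fails for complex values; the slack [e] absorbs
    the local error of differentiability. *)
Lemma cmvt F z w (M : R) : holo F ->
  (forall t : R, 0 <= t <= 1 -> normc (dc F (z + t%:C * w)) <= M) ->
  normc (F (z + w) - F z) <= M * normc w.
Proof.
move=> Fe FM; apply/ler_addgt0Pr => e e0.
have nw := normc_ge0 w.
(* Intervals are treated as the degenerate rectangles [[a, b] x {0}]. *)
pose P (a b c d : R) : Prop := normc (F (z + b%:C * w) - F (z + a%:C * w)) <= (M * normc w + e) * (b - a).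
suff : P 0 1 0 0 by rewrite /P mul1r mul0r addr0 subr0 mulr1.
apply: rectangle_induction => //.
  move=> a b c d _ _ H1 H2 _ _; rewrite /P in H1 H2 *.
  set m := (a + b) / 2 in H1 H2.
  rewrite (_ : _ - _ = (F (z + b%:C * w) - F (z + m%:C * w)) + (F (z + m%:C * w) - F (z + a%:C * w))); last by ring.
  by rewrite (le_trans (normcD _ _))// (le_trans (lerD H2 H1))//; lra.
move=> t y0 ht _.
have e'0 : 0 < e / (1 + normc w) by rewrite divr_gt0//; lra.
have [D D0 HD] := holo_cder (z + t%:C * w) Fe e'0.
exists (D / (1 + normc w)); first by rewrite divr_gt0//; lra.
move=> a b c d _ h1 h2 _ _ _ _ _ sD _; rewrite /P.
have Mt := FM _ ht; set k := dc F _ in HD Mt.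
have M0 : 0 <= M := le_trans (normc_ge0 _) Mt.
have L s : `|s - t| <= b - a -> normc (F (z + s%:C * w) - F (z + t%:C * w)) <= (M * normc w + e) * `|s - t|.
  move=> st; have := HD ((s - t)%:C * w).
  rewrite (_ : z + t%:C * w + (s - t)%:C * w = z + s%:C * w); last by rewrite rmorphB /=; ring.
  rewrite normcM normc_real.
  have : `|s - t| * normc w < D.
    rewrite (@le_lt_trans _ _ ((b - a) * (1 + normc w)))// -?ltr_pdivlMr//; last by lra.
    by rewrite ler_pM//; lra.
  move=> hD /(_ hD) H.
  rewrite (_ : _ - _ = (F (z + s%:C * w) - F (z + t%:C * w) - k * ((s - t)%:C * w)) + k * ((s - t)%:C * w)); last by rewrite subrK.
  rewrite (le_trans (normcD _ _))// (le_trans (lerD H (lexx _)))// !normcM normc_real.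
  have -> : e / (1 + normc w) * (`|s - t| * normc w) + normc k * (`|s - t| * normc w) =
     (normc k * normc w + e * (normc w / (1 + normc w))) * `|s - t| by ring.
  rewrite ler_wpM2r// lerD ?ler_wpM2r// ger_pMr// ler_pdivrMr; lra.
rewrite (_ : _ - _ = (F (z + b%:C * w) - F (z + t%:C * w)) - (F (z + a%:C * w) - F (z + t%:C * w))); last by ring.
rewrite (le_trans (normcB _ _))// (le_trans (lerD (L b _) (L a _)))//.
- by rewrite ger0_norm; lra.
- by rewrite ler0_norm; lra.
- by rewrite ger0_norm ?ler0_norm; lra.
Qed.

Lemma holo_iter_dc F n : holo F -> holo (iter n dc F).
Proof. by move=> Fe; elim: n => //= n; exact: holo_dc. Qed.

Lemma cder_Xn n z : cder (fun w => w ^+ n.+1) z (n.+1%:R * z ^+ n).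
Proof.
elim: n => [|n IH].
  by rewrite expr0 mulr1; apply: (cder_near ltr01 _ (cder_id z)) => h _; rewrite expr1.
apply: (cder_near ltr01 (F := fun w => w * w ^+ n.+1)).
  by move=> h _; rewrite -exprS.
apply: cder_eq; first by apply: cderM; [exact: cder_id|exact: IH].
by rewrite /= mul1r mulrCA -exprS -{1}[z ^+ n.+1]mul1r -mulrDl -[n.+2%:R]natr1 addrC.
Qed.

Definition taylor n F z w : R[i] := \sum_(k < n) w ^+ k / k`!%:R * iter k dc F z.

Lemma cder_taylor n F z w : cder (taylor n.+1 F z) w (taylor n (dc F) z w).
Proof.
elim: n => [|n IH].
  rewrite /taylor big_ord0; under [X in cder X]eq_fun do rewrite big_ord1 expr0.
  exact: cder_cst.
rewrite /taylor.
have -> : (fun w => \sum_(k < n.+2) w ^+ k / k`!%:R * iter k dc F z) =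
    (fun w => taylor n.+1 F z w + w ^+ n.+1 / n.+1`!%:R * iter n.+1 dc F z).
  by apply/funext => v; rewrite big_ord_recr.
rewrite big_ord_recr; apply: cderD; first exact: IH.
apply: (cder_near ltr01 (F := fun w => w ^+ n.+1 * (iter n.+1 dc F z / n.+1`!%:R))).
  by move=> h _ /=; rewrite mulrAC -mulrA.
apply: cder_eq; first by apply: cderM; [exact: cder_Xn|exact: cder_cst].
rewrite mulr0 addr0 -iterSr factS natrM /=.
have f0 : n`!%:R != 0 :> R[i] by rewrite pnatr_eq0 -lt0n fact_gt0.
by field; rewrite f0 addrC natr1 pnatr_eq0.
Qed.

(** The derivative in [w] of the remainder with [n.+1] terms for [F] is the remainder with [n] terms
    for [dc F], so induction through [cmvt] applies. The factor [1 / n!] is given up. *)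
Lemma taylor_remainder n F z w (M : R) : holo F ->
  (forall t : R, 0 <= t <= 1 -> normc (iter n dc F (z + t%:C * w)) <= M) ->
  normc (F (z + w) - taylor n F z w) <= M * normc w ^+ n.
Proof.
elim: n F w => [|n IH] F w Fe FM.
  by rewrite /taylor big_ord0 subr0 expr0 mulr1; have := FM 1; rewrite mul1r ler01 lexx => /(_ isT).
have M0 : 0 <= M by apply: (le_trans (normc_ge0 _) (FM 0 _)); rewrite lexx ler01.
pose T v := F (v + z) - taylor n.+1 F z v.
have Td v : cder T v (dc F (z + v) - taylor n (dc F) z v).
  apply: cderB; last exact: cder_taylor.
  apply: cder_eq.
    apply: (@cder_comp _ F (fun v => v + z)); last exact: holo_cder.
    by apply: cderD; [exact: cder_id|exact: cder_cst].
  by rewrite addr0 mulr1 addrC.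
have Te : holo T by apply/holoP => v; eexists; exact: Td.
have T0 : T 0 = 0.
  rewrite /T add0r /taylor big_ord_recl big1.
    by rewrite expr0 invr1 mul1r mul1r addr0 subrr.
  by move=> i _; rewrite exprS !mul0r.
have -> : F (z + w) - taylor n.+1 F z w = T (0 + w) - T 0.
  by rewrite T0 subr0 add0r /T addrC [w + z]addrC addrC.
rewrite exprSr mulrA; apply: cmvt => // t /andP[t0 t1]; rewrite add0r (dcE (Td _)).
have ntw : normc (t%:C * w) <= normc w.
  by rewrite normcM normc_real ger0_norm// ler_piMl// normc_ge0.
apply: (le_trans (IH (dc F) (t%:C * w) (holo_dc Fe) _)).
  move=> s /andP[s0 s1]; rewrite -iterSr mulrA -rmorphM; apply: FM.
  by rewrite mulr_ge0// mulr_ile1.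
by rewrite ler_wpM2l// lerXn2r ?nnegrE ?normc_ge0.
Qed.

End entire_functions.

(** * The complex exponential *)

Section complex_exponential.
Context {R : realType}.
Implicit Types (z w h : R[i]) (F G : R[i] -> R[i]).

Definition cexp z : R[i] :=
  (expR (complex.Re z) * cos (complex.Im z)) +i* (expR (complex.Re z) * sin (complex.Im z)).

Lemma cexpD z w : cexp (z + w) = cexp z * cexp w.
Proof.
case: z w => [a b] [c d]; rewrite /cexp /= expRD cosD sinD.
by simpc; congr (_ +i* _); ring.
Qed.

Lemma normc_cexp z : normc (cexp z) = expR (complex.Re z).
Proof.
case: z => a b; rewrite /cexp /= !exprMn -mulrDr cos2Dsin2 mulr1.
by rewrite sqrtr_sqr ger0_norm// expR_ge0.
Qed.

Lemma is_derive_eps (f : R -> R) (x d e : R) : is_derive x 1 f d -> 0 < e ->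
  exists2 D : R, 0 < D & forall h : R, `|h| < D -> `|f (x + h) - f x - d * h| <= e * `|h|.
Proof.
move=> fd e0; have := @ex_derive _ _ _ _ _ _ _ fd.
move=> /cvg_ex[/= l fl]; have ld : l = d.
  by rewrite -(@derive_val _ _ _ _ _ _ _ fd); apply/esym/cvg_lim.
subst l; move/cvgrPdist_le : fl => /(_ e e0).
rewrite /dnbhs near_withinE => /nbhs_ballP[D /= D0 HD]; exists D => // h hD.
have [->|h0] := eqVneq h 0; first by rewrite addr0 subrr mulr0 subr0 normr0 mulr0.
have := HD h; rewrite /ball /= sub0r normrN => /(_ hD h0).
rewrite /GRing.scale /= mulr1 => H.
rewrite -(ler_pM2r (_ : 0 < `|h|)) ?normr_gt0// -normrM in H.
rewrite (le_trans _ H)// distrC mulrBl mulrAC mulVf// mul1r [h + x]addrC.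
by rewrite distrC.
Qed.

(** The functional equation will move the derivative at 0 to all points. With an error [e / 12] in
    each real function, the real part is off by at most [e / 3] and the imaginary part by at most
    [e / 2], relative to [normc h]. *)
Lemma cder_cexp0 : cder cexp 0 1.
Proof.
move=> e e0; have e60 : 0 < e / 12 by rewrite divr_gt0.
have [D1 D10 H1] := is_derive_eps (is_derive_expR 0) e60.
have [D2 D20 H2] := is_derive_eps (is_derive_cos 0) e60.
have [D3 D30 H3] := is_derive_eps (is_derive_sin 0) e60.
have [D4 D40 H4] := is_derive_eps (is_derive_expR 0) ltr01.
pose D5 := Num.min 1 (e / 12).
have D50 : 0 < D5 by rewrite lt_min ltr01.
exists (Num.min (Num.min D1 D2) (Num.min (Num.min D3 D4) D5)).
  by rewrite !lt_min D10 D20 D30 D40 ltr01.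
case=> a b; set N := normc _; rewrite !lt_min => /andP[/andP[n1 n2] /andP[/andP[n3 n4] /andP[n5 n6]]].
have aN : `|a| <= N := normc_Re (a +i* b).
have bN : `|b| <= N := normc_Im (a +i* b).
have := H1 a (le_lt_trans aN n1); rewrite add0r expR0 mul1r => {}H1.
have := H2 b (le_lt_trans bN n2); rewrite add0r cos0 sin0 oppr0 mul0r subr0 => {}H2.
have := H3 b (le_lt_trans bN n3); rewrite add0r sin0 cos0 subr0 mul1r => {}H3.
have := H4 a (le_lt_trans aN n4); rewrite add0r expR0 !mul1r => {}H4.
have N0 : 0 <= N := normc_ge0 _.
have eN0 : 0 <= e * N by rewrite mulr_ge0// ltW.
have E1 : `|expR a - 1| <= 2 * N.
  rewrite (_ : _ - _ = (expR a - 1 - a) + a); last by rewrite subrK.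
  by rewrite (le_trans (ler_normD _ _))//; lra.
have E2 : `|expR a| <= 3.
  rewrite (_ : expR a = (expR a - 1) + 1); last by rewrite subrK.
  by rewrite (le_trans (ler_normD _ _))// normr1; lra.
have b12 : `|b| <= e / 12 by lra.
have C1 : `|expR a * cos b - 1 - a| <= e / 3 * N.
  rewrite (_ : _ - _ = (expR a - 1 - a) + expR a * (cos b - 1)); last by ring.
  rewrite (le_trans (ler_normD _ _))// normrM.
  have : `|expR a| * `|cos b - 1| <= 3 * (e / 12 * `|b|) by rewrite ler_pM.
  have : e / 12 * `|a| <= e / 12 * N by rewrite ler_wpM2l// ltW.
  have : e / 12 * `|b| <= e / 12 * N by rewrite ler_wpM2l// ltW.
  by lra.
have C2 : `|expR a * sin b - b| <= e / 2 * N.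
  rewrite (_ : _ - _ = expR a * (sin b - b) + (expR a - 1) * b); last by ring.
  rewrite (le_trans (ler_normD _ _))// !normrM.
  have : `|expR a| * `|sin b - b| <= 3 * (e / 12 * `|b|) by rewrite ler_pM.
  have : `|expR a - 1| * `|b| <= (2 * N) * (e / 12) by rewrite ler_pM.
  have : e / 12 * `|b| <= e / 12 * N by rewrite ler_wpM2l// ltW.
  by lra.
rewrite add0r ?mul1r (le_trans (normc_le_ReIm _))// /cexp /= expR0 cos0 sin0 !mulr1 mulr0 subr0.
rewrite (le_trans (lerD C1 C2))//.
have : 0 <= e * N by rewrite mulr_ge0// ltW.
lra.
Qed.

Lemma cder_cexp z : cder cexp z (cexp z).
Proof.
move=> e e0.
have N0 : 0 < normc (cexp z) by rewrite normc_cexp expR_gt0.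
have [D D0 HD] := cder_cexp0 (divr_gt0 e0 N0); exists D => // h /HD.
rewrite add0r mul1r => H; rewrite cexpD.
have c0 : cexp 0 = 1 by rewrite /cexp /= expR0 cos0 sin0 mulr1 mulr0.
rewrite c0 in H; rewrite (_ : _ - _ = cexp z * (cexp h - 1 - h)); last by ring.
rewrite normcM (le_trans (ler_wpM2l (ltW N0) H))// mulrA mulrCA divff ?mulr1// gt_eqF//.
Qed.

Lemma holo_cexp : holo cexp.
Proof. by apply/holoP => z; exists (cexp z); exact: cder_cexp. Qed.

End complex_exponential.

(** * Phragmen-Lindelof principles and the bound on the imaginary axis *)

Section phragmen_lindelof.
Context {R : realType}.
Implicit Types (z w h : R[i]) (F G : R[i] -> R[i]).

(** Multiply by [exp (- 2 del cosh (be (z - i t0)))]. As [be * al < pi / 2], the cosine stays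
    positive and this factor has modulus at most 1 on the strip; as [b < be], it beats the growth of
    [F] on far vertical sides. Apply the maximum principle and let [del] tend to 0. *)
Lemma phragmen_lindelof_strip F (t0 al be b A C M : R) : holo F ->
  0 < al -> 0 < be -> be * al < pi / 2 -> 0 <= b -> b < be -> 0 <= A -> 0 <= C ->
  (forall s, normc (F (s +i* (t0 - al))) <= M) ->
  (forall s, normc (F (s +i* (t0 + al))) <= M) ->
  (forall s t, `|t - t0| <= al ->
     normc (F (s +i* t)) <= C * expR (A * (expR (b * s) + expR (- (b * s))))) ->
  forall s t, `|t - t0| < al -> normc (F (s +i* t)) <= M.
Proof.
move=> Fh al0 be0 beal b0 bbe A0 C0 Flo Fhi Fgr s t tal.
have M0 : 0 <= M := le_trans (normc_ge0 _) (Flo 0).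
apply/ler_addgt0Pr => eta eta0.
(* [M] may be 0, and the width of the rectangle below is defined by a division by the bound. *)
set M' := M + eta.
have M'0 : 0 < M' by rewrite ltr_wpDl.
pose kap := cos (be * al).
have beal0 : 0 < be * al by rewrite mulr_gt0.
have pi0 := pi_gt0 R.
have kap0 : 0 < kap by apply: cos_gt0_pihalf; apply/andP; split; lra.
have coskap u : `|u - t0| <= al -> kap <= cos (be * (u - t0)).
  move=> ual; have -> : cos (be * (u - t0)) = cos `|be * (u - t0)|.
    by case: (ler0P (be * (u - t0))) => _; rewrite ?cosN.
  have n1 : `|be * (u - t0)| <= be * al by rewrite normrM gtr0_norm// ler_pM2l.
  rewrite /kap leNgt; apply/negP; rewrite ltr_cos ?in_itv /=.
  - by rewrite ltNge n1.
  - by rewrite (ltW beal0)/=; lra.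
  - by rewrite normr_ge0/=; lra.
pose T u := expR (be * u) + expR (- (be * u)).
have T0 u : 0 < T u by rewrite addr_gt0 ?expR_gt0.
pose ph z := z - (0 +i* t0).
pose W (del : R) z := cexp (- (del%:C * (cexp (be%:C * ph z) + cexp (- (be%:C * ph z))))).
have Wh del : holo (W del).
  have phh : holo (fun z => be%:C * ph z).
    by apply: holoM; [exact: holo_cst|apply: holoB; [exact: holo_id|exact: holo_cst]].
  have hN G : holo G -> holo (fun z => - G z).
    move=> Gh; have := holoB (holo_cst 0) Gh.
    by under [X in holo X]eq_fun do rewrite sub0r.
  apply: (holo_comp holo_cexp); apply: (hN _); apply: holoM; first exact: holo_cst.
  by apply: holoD; apply: (holo_comp holo_cexp) => //; exact: hN.
have WE del u v : normc (W del (u +i* v)) = expR (- (del * (cos (be * (v - t0)) * T u))).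
  rewrite /W normc_cexp /ph /cexp /=; congr expR; simpc; rewrite /= cosN /T; ring.
have key del : 0 < del -> normc (F (s +i* t)) * expR (- (del * T s)) <= M'.
  move=> del0.
  have dk0 : 0 < del * kap by rewrite mulr_gt0.
  have bb0 : 0 < be - b by rewrite subr_gt0.
  pose K := C / M'.
  have K0 : 0 <= K by rewrite divr_ge0// ltW.
  (* On the sides [u = S] and [u = - S] the second bound makes the exponent at most [- K], and
     [C exp (- K) <= M'] because [C = K M']. The first bound puts the point inside the rectangle. *)
  pose S := Num.max (`|s| + 1) (((2 * A + K) / (del * kap)) / (be - b)).
  have S1 : `|s| + 1 <= S by rewrite le_max lexx.
  have S2 : (2 * A + K) / (del * kap) <= expR ((be - b) * S).
    apply: le_trans (expR_ge1Dx _); rewrite (@le_trans _ _ ((be - b) * S))//; last by lra.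
    by rewrite [leRHS]mulrC -ler_pdivrMr// le_max lexx orbT.
  clearbody S; have S0 : 0 < S by have := normr_ge0 s; lra.
  have edge u v : `|u| = S -> `|v - t0| <= al ->
      normc (F (u +i* v)) * normc (W del (u +i* v)) <= M'.
    move=> uS val; rewrite WE.
    have symb c : 0 <= c -> expR (c * u) + expR (- (c * u)) = expR (c * S) + expR (- (c * S)).
      by move=> c0; rewrite -uS; case: (ler0P u) => _ //; rewrite mulrN opprK addrC.
    apply: (@le_trans _ _ (C * expR (A * (expR (b * u) + expR (- (b * u)))) *
        expR (- (del * (kap * T u))))).
      rewrite ler_pM ?normc_ge0 ?expR_ge0 ?Fgr// ler_expR lerN2 ler_wpM2l ?(ltW del0)//.
      by rewrite ler_wpM2r ?(ltW (T0 _))// coskap.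
    rewrite -mulrA -expRD /T (symb b b0) (symb be (ltW be0)).
    set X := expR (b * S); set Y := expR (be * S).
    have X1 : 1 <= X by rewrite -expR0 ler_expR mulr_ge0// ltW.
    have XN : expR (- (b * S)) <= X by rewrite ler_expR; have : 0 <= b * S by [rewrite mulr_ge0// ltW]; lra.
    have YX : Y = expR ((be - b) * S) * X by rewrite -expRD -mulrDl subrK.
    have Y1 : (2 * A + K) * X <= del * kap * Y.
      rewrite YX mulrA ler_wpM2r//; first by rewrite ltW// (lt_le_trans ltr01).
      by rewrite [leRHS]mulrC -ler_pdivrMr.
    have YN : 0 <= del * kap * expR (- (be * S)) by rewrite mulr_ge0 ?expR_ge0// ltW.
    have AX : A * expR (- (b * S)) <= A * X by rewrite ler_wpM2l.
    have KX : K * 1 <= K * X by rewrite ler_wpM2l.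
    apply: (@le_trans _ _ (C * expR (- K))).
      by rewrite ler_wpM2l// ler_expR; lra.
    rewrite expRN ler_pdivrMr ?expR_gt0//.
    apply: (@le_trans _ _ (M' * K)).
      by rewrite /K mulrCA mulfV ?mulr1// gt_eqF.
    by rewrite ler_pM2l// (le_trans _ (expR_ge1Dx _))//; lra.
  have GW : holo (fun z => F z * W del z) by exact: holoM.
  have hi : inside (- S) S (t0 - al) (t0 + al) (s +i* t).
    move: tal; rewrite ltr_norml => /andP[t1 t2].
    have := ler_norm s; have := ler_norm (- s); rewrite normrN => s1 s2.
    by split; apply/andP; split; rewrite /=; lra.
  have W1 u v : `|v - t0| <= al -> normc (W del (u +i* v)) <= 1.
    move=> val; rewrite WE -expR0 ler_expR oppr_le0 mulr_ge0 ?(ltW del0)// mulr_ge0 ?(ltW (T0 _))//.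
    by rewrite (le_trans (ltW kap0))// coskap.
  have := max_principle GW hi (M := M').
  rewrite normcM WE => H.
  apply: (@le_trans _ _ (normc (F (s +i* t)) * expR (- (del * (cos (be * (t - t0)) * T s))))).
    rewrite ler_wpM2l ?normc_ge0// ler_expR lerN2 ler_wpM2l ?(ltW del0)//.
    by rewrite ger_pMl// cos_le1.
  apply: H => -[u v] /= [[/= hu hv]|[/= hv hu]]; rewrite normcM.
    have val : `|v - t0| <= al by case: hv => ->; rewrite ler_norml; apply/andP; split; lra.
    rewrite -[M']mulr1 ler_pM ?normc_ge0 ?W1// /M'.
    by case: hv => ->; apply: ler_wpDr; rewrite ?(ltW eta0).
  apply: edge.
    by case: hu => ->; rewrite ?normrN gtr0_norm.
  by rewrite ler_norml; lra.
apply/ler_addgt0Pr => e e0.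
set N := normc _ in key *.
have N0 : 0 <= N := normc_ge0 _.
have NT : 0 <= N * T s by rewrite mulr_ge0// ltW.
pose del := e / (N * T s + 1).
have N1 : 0 < N * T s + 1 by lra.
have del0 : 0 < del by rewrite divr_gt0.
have := key _ del0.
have : N * (1 - del * T s) <= N * expR (- (del * T s)).
  by rewrite ler_wpM2l// (le_trans _ (expR_ge1Dx _)).
have : del * (N * T s) <= e.
  by rewrite /del mulrAC ler_pdivrMr// ler_pM2l//; lra.
lra.
Qed.

(* In the coordinate [log z] the quadrants and the half-plane become strips, and all functions stay entire. *)
Lemma phragmen_lindelof_halfplane G (sg A C C' M : R) : holo G -> 0 <= A -> 0 <= C ->
  (forall z, normc (G z) <= C * expR (A * normc z)) ->
  (forall x : R, normc (G x%:C) <= M) ->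
  (forall y : R, 0 <= y -> normc (G (0 +i* y)) <= C' * expR (sg * y)) ->
  forall y : R, 0 < y -> normc (G (0 +i* y)) <= M * expR (sg * y).
Proof.
move=> Gh A0 C0 Ggr GM Gi y y0.
(* The second factor has modulus [exp (- sg Im z)]: it is 1 on the real line and cancels the growth
   on the imaginary axis. *)
pose H w := let z := cexp w in G z * cexp (0 +i* sg * z).
have Hh : holo H.
  apply: holoM; first by apply: holo_comp => //; exact: holo_cexp.
  apply: (holo_comp holo_cexp); apply: holoM; [exact: holo_cst|exact: holo_cexp].
have HE s t : normc (H (s +i* t)) =
    normc (G (cexp (s +i* t))) * expR (- (sg * (expR s * sin t))).
  by rewrite /H normcM normc_cexp /cexp /=; congr (_ * expR _); rewrite mul0r sub0r.
have pi0 := pi_gt0 R.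
have Hgr s t : normc (H (s +i* t)) <= C * expR ((A + `|sg|) * (expR (1 * s) + expR (- (1 * s)))).
  rewrite HE mul1r.
  apply: (@le_trans _ _ (C * expR (A * expR s) * expR (`|sg| * expR s))).
    rewrite ler_pM ?normc_ge0 ?expR_ge0//.
      by rewrite (le_trans (Ggr _))// normc_cexp.
    rewrite ler_expR (le_trans (ler_norm _))// normrN normrM ler_wpM2l//.
    rewrite normrM ger0_norm ?expR_ge0// ler_piMr ?expR_ge0//.
    by rewrite ler_norml sin_geN1 sin_le1.
  rewrite -mulrA ler_wpM2l// -expRD ler_expR -mulrDl ler_wpM2l ?addr_ge0//.
  by rewrite lerDl expR_ge0.
have H0 s : normc (H (s +i* 0)) <= M.
  rewrite HE sin0 mulr0 mulr0 oppr0 expR0 mulr1 /cexp /= cos0 sin0 mulr1 mulr0; exact: GM.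
have Hpi s : normc (H (s +i* pi)) <= M.
  rewrite HE sinpi mulr0 mulr0 oppr0 expR0 mulr1 /cexp /= cospi sinpi mulr0; exact: GM.
have Hpi2 s : normc (H (s +i* (pi / 2))) <= C'.
  rewrite HE sin_pihalf mulr1 /cexp /= cos_pihalf sin_pihalf mulr1 mulr0.
  rewrite (le_trans (ler_wpM2r _ (Gi _ _))) ?expR_ge0//.
  by rewrite -mulrA -expRD subrr expR0 mulr1.
pose M1 := Num.max M C'.
have M10 : 0 <= M1 by rewrite le_max (le_trans _ (GM 0)) ?normc_ge0.
(* A quadrant is a strip of half-width [pi / 4], so [be = 3 / 2] is admissible and exceeds the order
   [b = 1] of [H]. *)
have Q1 s t : 0 <= t <= pi / 2 -> normc (H (s +i* t)) <= M1.
  move=> /andP[]; rewrite le_eqVlt => /predU1P[<-|t0]; first by rewrite le_max H0.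
  rewrite le_eqVlt => /predU1P[->|t1]; first by rewrite le_max Hpi2 orbT.
  apply: (@phragmen_lindelof_strip H (pi / 4) (pi / 4) (3 / 2) 1 (A + `|sg|) C M1) => //; try lra.
  - by rewrite addr_ge0.
  - by move=> u; rewrite subrr le_max H0.
  - move=> u; rewrite (_ : pi / 4 + pi / 4 = pi / 2); last by field.
    by rewrite le_max Hpi2 orbT.
  - by rewrite ltr_norml; lra.
have Q2 s t : pi / 2 <= t <= pi -> normc (H (s +i* t)) <= M1.
  move=> /andP[]; rewrite le_eqVlt => /predU1P[<-|t0]; first by rewrite le_max Hpi2 orbT.
  rewrite le_eqVlt => /predU1P[->|t1]; first by rewrite le_max Hpi.
  apply: (@phragmen_lindelof_strip H (3 * pi / 4) (pi / 4) (3 / 2) 1 (A + `|sg|) C M1) => //; try lra.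
  - by rewrite addr_ge0.
  - move=> u; rewrite (_ : 3 * pi / 4 - pi / 4 = pi / 2); last by field.
    by rewrite le_max Hpi2 orbT.
  - move=> u; rewrite (_ : 3 * pi / 4 + pi / 4 = pi); last by field.
    by rewrite le_max Hpi.
  - by rewrite ltr_norml; lra.
(* The half-plane is a strip of half-width [pi / 2], for which order 1 would be critical. The bounds
   on the quadrants leave a bounded function, so [b = 0] and [be = 1 / 2]; the gain is that [M1]
   becomes [M], the bound on the real line alone. *)
have : normc (H (ln y +i* (pi / 2))) <= M.
  apply: (@phragmen_lindelof_strip H (pi / 2) (pi / 2) (1 / 2) 0 0 M1 M) => //; try lra.
  - by move=> u; rewrite subrr.
  - by move=> u; rewrite (_ : pi / 2 + pi / 2 = pi)//; field.
  - move=> s t; rewrite ler_norml mul0r expR0 mulr1 => /andP[t1 t2].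
    case: (leP t (pi / 2)) => t3; first by apply: Q1; lra.
    by apply: Q2; lra.
  - by rewrite subrr normr0; lra.
rewrite HE sin_pihalf mulr1 /cexp /= cos_pihalf sin_pihalf mulr1 mulr0 lnK ?posrE//.
by rewrite expRN ler_pdivrMr ?expR_gt0.
Qed.

(** Both half-planes, the lower one through [G (- z)], with exponent [a + e]; letting [e] tend to 0
    leaves exactly [a]. *)
Lemma exp_type_bound G (a M : R) : holo G -> 0 <= a -> exp_type_le a G ->
  (forall x : R, normc (G x%:C) <= M) ->
  forall y : R, normc (G (0 +i* y)) <= M * expR (a * `|y|).
Proof.
move=> Gh a0 Ga GM y.
have M0 : 0 <= M := le_trans (normc_ge0 _) (GM 0).
have up G' e y' : holo G' -> (exists C, forall z, normc (G' z) <= C * expR ((a + e) * normc z)) ->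
    (forall x : R, normc (G' x%:C) <= M) -> 0 < e -> 0 < y' ->
    normc (G' (0 +i* y')) <= M * expR ((a + e) * y').
  move=> Gh' [C HC] GM' e0 y'0.
  have C0 : 0 <= C.
    by have := HC 0; rewrite Normc.normc0 mulr0 expR0 mulr1; apply: le_trans; exact: normc_ge0.
  apply: (@phragmen_lindelof_halfplane G' (a + e) (a + e) C C M) => //; first by lra.
  move=> u u0; rewrite (le_trans (HC _))// /= expr0n add0r sqrtr_sqr ger0_norm//.
have ub e : 0 < e -> normc (G (0 +i* y)) <= M * expR ((a + e) * `|y|).
  move=> e0; have [y0|y0|->] := ltgtP y 0.
  - rewrite ltr0_norm//.
    have -> : G (0 +i* y) = (fun z => G (- z)) (0 +i* (- y)).
      by congr G; apply/eqP; rewrite eq_complex /= oppr0 opprK !eqxx.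
    apply: (up (fun z => G (- z))) => //; last by lra.
    + by apply: holo_comp => //; have := holoB (holo_cst (0 : R[i])) holo_id;
        under [X in holo X]eq_fun do rewrite sub0r.
    + by have [C HC] := Ga _ e0; exists C => z; rewrite (le_trans (HC _))// normcN.
    + by move=> x; rewrite -rmorphN; exact: GM.
  - by rewrite gtr0_norm//; apply: up => //; exact: Ga.
  - by rewrite normr0 mulr0 expR0 mulr1; exact: (GM 0).
set N := normc _ in ub *.
have E0 := expR_gt0 (a * `|y|).
have key e : 0 < e -> N * (1 - e * `|y|) <= M * expR (a * `|y|).
  move=> e0; apply: (@le_trans _ _ (N * expR (- (e * `|y|)))).
    by rewrite ler_wpM2l ?normc_ge0// (le_trans _ (expR_ge1Dx _)).
  rewrite expRN ler_pdivrMr ?expR_gt0// -mulrA -expRD -mulrDl; exact: ub.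
apply/ler_addgt0Pr => e e0.
have N0 : 0 <= N * `|y| by rewrite mulr_ge0 ?normc_ge0.
have N1 : 0 < N * `|y| + 1 by lra.
have := key _ (divr_gt0 e0 N1).
have : e / (N * `|y| + 1) * (N * `|y|) <= e by rewrite mulrAC ler_pdivrMr// ler_pM2l//; lra.
lra.
Qed.

End phragmen_lindelof.

(** * Measurability on the plane; integrals over lines and boxes *)

Section plane_measurability.
Context {R : realType}.
Notation mR := (measurableTypeR R).

Definition jcont (f : R * R -> R) := forall x y e : R, 0 < e ->
  exists2 D : R, 0 < D & forall s t : R, `|s| < D -> `|t| < D ->
  `|f (x + s, y + t) - f (x, y)| <= e.

(** A superlevel set is open, hence a countable union of boxes with rational centres and half-sides
    [1 / n.+1], each of which lies in the product sigma-algebra. *)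
Lemma measurable_jcont (f : mR * mR -> mR) : jcont f -> measurable_fun setT f.
Proof.
move=> fc mD; apply: (measurability _ (RGenOInfty.measurableE R)) => // _ [_ [r ->] <-].
rewrite setTI.
pose box (n : nat) (q1 q2 : rat) : set (mR * mR) :=
  `]ratr q1 - n.+1%:R^-1, ratr q1 + n.+1%:R^-1[%classic `*` `]ratr q2 - n.+1%:R^-1, ratr q2 + n.+1%:R^-1[%classic.
pose U := f @^-1` `]r, +oo[.
pose boxU n q1 q2 := [set p | box n q1 q2 `<=` U /\ box n q1 q2 p].
rewrite -[X in measurable X]/U.
have -> : U = \bigcup_(n : nat) \bigcup_(q1 : rat) \bigcup_(q2 : rat) boxU n q1 q2.
  apply/seteqP; split=> [[x y]|p [n _ [q1 _ [q2 _ [bs]]]]]; last exact: bs.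
  rewrite /U /= in_itv /= andbT => rf.
  have e0 : 0 < (f (x, y) - r) / 2 by rewrite divr_gt0// subr_gt0.
  have [D D0 HD] := fc x y _ e0.
  pose n := Num.truncn (2 / D).
  have nD : 2 * n.+1%:R^-1 < D.
    by rewrite ltr_pdivrMr// mulrC -ltr_pdivrMr// truncnS_gt.
  have n0 : 0 < n.+1%:R^-1 :> R by rewrite invr_gt0.
  set k : R := n.+1%:R^-1 in nD n0.
  have rat_near (u : R) : exists q : rat, u - k < ratr q < u + k.
    have [|q] := @rat_in_itvoo _ (u - k) (u + k); first by lra.
    by rewrite in_itv /=; exists q.
  have [q1 /andP[h1 h2]] := rat_near x; have [q2 /andP[h3 h4]] := rat_near y.
  exists n => //; exists q1 => //; exists q2 => //; split.
    move=> [u v] [] /=; rewrite !in_itv /= -/k => /andP[u1 u2] /andP[v1 v2].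
    rewrite /U /= in_itv /= andbT.
    have := HD (u - x) (v - y); rewrite !subrKC ltr_norml => H.
    have : `|f (u, v) - f (x, y)| <= (f (x, y) - r) / 2.
      by apply: H; rewrite ?ltr_norml; lra.
    by rewrite ler_norml => /andP[+ _]; lra.
  by split; rewrite /= in_itv /= -/k; lra.
apply: bigcup_measurable => n _; apply: bigcupT_measurable_rat => q1.
apply: bigcupT_measurable_rat => q2.
case: (pselect (box n q1 q2 `<=` U)) => bU; last first.
  by rewrite (_ : boxU _ _ _ = set0)//; apply/seteqP; split=> // p [].
rewrite (_ : boxU _ _ _ = box n q1 q2); last by apply/seteqP; split=> [p []|].
by apply: measurableX; exact: measurable_itv.
Qed.

Implicit Types F : R[i] -> R[i].

Definition msq F (p : R * R) : R := normc (F (p.1 +i* p.2)) ^+ 2.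

Lemma msq_ge0 F p : 0 <= msq F p.
Proof. by rewrite exprn_ge0// normc_ge0. Qed.

Lemma jcont_msq F : holo F -> jcont (msq F).
Proof.
move=> /holoP Fh x y e e0.
have [k Fk] := Fh (x +i* y).
pose N := normc (F (x +i* y)).
have N0 : 0 <= N := normc_ge0 _.
pose e' := Num.min 1 (e / (2 * N + 1)).
have N1 : 0 < 2 * N + 1 by lra.
have e'0 : 0 < e' by rewrite lt_min ltr01 divr_gt0.
have [D D0 HD] := cder_cont Fk e'0.
exists (D / 2); first by rewrite divr_gt0.
move=> s t sD tD; rewrite /msq /=.
have := HD (s +i* t); have -> : x +i* y + s +i* t = (x + s) +i* (y + t) by simpc.
move=> /(_ (le_lt_trans (normc_le_ReIm _) _))/=; rewrite (_ : `|s| + `|t| < D); last by lra.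
move=> /(_ isT); set w := F _ => H.
have nw : `|normc w - N| <= e'.
  rewrite ler_norml; have := normcD (w - F (x +i* y)) (F (x +i* y)); rewrite subrK -/N.
  have := normcD (F (x +i* y) - w) w; rewrite subrK -/N normc_distC; lra.
rewrite -/N subr_sqr normrM.
have : e' <= 1 /\ e' <= e / (2 * N + 1) by split; rewrite ge_min lexx ?orbT.
move=> [e1 e2].
have nn : `|normc w + N| <= 2 * N + 1.
  rewrite ger0_norm ?addr_ge0 ?normc_ge0//; move: nw; rewrite ler_norml; lra.
rewrite (le_trans (ler_pM _ _ nw nn))// -ler_pdivlMr//.
Qed.

Lemma measurable_msq F : holo F -> measurable_fun setT (msq F : (mR * mR)%type -> mR).
Proof. by move=> Fh; apply: measurable_jcont; exact: jcont_msq. Qed.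

Local Open Scope ereal_scope.

Definition leb_preserving (phi : R -> R) :=
  measurable_fun (T := mR) (U := mR) setT phi /\
  forall A : set mR, measurable A -> leb R (phi @^-1` A) = leb R A.

Lemma leb_preserving_shift (c : R) : leb_preserving (fun x => x + c)%R.
Proof.
have mphi : measurable_fun (T := mR) (U := mR) setT (fun x => x + c)%R.
  by apply: measurable_funD.
split=> // A mA.
have mphi' : measurable_fun [set: mR] (fun x : mR => (x + c)%R : mR) := mphi.
apply/esym.
pose m := pushforward (leb R) (fun x : mR => (x + c)%R : mR).
rewrite -[RHS]/(m A).
apply: (lebesgue_measure_unique (mu := m)) => //= _ [[a b]] _ <-.
rewrite /m /pushforward /=.
rewrite (_ : _ @^-1` _ = `]a - c, b - c]%classic)%R; last first.
  by apply/seteqP; split=> x /=; rewrite !in_itv /= => /andP[? ?]; apply/andP; split; lra.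
by rewrite !lebesgue_measure_itv /= !lte_fin ltrD2r -!EFinB; congr (if _ then _%:E else _); ring.
Qed.

Lemma leb_preserving_reflect (c : R) : leb_preserving (fun x => c - x)%R.
Proof.
have [m1 p1] := leb_preserving_shift c.
have mN : measurable_fun (T := mR) (U := mR) setT (fun x => - x)%R by apply: continuous_measurable_fun; exact: opp_continuous.
have E : (fun x : R => c - x)%R = (fun x => x + c)%R \o (fun x => - x)%R.
  by apply/funext => x /=; rewrite addrC.
split=> [|A mA]; first by rewrite E; exact: measurableT_comp.
have mA1 : measurable ((fun x : R => x + c)%R @^-1` A : set mR).
  by rewrite -[X in measurable X]setTI; exact: m1.
by rewrite E comp_preimage -[RHS]p1// -[RHS]lebesgue_measureN.
Qed.

Lemma integral_leb_preserving (phi : R -> R) (f : R -> \bar R) (D : set mR) :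
  leb_preserving phi -> measurable D -> measurable_fun (T := mR) setT f -> (forall x, 0 <= f x) ->
  \int[leb R]_(x in D) f x = \int[leb R]_(x in phi @^-1` D) f (phi x).
Proof.
move=> [mphi pphi] mD mf f0.
rewrite -(@ge0_integral_pushforward _ _ _ _ _ (phi : mR -> mR))//; last exact: measurable_funTS.
by apply: eq_measure_integral => A mA _; exact/esym/pphi.
Qed.

Lemma integral_shift (c : R) (f : R -> \bar R) :
  measurable_fun (T := mR) setT f -> (forall x, 0 <= f x) ->
  \int[leb R]_x f (x + c)%R = \int[leb R]_x f x.
Proof.
move=> mf f0; rewrite [RHS](integral_leb_preserving (leb_preserving_shift c))//.
Qed.

(** For [g = msq F] this is the squared L^2 norm of F on the line Im z = y; at [y = 0] it is the
    L(F) of the overview. *)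
Definition slice (g : R * R -> R) (y : R) : \bar R := \int[leb R]_x (g (x, y))%:E.

(** The half-height [a] precedes the half-width [b], against the order of the centre [x y]. *)
Definition box (g : R * R -> R) (x y a b : R) : \bar R :=
  \int[leb R]_(v in `[(y - a)%R, (y + a)%R]) \int[leb R]_(u in `[(x - b)%R, (x + b)%R]) (g (u, v))%:E.

Definition ind (a b x : R) : R := if (a <= x <= b)%R then 1%R else 0%R.

Lemma ind_ge0 a b x : (0 <= ind a b x)%R.
Proof. by rewrite /ind; case: ifP. Qed.

Lemma measurable_ind a b : measurable_fun (T := mR) (U := mR) setT (ind a b).
Proof.
have -> : ind a b = (\1_(`[a, b]%classic : set mR) : R -> R).
  by apply/funext => x; rewrite indicE /ind mem_setE in_itv /=; case: ifP.
exact: measurable_indic.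
Qed.

Lemma integral_ind (f : R -> \bar R) (a b : R) :
  \int[leb R]_(x in `[a, b]) f x = \int[leb R]_x ((ind a b x)%:E * f x).
Proof.
rewrite integral_mkcond; apply: eq_integral => x _.
rewrite patchE mem_setE in_itv /= /ind; case: ifP => _; by rewrite ?mul1e ?mul0e.
Qed.

Implicit Types g : R * R -> R.

Lemma measurable_fin (d : measure_display) (T : measurableType d) (f : T -> mR) :
  measurable_fun setT f -> measurable_fun setT (fun x => (f x)%:E).
Proof. by move=> mf; exact/measurable_EFinP. Qed.

Lemma measurable_slice g : measurable_fun (setT : set (mR * mR)) (g : _ -> mR) ->
  (forall p, 0 <= g p)%R -> measurable_fun (T := mR) setT (slice g).
Proof.
move=> mg g0; apply: (measurable_fun_fubini_tonelli_G (m1 := leb R) (fun p : mR * mR => (g p)%:E)) => //.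
exact: measurable_fin.
Qed.

Lemma measurable_row g v : measurable_fun (setT : set (mR * mR)) (g : _ -> mR) ->
  measurable_fun (T := mR) setT (fun u => (g (u, v))%:E).
Proof.
by move=> mg; apply: measurable_fin; exact: (measurable_fun_pair1 (f := g : mR * mR -> mR) v mg).
Qed.

Lemma slice_ge0 g y : (forall p, 0 <= g p)%R -> 0 <= slice g y.
Proof. by move=> g0; apply: integral_ge0 => x _; rewrite lee_fin. Qed.

Definition boxg g (a b c d : R) (p : R * R) : R := (ind a b p.1 * ind c d p.2 * g p)%R.

Lemma boxg_ge0 g a b c d p : (forall p, 0 <= g p)%R -> (0 <= boxg g a b c d p)%R.
Proof. by move=> g0; rewrite !mulr_ge0 ?ind_ge0. Qed.

Lemma measurable_boxg g a b c d : measurable_fun (setT : set (mR * mR)) (g : _ -> mR) ->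
  measurable_fun (setT : set (mR * mR)) (boxg g a b c d : _ -> mR).
Proof.
move=> mg; apply: measurable_funM => //; apply: measurable_funM.
- exact: (measurableT_comp (measurable_ind a b) measurable_fst).
- exact: (measurableT_comp (measurable_ind c d) measurable_snd).
Qed.

Lemma boxE g x y a b : measurable_fun (setT : set (mR * mR)) (g : _ -> mR) ->
  (forall p, 0 <= g p)%R ->
  box g x y a b = \int[leb R]_v slice (boxg g (x - b) (x + b) (y - a) (y + a))%R v.
Proof.
move=> mg g0; rewrite /box integral_ind; apply: eq_integral => v _.
rewrite integral_ind /slice -ge0_integralZl//.
- by apply: eq_integral => u _; rewrite /boxg /= -!EFinM mulrA [(ind _ _ v * _)%R]mulrC.
- apply: emeasurable_funM; first exact: measurable_fin (measurable_ind _ _).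
  exact: measurable_row.
- by move=> u _; rewrite mule_ge0 ?lee_fin// ind_ge0.
- by rewrite lee_fin ind_ge0.
Qed.

Lemma box_le_strip g x y a b : measurable_fun (setT : set (mR * mR)) (g : _ -> mR) ->
  (forall p, 0 <= g p)%R ->
  box g x y a b <= \int[leb R]_(v in `[(y - a)%R, (y + a)%R]) slice g v.
Proof.
move=> mg g0; rewrite boxE// integral_ind.
have bg0 p : (0 <= boxg g (x - b) (x + b) (y - a) (y + a) p)%R by exact: boxg_ge0.
have bgm := measurable_boxg (x - b)%R (x + b)%R (y - a)%R (y + a)%R mg.
apply: ge0_le_integral => //.
- by move=> v _; exact: slice_ge0.
- exact: measurable_slice.
- by apply: emeasurable_funM; [exact: measurable_fin (measurable_ind _ _)|exact: measurable_slice].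
move=> v _; have mr := measurable_row v mg.
rewrite /slice -ge0_integralZl//.
- apply: ge0_le_integral => //.
  + by move=> u _; rewrite lee_fin.
  + exact: measurable_row.
  + exact: emeasurable_funM.
  + move=> u _; rewrite -EFinM lee_fin /boxg /= -mulrA /ind; case: ifP => _; first by rewrite mul1r.
    by rewrite mul0r mulr_ge0//; case: ifP.
- by move=> u _; rewrite lee_fin.
- by rewrite lee_fin ind_ge0.
Qed.

Lemma tonelli d1 d2 (T1 : measurableType d1) (T2 : measurableType d2)
    (m1 : {sigma_finite_measure set T1 -> \bar R}) (m2 : {sigma_finite_measure set T2 -> \bar R})
    (K : T1 * T2 -> \bar R) : measurable_fun setT K -> (forall p, 0 <= K p) ->
  [/\ measurable_fun setT (fun x => \int[m2]_y K (x, y)),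
      \int[m1 \x m2]_p K p = \int[m2]_y \int[m1]_x K (x, y) &
      \int[m1]_x \int[m2]_y K (x, y) = \int[m2]_y \int[m1]_x K (x, y)].
Proof.
move=> mK K0; split.
- exact: measurable_fun_fubini_tonelli_F.
- by rewrite fubini_tonelli2.
- exact: (fubini_tonelli (m1 := m1) (m2 := m2) K).
Qed.

Lemma integral_ind_const (u b c : R) : (0 <= b)%R -> (0 <= c)%R ->
  \int[leb R]_x (ind (- b) b (u - x) * c)%:E = (2 * b)%:E * c%:E.
Proof.
move=> b0 c0.
have E x : ind (- b) b (u - x) = ind (u - b) (u + b) x.
  rewrite /ind (_ : (- b <= u - x <= b)%R = (u - b <= x <= u + b)%R)//.
  by apply/idP/idP; lra.
transitivity (\int[leb R]_(x in `[(u - b)%R, (u + b)%R]) (c%:E : \bar R)).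
  by rewrite integral_ind; apply: eq_integral => x _; rewrite E EFinM.
rewrite integral_cst//= lebesgue_measure_itv /= lte_fin muleC.
case: ifP => [_|/negbT]; first by rewrite -EFinB; congr (_%:E * _); ring.
by rewrite -leNgt => h; congr (_%:E * _); lra.
Qed.

(* Each point of the strip lies in the boxes centred on an interval of length 2b. *)
Lemma integral_box g y a b : (0 <= b)%R -> measurable_fun (setT : set (mR * mR)) (g : _ -> mR) ->
  (forall p, 0 <= g p)%R ->
  measurable_fun (T := mR) setT (fun x => box g x y a b) /\
  \int[leb R]_x box g x y a b =
  (2 * b)%:E * \int[leb R]_(v in `[(y - a)%R, (y + a)%R]) slice g v.
Proof.
move=> b0 mg g0.
pose H (p : mR * mR) : mR := (ind (y - a) (y + a) p.2 * g p)%R.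
have H0 p : (0 <= H p)%R by rewrite mulr_ge0 ?ind_ge0.
have mH : measurable_fun setT H.
  apply: measurable_funM => //.
  exact: (measurableT_comp (measurable_ind (y - a) (y + a)) measurable_snd).
have RE : (2 * b)%:E * \int[leb R]_(v in `[(y - a)%R, (y + a)%R]) slice g v =
    \int[leb R]_v \int[leb R]_u ((2 * b)%:E * (H (u, v))%:E).
  rewrite integral_ind -ge0_integralZl//.
  - apply: eq_integral => v _; have mv := measurable_row v mH.
    rewrite ge0_integralZl//; [|by move=> u _; rewrite lee_fin|by rewrite lee_fin mulr_ge0].
    congr (_ * _); rewrite /slice -ge0_integralZl//; first exact: measurable_row.
      by move=> u _; rewrite lee_fin.
    by rewrite lee_fin ind_ge0.
  - by apply: emeasurable_funM; [exact: measurable_fin (measurable_ind _ _)|exact: measurable_slice].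
  - by move=> v _; rewrite mule_ge0 ?slice_ge0// lee_fin ind_ge0.
  - by rewrite lee_fin mulr_ge0.
rewrite {}RE.
(* With [q = ((x, v), u)]: integrating in [u] and [v] gives the box centred at [x], while
   integrating in [x] first gives the factor [2 b]. *)
pose K (q : mR * mR * mR) : \bar R := (ind (- b) b (q.2 - q.1.1) * H (q.2, q.1.2))%:E%R.
have K0 q : 0 <= K q by rewrite lee_fin mulr_ge0 ?ind_ge0.
have mK : measurable_fun setT K.
  apply: measurable_fin; apply: measurable_funM.
    apply: (measurableT_comp (measurable_ind (- b) b)); apply: measurable_funB.
      exact: measurable_snd.
    exact: (measurableT_comp measurable_fst measurable_fst).
  apply: (measurableT_comp mH); apply: measurable_fun_pair; first exact: measurable_snd.
  exact: (measurableT_comp measurable_snd measurable_fst).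
pose L (p : mR * mR) := \int[leb R]_u K (p, u).
have mL : measurable_fun setT L by exact: (measurable_fun_fubini_tonelli_F (m2 := leb R) K).
have L0 p : 0 <= L p by apply: integral_ge0 => u _.
have indE x u : ind (- b) b (u - x) = ind (x - b) (x + b) u.
  rewrite /ind (_ : (- b <= u - x <= b)%R = (x - b <= u <= x + b)%R)//.
  by apply/idP/idP; lra.
have [mF _ LE] := tonelli (leb R) (leb R) mL L0.
have -> : (fun x => box g x y a b) = (fun x => \int[leb R]_v L (x, v)).
  apply/funext => x; rewrite (boxE x y a b mg g0); apply: eq_integral => v _.
  rewrite /slice /L; apply: eq_integral => u _.
  by rewrite /K /H /= /boxg /= indE mulrA.
split; first exact: mF.
rewrite LE; apply: eq_integral => v _.
have mKv : measurable_fun setT (fun p : mR * mR => K ((p.1, v), p.2)).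
  apply: (measurableT_comp mK); apply: measurable_fun_pair; last exact: measurable_snd.
  by apply: measurable_fun_pair; [exact: measurable_fst|exact: measurable_cst].
have [_ _] := tonelli (leb R) (leb R) mKv (fun p => K0 _).
rewrite /L /= => ->; apply: eq_integral => u _.
by rewrite /K /= (integral_ind_const _ b0 (H0 (u, v))).
Qed.

End plane_measurability.

(** * Mean value inequalities for the squared modulus *)

Section mean_value.
Context {R : realType}.
Notation mR := (measurableTypeR R).
Implicit Types (F : R[i] -> R[i]) (x y : R).
Local Open Scope ereal_scope.

Lemma leb_preserving_shiftl (c : R) : leb_preserving (fun x => c + x)%R.
Proof.
have -> : (fun x => c + x)%R = (fun x => x + c)%R by apply/funext => x; rewrite addrC.
exact: leb_preserving_shift.
Qed.

Lemma integral_affine_le (phi : R -> R) (f : R -> \bar R) (D E : set mR) :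
  leb_preserving phi -> measurable D -> measurable E ->
  measurable_fun (T := mR) setT f -> (forall x, 0 <= f x) ->
  D `<=` phi @^-1` E -> \int[leb R]_(x in D) f (phi x) <= \int[leb R]_(x in E) f x.
Proof.
move=> pphi mD mE mf f0 DE; rewrite (integral_leb_preserving pphi mE mf f0).
have [mphi _] := pphi.
apply: ge0_subset_integral => //.
- by rewrite -[X in measurable X]setTI; exact: mphi.
- by apply: measurable_funTS; apply: (measurableT_comp mf).
Qed.

Definition hside (g : R * R -> R) (a b v : R) : \bar R := \int[leb R]_(u in `[a, b]) (g (u, v))%:E.

Lemma hside_ge0 g a b v : (forall p, 0 <= g p)%R -> 0 <= hside g a b v.
Proof. by move=> g0; apply: integral_ge0 => u _; rewrite lee_fin. Qed.

Lemma measurable_hside g a b : measurable_fun (setT : set (mR * mR)) (g : _ -> mR) ->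
  (forall p, 0 <= g p)%R -> measurable_fun (T := mR) setT (hside g a b).
Proof.
move=> mg g0.
have -> : hside g a b = slice (fun p => ind a b p.1 * g p)%R.
  by apply/funext => v; rewrite /hside integral_ind.
apply: measurable_slice; last by move=> p; rewrite mulr_ge0 ?ind_ge0.
apply: measurable_funM => //; exact: (measurableT_comp (measurable_ind a b) measurable_fst).
Qed.

(** Exchanging the coordinates lets the facts on horizontal sides serve for the vertical ones. *)
Definition swapg (g : R * R -> R) (p : R * R) := g (p.2, p.1).

Lemma measurable_swapg g : measurable_fun (setT : set (mR * mR)) (g : _ -> mR) ->
  measurable_fun (setT : set (mR * mR)) (swapg g : _ -> mR).
Proof.
move=> mg; apply: (measurableT_comp mg); apply: measurable_fun_pair.
  exact: measurable_snd.
exact: measurable_fst.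
Qed.

Lemma box_swap g x y a b : measurable_fun (setT : set (mR * mR)) (g : _ -> mR) ->
  (forall p, 0 <= g p)%R -> box (swapg g) y x b a = box g x y a b.
Proof.
move=> mg g0; have g'0 p : (0 <= swapg g p)%R by exact: g0.
rewrite (boxE y x b a (measurable_swapg mg) g'0) (boxE x y a b mg g0).
have mb := measurable_boxg (x - b)%R (x + b)%R (y - a)%R (y + a)%R mg.
have [_ _] := tonelli (leb R) (leb R) (measurable_fin mb) (fun p => boxg_ge0 _ _ _ _ p g0).
rewrite /slice /= => <-; apply: eq_integral => v _; apply: eq_integral => u _.
by rewrite /boxg /= /swapg /= [(ind _ _ u * _)%R]mulrC.
Qed.

Lemma lee_sum4 (a b c d : R) (X Y Z T : \bar R) : 0 <= X -> 0 <= Y -> 0 <= Z -> 0 <= T ->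
  a%:E <= 2%:E * X -> b%:E <= 2%:E * Y -> c%:E <= 2%:E * Z -> d%:E <= 2%:E * T ->
  ((a + b) + (c + d))%:E <= 2%:E * ((X + Y) + (Z + T)).
Proof.
move=> X0 Y0 Z0 T0 aX bY cZ dT.
rewrite (ge0_muleDr _ (adde_ge0 X0 Y0) (adde_ge0 Z0 T0)) (ge0_muleDr _ X0 Y0) (ge0_muleDr _ Z0 T0).
by rewrite !EFinD; apply: leeD; apply: leeD.
Qed.

Lemma normc_contour_sides (G : R[i] -> R[i]) x y r (r0 : (1 <= r)%R) : frame G (x - r) (x + r) (y - r) (y + r) ->
  ((normc (contour G (x - r) (x + r) (y - r) (y + r)))%:E <= 2%:E * (
   (hside (fun p => normc (G (p.1 +i* p.2))) (x - r) (x + r) (y - r) +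
   hside (swapg (fun p => normc (G (p.1 +i* p.2)))) (y - r) (y + r) (x + r)) +
   (hside (fun p => normc (G (p.1 +i* p.2))) (x - r) (x + r) (y + r) +
   hside (swapg (fun p => normc (G (p.1 +i* p.2)))) (y - r) (y + r) (x - r))))%E.
Proof.
move=> [f1 f2 f3 f4].
have h1 : (x - r <= x + r)%R by lra.
have h2 : (y - r <= y + r)%R by lra.
have b1 := normc_cint_int h1 f1; have b2 := normc_cint_int h1 f2.
have b3 := normc_cint_int h2 f3; have b4 := normc_cint_int h2 f4.
rewrite /contour; set A := cint _ _ _ in b1 *; set B := cint _ _ _ in b4 *.
set C := cint _ _ _ in b2 *; set D := cint _ _ _ in b3 *.
have n0 g a b v : (forall p, 0 <= g p)%R -> 0 <= hside g a b v by exact: hside_ge0.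
apply: (@le_trans _ _ ((normc A + normc B) + (normc C + normc D))%:E).
  rewrite lee_fin (_ : A + _ - _ - _ = (A + 'i * B) - (C + 'i * D))%R; last by ring.
  rewrite (le_trans (normcB _ _))// lerD// (le_trans (normcD _ _))// lerD//;
    by rewrite normcM normc_i mul1r.
by apply: lee_sum4 => //; apply: n0 => p; exact: normc_ge0.
Qed.

Lemma integral_sum4_le (D : set mR) (f1 f2 f3 f4 : R -> \bar R) (B : \bar R) : measurable D ->
  (forall x, 0 <= f1 x) -> (forall x, 0 <= f2 x) -> (forall x, 0 <= f3 x) -> (forall x, 0 <= f4 x) ->
  measurable_fun D f1 -> measurable_fun D f2 -> measurable_fun D f3 -> measurable_fun D f4 ->
  \int[leb R]_(x in D) f1 x <= B -> \int[leb R]_(x in D) f2 x <= B ->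
  \int[leb R]_(x in D) f3 x <= B -> \int[leb R]_(x in D) f4 x <= B ->
  \int[leb R]_(x in D) ((f1 x + f2 x) + (f3 x + f4 x)) <= (B + B) + (B + B).
Proof.
move=> mD p1 p2 p3 p4 m1 m2 m3 m4 i1 i2 i3 i4.
rewrite ge0_integralD => //.
- rewrite (ge0_integralD (leb R) mD (fun x _ => p1 x) m1 (fun x _ => p2 x) m2).
  rewrite (ge0_integralD (leb R) mD (fun x _ => p3 x) m3 (fun x _ => p4 x) m4).
  by apply: leeD; exact: leeD.
- by move=> x _; exact: adde_ge0.
- exact: emeasurable_funD.
- by move=> x _; exact: adde_ge0.
- exact: emeasurable_funD.
Qed.

(* Cauchy's formula for F^2, averaged over the squares of half-side between 1 and 2. *)
Lemma mean_value F x y : holo F -> (msq F (x, y))%:E <= 2%:E * box (msq F) x y 2 2.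
Proof.
move=> Fh; set g := msq F; set B := box g x y 2 2.
have g0 : forall p, (0 <= g p)%R by exact: msq_ge0.
have mg := measurable_msq Fh.
have mg' := measurable_swapg mg.
have g'0 : forall p, (0 <= swapg g p)%R by move=> p; exact: g0.
pose w : R[i] := x +i* y.
pose G z := (F z ^+ 2 / (z - w))%R.
pose hs := hside g (x - 2) (x + 2); pose vs := hside (swapg g) (y - 2) (y + 2).
have mhs : measurable_fun (T := mR) setT hs by exact: measurable_hside.
have mvs : measurable_fun (T := mR) setT vs by exact: measurable_hside.
have hs0 v : 0 <= hs v by exact: hside_ge0.
have vs0 v : 0 <= vs v by exact: hside_ge0.
(* [r >= 1] gives [normc (G z) <= normc (F z) ^ 2] on the frame. The contour integral is at least
   [4 g] by Cauchy's formula and at most twice the sum of the side integrals. *)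
have key r : (1 <= r <= 2)%R -> (2 * g (x, y))%:E <= (hs (y - r)%R + vs (x + r)%R) + (hs (y + r)%R + vs (x - r)%R).
  move=> /andP[r1 r2].
  have hw : inside (x - r) (x + r) (y - r) (y + r) w.
    by rewrite /w; split; apply/andP; split => /=; lra.
  have F2 : holo (fun z => F z ^+ 2)%R by exact: holoX.
  have fr : frame G (x - r) (x + r) (y - r) (y + r).
    apply: frameM; first exact: holo_frame.
    by have := frame_inv_sub 1 hw.
  have rz z : on_frame (x - r) (x + r) (y - r) (y + r) z -> (r <= normc (z - w))%R.
    by apply: on_frame_dist.
  have Gle z : on_frame (x - r) (x + r) (y - r) (y + r) z -> (normc (G z) <= normc (F z) ^+ 2)%R.
    move=> /rz h; rewrite /G normcM normcX normcV ler_piMr ?exprn_ge0 ?normc_ge0//.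
    by rewrite invf_le1; lra.
  have C1 := normc_contour_sides r1 fr.
  have C2 : (4 * g (x, y) <= normc (contour G (x - r) (x + r) (y - r) (y + r)))%R.
    have := cauchy_formula hw (holo_cder_on F2).
    rewrite /Cint; under [X in contour X]eq_fun do rewrite expr1.
    rewrite -/G => ->; rewrite normcM normcX -/(msq F (x, y)) mulrC ler_wpM2l//.
    exact: Cint1_neq0.
  have hle (a b a' b' : R) (k g1 : R * R -> R) v : measurable_fun (setT : set (mR * mR)) (g1 : _ -> mR) ->
      (forall p, 0 <= g1 p)%R -> (forall p, 0 <= k p)%R ->
      (a' <= a)%R -> (b <= b')%R -> (forall u, a <= u <= b -> k (u, v) <= g1 (u, v))%R ->
      measurable_fun (`[a, b]%classic : set mR) (fun u => (k (u, v))%:E) ->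
      hside k a b v <= hside g1 a' b' v.
    move=> mg1 g10 k0 aa bb kg mk; apply: (@le_trans _ _ (hside g1 a b v)).
      apply: ge0_le_integral => //.
      - by move=> u _; rewrite lee_fin.
      - by apply: measurable_funTS; exact: measurable_row.
    apply: ge0_subset_integral => //.
    - by apply: measurable_funTS; exact: measurable_row.
    - by move=> u _; rewrite lee_fin.
    - by move=> u; rewrite /= !in_itv /=; lra.
  rewrite -(@lee_pmul2l _ 2%:E)// -EFinM mulrA -natrM /=.
  apply: (le_trans _ (le_trans C1 _)); first by rewrite lee_fin.
  rewrite lee_pmul2l//.
  have mn (f : R -> R[i]) a b : ccont f a b ->
      measurable_fun (`[a, b]%classic : set mR) (fun u => (normc (f u))%:E).
    move=> fc; apply/measurable_EFinP.
    have -> : (fun t => normc (f t)) = (fun t => Num.sqrt (complex.Re (f t) ^+ 2 + complex.Im (f t) ^+ 2))%R.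
      by apply/funext => t; case: (f t).
    apply: (@measurableT_comp _ _ _ _ _ _ (@Num.sqrt R)).
      exact: (continuous_measurable_fun (@sqrt_continuous R)).
    by apply: measurable_funD; apply: measurable_funX; apply/measurable_EFinP;
      apply: measurable_int; apply: cont_integrable; [exact: ccont_Re|exact: ccont_Im].
  have [f1 f2 f3 f4] := fr.
  apply: leeD; apply: leeD; apply: hle => //; try lra; try (by move=> p; exact: normc_ge0).
  - by move=> u hu; apply: Gle; left; split => //; left.
  - exact: mn.
  - by move=> u hu; apply: Gle; right; split => //; right.
  - exact: mn.
  - by move=> u hu; apply: Gle; left; split => //; right.
  - exact: mn.
  - by move=> u hu; apply: Gle; right; split => //; left.
  - exact: mn.
have mc (f : R -> \bar R) (phi : R -> R) : leb_preserving phi -> measurable_fun (T := mR) setT f ->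
    measurable_fun (`[1%R, 2%R]%classic : set mR) (fun r => f (phi r)).
  by move=> [mphi _] mf; apply: measurable_funTS; exact: (measurableT_comp mf mphi).
have I1 : \int[leb R]_(r in `[1%R, 2%R]) hs (y - r)%R <= B.
  apply: (integral_affine_le (phi := fun r => y - r)%R) => //; first exact: leb_preserving_reflect.
  by move=> r /=; rewrite !in_itv /=; lra.
have I2 : \int[leb R]_(r in `[1%R, 2%R]) hs (y + r)%R <= B.
  have -> : (fun r => hs (y + r)%R) = (fun r => hs (r + y)%R) by apply/funext => r; rewrite addrC.
  apply: (integral_affine_le (phi := fun r => r + y)%R) => //; first exact: leb_preserving_shift.
  by move=> r /=; rewrite !in_itv /=; lra.
have I3 : \int[leb R]_(r in `[1%R, 2%R]) vs (x - r)%R <= B.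
  rewrite /B -(box_swap x y 2 2 mg g0).
  apply: (integral_affine_le (phi := fun r => x - r)%R) => //; first exact: leb_preserving_reflect.
  by move=> r /=; rewrite !in_itv /=; lra.
have I4 : \int[leb R]_(r in `[1%R, 2%R]) vs (x + r)%R <= B.
  rewrite /B -(box_swap x y 2 2 mg g0).
  have -> : (fun r => vs (x + r)%R) = (fun r => vs (r + x)%R) by apply/funext => r; rewrite addrC.
  apply: (integral_affine_le (phi := fun r => r + x)%R) => //; first exact: leb_preserving_shift.
  by move=> r /=; rewrite !in_itv /=; lra.
(* The interval [[1, 2]] has length 1, and while [r] runs through it each side sweeps out a part of
   the box of half-side 2. *)
have S : (2 * g (x, y))%:E <= (B + B) + (B + B).
  have -> : (2 * g (x, y))%:E = \int[leb R]_(r in `[1%R, 2%R]) (2 * g (x, y))%:E.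
    rewrite integral_cst//= lebesgue_measure_itv /= lte_fin ltr1n -EFinB.
    by rewrite (_ : (2 - 1 = 1 :> R)%R) ?mule1//; ring.
  apply: (@le_trans _ _ (\int[leb R]_(r in `[1%R, 2%R]) ((hs (y - r)%R + vs (x + r)%R) + (hs (y + r)%R + vs (x - r)%R)))).
    apply: ge0_le_integral => //.
    - by move=> r _; rewrite lee_fin mulr_ge0.
    - apply: emeasurable_funD; apply: emeasurable_funD; apply: mc => //.
      + exact: leb_preserving_reflect.
      + exact: leb_preserving_shiftl.
      + exact: leb_preserving_shiftl.
      + exact: leb_preserving_reflect.
  have mm1 : measurable_fun (`[1%R, 2%R]%classic : set mR) (fun r => hs (y - r)%R).
    by apply: (mc _ (fun r => y - r)%R) => //; exact: leb_preserving_reflect.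
  have mm2 : measurable_fun (`[1%R, 2%R]%classic : set mR) (fun r => hs (y + r)%R).
    by apply: (mc _ (fun r => y + r)%R) => //; exact: leb_preserving_shiftl.
  have mm3 : measurable_fun (`[1%R, 2%R]%classic : set mR) (fun r => vs (x - r)%R).
    by apply: (mc _ (fun r => x - r)%R) => //; exact: leb_preserving_reflect.
  have mm4 : measurable_fun (`[1%R, 2%R]%classic : set mR) (fun r => vs (x + r)%R).
    by apply: (mc _ (fun r => x + r)%R) => //; exact: leb_preserving_shiftl.
  exact: integral_sum4_le.
have B0 : 0 <= B.
  by apply: integral_ge0 => v _; apply: integral_ge0 => u _; rewrite lee_fin.
rewrite -(@lee_pmul2l _ 2%:E)// -EFinM (le_trans S)// muleA -EFinM.
rewrite (_ : (2 * 2 = (1 + 1) + (1 + 1) :> R)%R); last by ring.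
by rewrite !EFinD !ge0_muleDl ?adde_ge0// !mul1e.
Qed.

Lemma box_ge0 (g : R * R -> R) x y a b : (forall p, 0 <= g p)%R -> 0 <= box g x y a b.
Proof. by move=> g0; apply: integral_ge0 => v _; apply: integral_ge0 => u _; rewrite lee_fin. Qed.

Lemma box_sub (g : R * R -> R) x y a b x' y' a' b' :
  measurable_fun (setT : set (mR * mR)) (g : _ -> mR) -> (forall p, 0 <= g p)%R ->
  (y' - a' <= y - a)%R -> (y + a <= y' + a')%R -> (x' - b' <= x - b)%R -> (x + b <= x' + b')%R ->
  box g x y a b <= box g x' y' a' b'.
Proof.
move=> mg g0 h1 h2 h3 h4.
have mh a1 b1 := measurable_hside a1 b1 mg g0.
have h0 a1 b1 v := hside_ge0 a1 b1 v g0.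
apply: (@le_trans _ _ (\int[leb R]_(v in `[(y - a)%R, (y + a)%R]) hside g (x' - b') (x' + b') v)).
  apply: ge0_le_integral => //.
  - by move=> v _; exact: (h0 (x - b) (x + b))%R.
  - by apply: measurable_funTS; exact: (mh (x - b) (x + b))%R.
  - by apply: measurable_funTS; exact: mh.
  - move=> v _; apply: ge0_subset_integral => //.
    + by apply: measurable_funTS; exact: measurable_row.
    + by move=> u _; rewrite lee_fin.
    + by move=> u; rewrite /= !in_itv /=; lra.
apply: ge0_subset_integral => //.
- by apply: measurable_funTS; exact: mh.
- by move=> u; rewrite /= !in_itv /=; lra.
Qed.

Lemma point_le_strip F x y : holo F ->
  (msq F (x, y))%:E <= 2%:E * \int[leb R]_(v in `[(y - 2)%R, (y + 2)%R]) slice (msq F) v.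
Proof.
move=> Fh; apply: (le_trans (mean_value x y Fh)); rewrite lee_pmul2l ?lte_fin ?ltr0n//.
by apply: box_le_strip; [exact: measurable_msq|exact: msq_ge0].
Qed.

(** The 8 is the 2 of [mean_value] times the width 4 of the boxes, which [integral_box] produces. *)
Lemma slice_le_strip F y : holo F ->
  slice (msq F) y <= 8%:E * \int[leb R]_(v in `[(y - 2)%R, (y + 2)%R]) slice (msq F) v.
Proof.
move=> Fh; have mg := measurable_msq Fh.
have [mB BE] := @integral_box R (msq F) y 2%R 2%R (ler0n _ 2) mg (@msq_ge0 R F).
apply: (@le_trans _ _ (\int[leb R]_x (2%:E * box (msq F) x y 2 2))).
  apply: ge0_le_integral => //.
  - by move=> x _; rewrite lee_fin msq_ge0.
  - exact: measurable_row.
  - exact: measurable_funeM.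
  - by move=> x _; exact: mean_value.
rewrite ge0_integralZl//; last by move=> x _; apply: box_ge0; exact: msq_ge0.
by rewrite BE muleA -EFinM (_ : (2 * (2 * 2) = 8 :> R)%R)//; ring.
Qed.

(** Cauchy's estimate on the unit disc around [x + s + iy]: the boxes of half-side 2 around its
    points all lie in one box of half-height 3 and half-width 4. The shift [s] makes the bound serve
    a whole segment, hence all difference quotients at once. *)
Lemma derivative_le_box : exists2 K : R, (0 < K)%R & forall F x y s, holo F -> (`|s| <= 1)%R ->
  (msq (dc F) ((x + s)%R, y))%:E <= K%:E * box (msq F) x y 3 4.
Proof.
pose c : R := 40%R; have c0 : (0 < c)%R by rewrite ltr0n.
have K0 : (0 < c ^+ 2 * 2)%R by rewrite mulr_gt0 ?exprn_gt0.
exists (c ^+ 2 * 2)%R => // F x y s Fh s1; have mg := measurable_msq Fh.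
have B0 := box_ge0 x y 3 4 (@msq_ge0 R F).
case BE : (box (msq F) x y 3 4) => [b| |]; last 2 first.
- by rewrite gt0_muley ?lte_fin ?leey.
- by rewrite BE in B0.
rewrite BE lee_fin in B0; rewrite -EFinM lee_fin.
have est z : (normc (z - ((x + s)%R +i* y))%R <= 2 * (1 / 2))%R -> (normc (F z) <= Num.sqrt (2 * b))%R.
  rewrite (_ : (2 * (1 / 2) = 1 :> R)%R); last by field.
  case: z => u v hz.
  have := normc_Re ((u +i* v) - ((x + s)%R +i* y))%R.
  have := normc_Im ((u +i* v) - ((x + s)%R +i* y))%R.
  move=> /= h1 h2; have {}h1 := le_trans h1 hz; have {}h2 := le_trans h2 hz.
  have q1 := mean_value u v Fh.
  have q2 : box (msq F) u v 2 2 <= b%:E.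
    rewrite -BE; apply: box_sub => //; first exact: msq_ge0.
    - by move: h1; rewrite ler_norml; lra.
    - by move: h1; rewrite ler_norml; lra.
    - by move: h2 s1; rewrite !ler_norml; lra.
    - by move: h2 s1; rewrite !ler_norml; lra.
  have q3 : 2%:E * box (msq F) u v 2 2 <= 2%:E * b%:E by rewrite lee_pmul2l.
  have := le_trans q1 q3; rewrite -EFinM lee_fin.
  by rewrite /msq /= => /ler_wsqrtr; rewrite sqrtr_sqr ger0_norm// normc_ge0.
have h12 : (0 < 1 / 2 :> R)%R by rewrite divr_gt0.
have := cauchy_estimate Fh h12 est.
rewrite (_ : (20 * Num.sqrt (2 * b) / (1 / 2) = c * Num.sqrt (2 * b))%R); last by rewrite /c; field.
move=> H; rewrite /msq /=.
rewrite (@le_trans _ _ ((c * Num.sqrt (2 * b)) ^+ 2)%R)//.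
  by rewrite lerXn2r ?nnegrE ?normc_ge0// mulr_ge0 ?sqrtr_ge0// ltW.
by rewrite exprMn sqr_sqrtr ?mulr_ge0// mulrA.
Qed.

End mean_value.

(** * Sets measurable for the completed measure, up to null sets *)

Section caratheodory_approximation.
Context {R : realType} d (T : measurableType d) (mu : {measure set T -> \bar R}).
Local Open Scope ereal_scope.

(** Intersect measurable covers whose measures exceed the outer measure by at most [1 / n.+1]. *)
Lemma measurable_hull (A : set T) : (mu^*)%mu A < +oo ->
  exists B, [/\ measurable B, A `<=` B & mu B = (mu^*)%mu A].
Proof.
move=> Afin.
have coverE s : (0 < s)%R -> exists B, [/\ measurable B, A `<=` B & mu B <= (mu^*)%mu A + s%:E].
  move=> s0; have : (mu^*)%mu A \is a fin_num by rewrite ge0_fin_numE// mu_ext_ge0//.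
  move/lb_ereal_inf_adherent => /(_ _ s0)[_/= [F [mF AF] <-] FE].
  exists (\bigcup_k F k); split=> //; first exact: bigcupT_measurable.
  apply: le_trans (ltW FE).
  by apply: measure_sigma_subadditive => //; exact: bigcupT_measurable.
have inv0 n : (0 < n.+1%:R^-1 :> R)%R by rewrite invr_gt0.
have [B hB] := choice (fun n => coverE _ (inv0 n)).
have mB n : measurable (B n) by have [] := hB n.
have mBB : measurable (\bigcap_n B n) by exact: bigcapT_measurable.
exists (\bigcap_n B n); split=> //.
  by move=> x Ax n _; have [_ + _] := hB n; exact.
apply/eqP; rewrite eq_le; apply/andP; split; last first.
  rewrite -(measurable_mu_extE mu mBB); apply: le_mu_ext.
  by move=> x Ax n _; have [_ + _] := hB n; exact.
apply/lee_addgt0Pr => /= _/posnumP[e]; near \oo => n.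
apply: (@le_trans _ _ (mu (B n))); first by apply: le_measure; rewrite ?inE//; exact: bigcap_inf.
have [_ _ h] := hB n; apply: (le_trans h); rewrite leeD// lee_fin ltW//.
by near: n; apply: near_infty_natSinv_lt.
Unshelve. all: by end_near. Qed.

(** Two hulls: [B] of [A], then a null hull [N] of the difference of [B] and [A]; removing [N] from
    [B] leaves a measurable subset of [A]. *)
Lemma caratheodory_approx_fin (A : set T) : (mu^*)%mu.-cara.-measurable A -> (mu^*)%mu A < +oo ->
  exists S N, [/\ measurable S, measurable N, mu N = 0, S `<=` A & A `\` S `<=` N].
Proof.
move=> cA Afin.
have [B [mB AB muB]] := measurable_hull Afin.
have cB : (mu^*)%mu.-cara.-measurable B by exact: caratheodory_measurable_mu_ext.
pose m : {measure set caratheodory_type (mu^*)%mu -> \bar R} := @completed_measure_extension _ _ _ mu.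
have mBA : m (B `\` A) = 0.
  rewrite measureD//=; last by rewrite /completed_measure_extension measurable_mu_extE// muB.
  rewrite setIidr// /completed_measure_extension measurable_mu_extE// muB subee//.
  by rewrite ge0_fin_numE// mu_ext_ge0.
have [N [mN BAN muN]] : exists N, [/\ measurable N, B `\` A `<=` N & mu N = 0].
  have [|N [mN ? e]] := @measurable_hull (B `\` A); first by rewrite -[X in X < _]/(m _) mBA.
  by exists N; split=> //; rewrite e -[LHS]/(m _).
exists (B `\` N), N; split=> //; first exact: measurableD.
  by move=> x [Bx Nx]; apply: contrapT => Ax; apply: Nx; exact: BAN.
move=> x [Ax nBN]; apply: contrapT => Nx; apply: nBN; split=> //; exact: AB.
Qed.

Lemma caratheodory_approx (A : set T) : sigma_finite setT mu -> (mu^*)%mu.-cara.-measurable A ->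
  exists S N, [/\ measurable S, measurable N, mu N = 0, S `<=` A & A `\` S `<=` N].
Proof.
move=> [F FT hF] cA.
have /choice[S hS] : forall k, exists S, exists N, [/\ measurable S, measurable N, mu N = 0, S `<=` A &
    (A `&` F k) `\` S `<=` N].
  move=> k; have [mFk Fk] := hF k.
  have [||S [N [mS mN N0 SA AN]]] := @caratheodory_approx_fin (A `&` F k).
  - by apply: measurableI => //; exact: caratheodory_measurable_mu_ext.
  - rewrite (le_lt_trans _ Fk)// -(measurable_mu_extE mu mFk); apply: le_mu_ext; exact: subIsetr.
  - by exists S, N; split=> // x /SA[].
have [N hN] := choice hS.
exists (\bigcup_k S k), (\bigcup_k N k); split.
- by apply: bigcupT_measurable => k; have [] := hN k.
- by apply: bigcupT_measurable => k; have [] := hN k.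
- apply/negligibleP; first by apply: bigcupT_measurable => k; have [] := hN k.
  by apply: negligible_bigcup => k; have [_ ? ? _ _] := hN k; exact/negligibleP.
- by move=> x [k _]; have [_ _ _ + _] := hN k; exact.
- move=> x [Ax nS]; have : setT x by [].
  rewrite FT => -[k _ Fx]; exists k => //; have [_ _ _ _] := hN k; apply.
  by split=> // Sx; apply: nS; exists k.
Qed.

(** The identity is measurable from the completed space to the original one, and it pushes the
    completed measure forward to [mu]. *)
Lemma integral_completion (g : T -> \bar R) : measurable_fun setT g -> (forall p, 0 <= g p) ->
  \int[@completed_measure_extension _ _ _ mu]_p g p = \int[mu]_p g p.
Proof.
move=> mg g0.
pose phi : caratheodory_type (mu^*)%mu -> T := id.
have mphi : measurable_fun setT phi.
  by move=> _ B mB; rewrite setTI; exact: caratheodory_measurable_mu_ext.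
transitivity (\int[pushforward (@completed_measure_extension _ _ _ mu) phi]_p g p).
  by rewrite (ge0_integral_pushforward mphi)//.
apply: eq_measure_integral => A mA _.
by rewrite -[RHS](measurable_mu_extE mu mA).
Qed.

Lemma negligible_bigcup_countable (C : countType) (N : C -> set T) : (forall q, mu.-negligible (N q)) ->
  mu.-negligible (\bigcup_q N q).
Proof.
move=> hN; pose F k := if unpickle k is Some q then N q else set0.
apply: (@negligibleS _ _ _ _ (\bigcup_k F k)).
  by move=> p [q _ h]; exists (pickle q) => //; rewrite /F pickleK.
by apply: negligible_bigcup => k; rewrite /F; case: unpickle => [q|]; [exact: hN|exact: negligible_set0].
Qed.

End caratheodory_approximation.

(** * Reduction of the Fock norm to an integral over horizontal lines *)

Section fock_reduction.
Context {R : realType}.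
Notation mR := (measurableTypeR R).
Local Open Scope ereal_scope.

(** The N(F) of the overview, with [v] in the role of the squared weight. *)
Definition fock2 (v : R -> R) F : \bar R := \int[leb R]_y ((v y)%:E * slice (msq F) y).

Lemma fock2_product (v : R -> R) F : measurable_fun (T := mR) (U := mR) setT v -> (forall y, 0 <= v y)%R ->
  holo F -> measurable_fun (setT : set (mR * mR)) (fun p => (msq F p * v p.2)%R%:E) /\
  \int[borel_area R]_p ((msq F p * v p.2)%R%:E) = fock2 v F.
Proof.
move=> mv v0 hF.
pose g (p : mR * mR) : \bar R := (msq F p * v p.2)%R%:E.
have mg : measurable_fun setT g.
  apply: measurable_fin; apply: measurable_funM; first exact: measurable_msq.
  exact: (measurableT_comp mv measurable_snd).
have g0 p : 0 <= g p by rewrite lee_fin mulr_ge0// msq_ge0.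
split=> //; have [_ -> _] := tonelli (leb R) (leb R) mg g0.
apply: eq_integral => y _.
rewrite /slice -(ge0_integralZl _ _ (measurable_row y (measurable_msq hF)))//.
- by apply: eq_integral => x _; rewrite /g /= -EFinM mulrC.
- by move=> x _; rewrite lee_fin msq_ge0.
- by rewrite lee_fin.
Qed.

Lemma area_integral (v : R -> R) F : measurable_fun (T := mR) (U := mR) setT v -> (forall y, 0 <= v y)%R ->
  holo F -> \int[area R]_p ((msq F p * v p.2)%R%:E) = fock2 v F.
Proof.
move=> mv v0 hF; have [mg <-] := fock2_product mv v0 hF.
by apply: (@integral_completion _ _ _ (borel_area R) _ mg) => p; rewrite lee_fin mulr_ge0// msq_ge0.
Qed.

(** By Tonelli almost every vertical section of a null set is null, and the real line has positive
    measure, so at least one abscissa is good. *)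
Lemma null_section (N : set (mR * mR)) : measurable N -> borel_area R N = 0 ->
  exists x, leb R (xsection N x) = 0.
Proof.
move=> mN N0; apply: contrapT => h.
have pos x : 0 < leb R (xsection N x).
  by rewrite lt_neqAle measure_ge0 andbT eq_sym; apply/eqP => e; apply: h; exists x.
have mf : measurable_fun (T := mR) setT (fun x => leb R (xsection N x)).
  exact: measurable_fun_xsection.
have [A [mA A0 TA]] : ae_eq (leb R) setT (fun x => leb R (xsection N x)) (cst 0).
  apply/ae_eq_integral_abs => //.
  rewrite -[RHS]N0; apply: eq_integral => x _; rewrite gee0_abs//.
have AT : A = setT.
  apply/seteqP; split=> // x _; apply: TA => /= /(_ Logic.I) e.
  by have := pos x; rewrite e ltxx.
have : leb R `[0%R, 1%R]%classic <= leb R A by rewrite AT; apply: le_measure; rewrite ?inE.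
by rewrite A0 lebesgue_measure_itv /= lte_fin ltr01 oppr0 adde0 lee_fin ler10.
Qed.

Lemma sigma_finite_borel_area : sigma_finite setT (borel_area R).
Proof.
exists (fun n => `[- n%:R, n%:R]%classic `*` `[- n%:R, n%:R]%classic)%R.
  apply/seteqP; split=> // -[x y] _.
  exists (Num.bound (Num.max `|x| `|y|))%R => //=.
  have := archi_boundP (x := Num.max `|x| `|y|)%R.
  rewrite le_max normr_ge0 => /(_ isT)/ltW; rewrite ge_max !ler_norml => /andP[? ?].
  by split; rewrite /= in_itv.
move=> n; split; first by apply: measurableX; exact: measurable_itv.
have e : leb R `[- n%:R, n%:R]%classic%R = ((n%:R - - n%:R)%R%:E : \bar R).
  rewrite lebesgue_measure_itv /= lte_fin; case: ifPn => // h.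
  by congr _%:E; have := ler0n R n; lra.
have mI : measurable (`[- n%:R, n%:R]%classic%R : set mR) by exact: measurable_itv.
have -> : borel_area R (`[- n%:R, n%:R]%classic `*` `[- n%:R, n%:R]%classic)%R = ((n%:R - - n%:R) * (n%:R - - n%:R))%R%:E.
  rewrite EFinM -e; exact: (product_measure1E (leb R) (leb R) mI mI).
exact: ltry.
Qed.

Lemma measurable_prop (b : bool) : measurable ([set _ | b] : set mR).
Proof.
case: b; first by rewrite (_ : [set _ | _] = setT)//; apply/seteqP.
by rewrite (_ : [set _ | _] = set0)//; apply/seteqP; split.
Qed.

(* [w] need not be Borel, but [w p.2] is Borel off a null set of the plane, which almost every
   vertical line meets in a null set of ordinates. *)
Lemma section_representative (w : R -> R) :
  measurable_fun [set: plane R] (fun p : plane R => w p.2) ->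
  exists v, measurable_fun (T := mR) (U := mR) setT v /\
  exists M : set mR, [/\ measurable M, leb R M = 0, forall y, ~ M y -> v y = w y & forall y, M y -> v y = 1%R].
Proof.
move=> mw.
have hq (q : rat) : exists SN : set (mR * mR) * set (mR * mR),
    [/\ measurable SN.1, measurable SN.2, borel_area R SN.2 = 0, SN.1 `<=` [set p | (ratr q < w p.2)%R] &
     [set p | (ratr q < w p.2)%R] `\` SN.1 `<=` SN.2].
  have [|S [N [mS mN N0 SA AN]]] := @caratheodory_approx _ _ _ (borel_area R) [set p | (ratr q < w p.2)%R] sigma_finite_borel_area; last by exists (S, N).
  have := mw measurableT _ (measurable_itv (Interval (BRight (ratr q : R)) +oo%O)).
  rewrite setTI; congr (measurable _); apply/seteqP; split=> p /=; by rewrite in_itv /= andbT.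
have [SN hSN] := choice hq.
pose N := \bigcup_(q : rat) (SN q).2.
have mN : measurable N by apply: bigcupT_measurable_rat => q; have [] := hSN q.
have N0 : borel_area R N = 0.
  apply/negligibleP => //.
  by apply: negligible_bigcup_countable => q; have [_ ? ? _ _] := hSN q; exact/negligibleP.
have [x0 M0] := null_section mN N0.
pose M := xsection N x0.
have mM : measurable M by exact: measurable_xsection.
pose v y := if y \in M then 1%R else w y.
exists v; split; last first.
  by exists M; split=> // y My; rewrite /v ?(mem_set My)// memNset.
(* Off [M] the superlevel set of [w] at [q] coincides with the section of the Borel set chosen for
   [q]. *)
have mwq (q : rat) : measurable (([set y | (ratr q < w y)%R] `\` M) : set mR).
  rewrite (_ : _ `\` _ = xsection (SN q).1 x0 `\` M).
    by apply: measurableD => //; apply: measurable_xsection; have [] := hSN q.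
  have [_ _ _ h1 h2] := hSN q.
  apply/seteqP; split=> y [h My]; split=> //.
    apply/xsectionP; apply: contrapT => h'; apply: My; apply/xsectionP; exists q => //.
    by apply: h2; split.
  by move/xsectionP: h => /h1.
move=> mD; apply: (measurability _ (RGenOInfty.measurableE R)) => // _ [_ [r ->] <-].
rewrite setTI.
rewrite (_ : _ @^-1` _ = (M `&` [set _ | (r < 1)%R]) `|` \bigcup_(q : rat) ([set y | (ratr q < w y)%R /\ (r < ratr q)%R] `\` M)).
  apply: measurableU; first by apply: measurableI => //; exact: measurable_prop.
  apply: bigcupT_measurable_rat => q; case: (ltrP r (ratr q)) => rq.
    rewrite (_ : _ `\` _ = [set y | (ratr q < w y)%R] `\` M)//.
    by apply/seteqP; split=> y [/=]; [case|].
  rewrite (_ : _ `\` _ = set0)//; apply/seteqP; split; last by [].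
  by move=> y [[]].
apply/seteqP; split=> y /=; rewrite in_itv /= andbT /v.
  case: ifPn => [|/negP] yM; first by rewrite inE in yM; left.
  move=> rw; right; have [q] := rat_in_itvoo rw.
  rewrite in_itv /= => /andP[rq qw]; exists q => //; split=> // My; apply: yM; exact: mem_set.
by case=> [[/mem_set ->]//|[q _ [[qw rq] My]]]; rewrite memNset//; exact: lt_trans qw.
Qed.

Lemma weight_lower_bound (W : R[i] -> R) (Y : R) : weight W ->
  exists2 c : R, (0 < c)%R & forall y, (`|y| <= Y)%R -> (c <= W (Complex 0%R y))%R.
Proof.
move=> [W0 _ hK].
pose i (y : R) : R[i]^o := (Complex 0%R y).
have ic : continuous i.
  move=> y; apply/cvgrPdist_lt => e /= e0.
  have eE : e = (complex.Re e)%:C%C by move: e0; case: (e) => a b; rewrite ltcE /= => /andP[/eqP -> _].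
  move: e0; rewrite {}eE; set k := complex.Re e; rewrite ltc_real => k0.
  near=> t; suff : ((normc (i y - i t : R[i]))%:C < k%:C)%C%R by rewrite -normcE.
  have -> : (i y - i t = Complex 0 (y - t) :> R[i])%R.
    by apply/eqP; rewrite eq_complex /= subrr !eqxx.
  rewrite ltc_real.
  rewrite /= expr0n add0r sqrtr_sqr.
  by near: t; apply: cvgr_dist_lt.
have cK : compact (i @` `[- Y, Y]%classic)%R.
  apply: continuous_compact; last exact: segment_compact.
  by apply: continuous_subspaceT => y; exact: ic.
have := hK _ cK; set m := ereal_inf _ => m0.
have hm y : (`|y| <= Y)%R -> m <= (W (Complex 0%R y))%:E.
  move=> yY; apply: ereal_inf_lbound; exists (i y) => //; exists y => //=.
  by rewrite in_itv /= -ler_norml.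
case: (m) m0 hm => [c| |] //=.
  by move=> c0 h; exists c => // y /h; rewrite lee_fin.
(* An infinite infimum leaves no [y] with [|y| <= Y], so any positive constant serves. *)
by move=> _ h; exists 1%R => // y /h; rewrite leye_eq.
Unshelve. all: by end_near. Qed.

(** The Borel representative changes the weight only on horizontal lines whose ordinates form a null
    set, and these do not affect the area integral. *)
Lemma fock_norm_reduce (W : R[i] -> R) : weight W ->
  (forall z w : R[i], complex.Im z = complex.Im w -> W z = W w) ->
  exists v : R -> R, [/\ measurable_fun (T := mR) (U := mR) setT v, forall y, (0 < v y)%R,
    forall Y, exists2 c : R, (0 < c)%R & forall y, (`|y| <= Y)%R -> (c <= v y)%R &
    forall F, holo F -> fock_norm W F = sqrte (fock2 v F)].
Proof.
move=> Ww WIm; have [W0 mW _] := Ww.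
pose w (y : R) := W (Complex 0%R y).
have WE p : (W \o @to_complex R) p = w p.2 by exact: WIm.
have mw : measurable_fun [set: plane R] (fun p : plane R => w p.2).
  by apply: eq_measurable_fun mW => p _; exact: WE.
have [u [mu [M [mM M0 uw u1]]]] := section_representative mw.
have u0 y : (0 < u y)%R by case: (pselect (M y)) => [/u1 ->//|/uw ->]; exact: W0.
exists (fun y => u y ^+ 2)%R; split.
- exact: measurable_funX.
- by move=> y; rewrite exprn_gt0.
- move=> Y; have [c c0 hc] := weight_lower_bound Y Ww.
  (* On the exceptional set the representative has the value 1, hence the minimum. *)
  exists (Num.min 1 c ^+ 2)%R; first by rewrite exprn_gt0// lt_min ltr01.
  move=> y yY; rewrite lerXn2r ?nnegrE ?(ltW (u0 y))//; first by rewrite le_min ler01 (ltW c0).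
  by rewrite ge_min; case: (pselect (M y)) => [/u1 ->|/uw ->]; rewrite ?lexx// [(c <= _)%R]hc ?orbT.
move=> F hF; rewrite /fock_norm -area_integral//; last 2 first.
- exact: measurable_funX.
- by move=> y; rewrite exprn_ge0// ltW.
congr sqrte.
have cm (f : plane R -> mR) : measurable_fun (setT : set (mR * mR)) (f : mR * mR -> mR) -> measurable_fun setT f.
  move=> mf _ B mB; apply: caratheodory_measurable_mu_ext; exact: mf.
have mF : measurable_fun [set: plane R] (msq F : plane R -> mR) by apply: cm; exact: measurable_msq.
apply: (@ge0_ae_eq_integral _ _ _ (area R) setT); first exact: measurableT.
- apply/measurable_EFinP; rewrite (_ : (fun _ => _) = (fun p : plane R => msq F p * (w p.2) ^+ 2)%R).
    exact: (measurable_funM mF (measurable_funX 2 mw)).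
  by apply/funext => p; rewrite exprMn /msq -WE.
- apply/measurable_EFinP; apply: (measurable_funM mF (cm _ _)).
  exact: (measurableT_comp (measurable_funX 2 mu) measurable_snd).
- by move=> p _; rewrite lee_fin exprn_ge0// mulr_ge0 ?normc_ge0// ltW.
- by move=> p _; rewrite lee_fin mulr_ge0 ?msq_ge0// exprn_ge0// ltW.
have mTM : measurable (setT `*` M : set (mR * mR)) by exact: measurableX.
exists (setT `*` M); split.
- exact: caratheodory_measurable_mu_ext.
- rewrite [LHS](measurable_mu_extE (borel_area R) mTM).
  rewrite [LHS](product_measure1E (leb R) (leb R) measurableT mM).
  by rewrite [X in _ * X]M0 mule0.
move=> p /= h; split=> //; apply: contrapT => Mp; apply: h => _.
rewrite exprMn uw// -WE //.
Qed.

End fock_reduction.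

(** * The Plancherel-Polya inequality *)

Section plancherel_polya.
Context {R : realType}.
Notation mR := (measurableTypeR R).
Implicit Types F : R[i] -> R[i].

(** Lower semicontinuity in the limit is all that Fatou's lemma needs; stated through real
    [c < g x], it spares convergence in the extended reals. *)
Lemma fatou_le d (T : measurableType d) (mu : {measure set T -> \bar R})
    (f : nat -> T -> \bar R) (g : T -> \bar R) (B : \bar R) :
  (forall n, measurable_fun setT (f n)) -> measurable_fun setT g ->
  (forall n x, (0 <= f n x)%E) -> (forall x, (0 <= g x)%E) ->
  (forall x (c : R), (c%:E < g x)%E -> exists N, forall n, (N <= n)%N -> (c%:E <= f n x)%E) ->
  (forall n, (\int[mu]_x f n x <= B)%E) -> (\int[mu]_x g x <= B)%E.
Proof.
move=> mf mg f0 g0 fg fB.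
have einfE (u : nat -> \bar R) : limn_einf u = ereal_sup (range (einfs u)).
  by rewrite limn_einf_lim; apply/cvg_lim => //; exact: cvg_einfs_sup.
have gle x : (g x <= limn_einf (f ^~ x))%E.
  rewrite einfE leNgt; apply/negP; set S := ereal_sup _ => Sg.
  have S0 : (0 <= S)%E.
    apply: (@le_trans _ _ (einfs (f ^~ x) 0)); last by apply: ereal_sup_ubound; exists 0%N.
    by apply: le_ereal_inf_tmp => _ [k _ <-].
  have [c Sc cg] : exists2 c : R, (S < c%:E)%E & (c%:E < g x)%E.
    case: (S) S0 Sg => [s| |] // s0; case: (g x) => [r| |] //; last first.
      by move=> _; exists (s + 1); rewrite ?ltry// lte_fin ltrDl.
    by rewrite lte_fin => sr; exists ((s + r) / 2); rewrite lte_fin; lra.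
  have [N HN] := fg _ _ cg.
  have : (c%:E <= S)%E.
    apply: (@le_trans _ _ (einfs (f ^~ x) N)); last by apply: ereal_sup_ubound; exists N.
    by apply: le_ereal_inf_tmp => _ [k Nk <-]; exact: HN.
  by rewrite leNgt Sc.
apply: (@le_trans _ _ (\int[mu]_x limn_einf (f ^~ x))%E).
  apply: ge0_le_integral => //.
  rewrite (_ : (fun x => _) = (fun x => - limn_esup (fun n => - f n x)))%E//.
  by apply: measurableT_comp => //; apply: measurable_fun_limn_esup => n; exact: measurableT_comp.
apply: (le_trans (fatou mu measurableT mf (fun n x _ => f0 n x))).
rewrite einfE; apply: ge_ereal_sup => _ [n _ <-].
apply: le_trans (fB n); apply: ereal_inf_lbound; exists n => //=.
Qed.

Lemma integral_le_centered (f : R -> \bar R) (B : \bar R) :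
  measurable_fun (T := mR) setT f -> (forall x, (0 <= f x)%E) ->
  (forall n : nat, (\int[leb R]_(x in `[(- n%:R)%R, n%:R]) f x <= B)%E) -> (\int[leb R]_x f x <= B)%E.
Proof.
move=> mf f0 fB.
apply: (@fatou_le _ mR (leb R) (fun n x => ((ind (- n%:R) n%:R x)%:E * f x)%E)) => //.
- by move=> n; apply: emeasurable_funM => //; exact: measurable_fin (measurable_ind _ _).
- by move=> n x; rewrite mule_ge0// lee_fin ind_ge0.
- move=> x c cf; exists (Num.bound `|x|) => n xn.
  rewrite /ind -ler_norml ifT ?mul1e ?(ltW cf)//.
  have := archi_boundP (normr_ge0 x) => /ltW/le_trans; apply; by rewrite ler_nat.
- by move=> n; rewrite -integral_ind.
Qed.

Lemma mul_conj_normc (z : R[i]) : z * z^* = (normc z ^+ 2)%:C.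
Proof. by rewrite sqr_normcE; case: z => a b; simpc; congr (_ +i* _); rewrite /=; ring. Qed.

Lemma cder_cint (K : R[i] -> R -> R[i]) (K1 : R -> R[i]) a b w (r C : R) :
  a <= b -> 0 < r -> 0 <= C ->
  (forall h, normc h < r -> ccont (K (w + h)) a b) -> ccont K1 a b ->
  (forall t h, a <= t <= b -> normc h < r ->
     normc (K (w + h) t - K w t - h * K1 t) <= C * normc h ^+ 2) ->
  cder (fun w => cint a b (K w)) w (cint a b K1).
Proof.
move=> ab r0 C0 Kf K1f HK e e0.
have Kf0 := Kf 0; rewrite Normc.normc0 addr0 in Kf0; have {}Kf0 := Kf0 r0.
pose s := 2 * (b - a) * C + 1.
have s0 : 0 < s by rewrite ltr_wpDl// !mulr_ge0//; lra.
exists (Num.min r (e / s)); first by rewrite lt_min r0 divr_gt0.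
move=> h; rewrite lt_min => /andP[hr hs].
have Kfh := Kf _ hr.
have hK1 : ccont (fun t => h * K1 t) a b by apply: ccontM => //; exact: ccont_cst.
rewrite -cintB// [cint a b K1 * h]mulrC -cintZ// -cintB//; last exact: ccontB.
apply: (le_trans (normc_cint_le ab (M := C * normc h ^+ 2) _ _)).
- by apply: ccontB => //; exact: ccontB.
- by move=> t ht; exact: HK.
rewrite expr2 !mulrA ler_wpM2r ?normc_ge0//.
rewrite (@le_trans _ _ (s * normc h))// ?ler_wpM2r ?normc_ge0// ?lerDl//.
by rewrite mulrC -ler_pdivlMr// ltW.
Qed.

Lemma holo_bounded F (r : R) : holo F -> exists2 M, 0 <= M & forall z, normc z <= r -> normc (F z) <= M.
Proof.
move=> hF.
have r1 : - (`|r| + 1) <= `|r| + 1 by have := normr_ge0 r; lra.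
have [M M0 HM] := frame_bounded r1 r1 (holo_frame _ _ _ _ hF).
exists M => // z zr; apply: (max_principle hF _ HM).
have := normc_Re z; have := normc_Im z; have := ler_norm r => h1 h2 h3.
have {}h2 : `|complex.Im z| < `|r| + 1 by lra.
have {}h3 : `|complex.Re z| < `|r| + 1 by lra.
by split; rewrite -ltr_norml.
Qed.

Lemma ccont_row F z a b : holo F -> ccont (fun t => F (z + t%:C)) a b.
Proof.
move=> hF; apply: ccont_comp; first by move=> t _; exists (dc F (z + t%:C)); exact: holo_cder.
by apply: (@ccont_ext _ (fun t => z + t%:C * 1)) => [t|]; [rewrite mulr1|exact: ccont_segment].
Qed.

(** Differentiation under the integral sign; the second-order Taylor remainder is uniform because
    the second derivative is bounded on a disc containing every [w + t + h] with [normc h < 1]. *)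
Lemma holo_convolution F (k : R -> R[i]) a b : a <= b -> holo F -> ccont k a b ->
  holo (fun z => cint a b (fun t => F (z + t%:C) * k t)).
Proof.
move=> ab hF kc; apply/holoP => w.
have [N HN] := ccont_bounded ab kc.
have N0 : 0 <= N by apply: (le_trans (normc_ge0 (k a))); apply: HN; rewrite lexx.
pose r := normc w + 1 + (`|a| + `|b|).
have [M M0 HM] := @holo_bounded (iter 2 dc F) r (holo_iter_dc 2 hF).
exists (cint a b (fun t => dc F (w + t%:C) * k t)).
apply: (@cder_cint _ _ a b w 1 (M * N)) => //; first exact: mulr_ge0.
- by move=> h _; apply: ccontM => //; exact: ccont_row.
- by apply: ccontM => //; apply: ccont_row; exact: holo_dc.
move=> t h tab h1.
have -> : F (w + h + t%:C) * k t - F (w + t%:C) * k t - h * (dc F (w + t%:C) * k t) =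
    (F (w + t%:C + h) - taylor 2 F (w + t%:C) h) * k t.
  rewrite /taylor big_ord_recl big_ord1 /= expr0 expr1 fact0 factS fact0 muln1 !divr1 mul1r.
  by rewrite (addrAC w h); ring.
rewrite normcM [_ * N * _]mulrAC ler_pM ?normc_ge0 ?HN//.
apply: taylor_remainder => // u u01; apply: HM.
have tn : normc t%:C <= `|a| + `|b|.
  rewrite normc_real; move: tab => /andP[at_ tb].
  have := ler_norm b; have := ler_norm (- a); rewrite normrN.
  by move=> ? ?; have := normr_ge0 a; have := normr_ge0 b => ? ?; rewrite ler_norml; lra.
have un : normc (u%:C * h) <= 1.
  rewrite normcM normc_real ger0_norm; last by case/andP: u01.
  by rewrite mulr_ile1 ?normc_ge0//; [case/andP: u01|case/andP: u01|exact: ltW].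
rewrite (le_trans (normcD _ _))// (le_trans (lerD (normcD _ _) (lexx _)))// /r; lra.
Qed.

(* [F z] is bounded by [C e^{(a+e)|z|}], so the truncated convolution is again of type [a]. *)
Lemma exp_type_le_convolution F (a : R) (k : R -> R[i]) b c : 0 <= a -> b <= c -> holo F ->
  exp_type_le a F -> ccont k b c ->
  exp_type_le a (fun z => cint b c (fun t => F (z + t%:C) * k t)).
Proof.
move=> a0 bc hF Fa kc e e0; have [C HC] := Fa e e0.
have [N HN] := ccont_bounded bc kc.
have N0 : 0 <= N by apply: (le_trans (normc_ge0 (k b))); apply: HN; rewrite lexx.
pose s := `|b| + `|c|.
exists (2 * (c - b) * (`|C| * expR ((a + e) * s) * N)) => z.
have -> : 2 * (c - b) * (`|C| * expR ((a + e) * s) * N) * expR ((a + e) * normc z) =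
  2 * (c - b) * (`|C| * expR ((a + e) * (normc z + s)) * N).
  by rewrite [(a + e) * (_ + s)]mulrDr expRD; ring.
apply: normc_cint_le => //; first by apply: ccontM => //; exact: ccont_row.
move=> t tbc; rewrite normcM ler_pM ?normc_ge0 ?HN//.
apply: (le_trans (HC _)); apply: (@le_trans _ _ (`|C| * expR ((a + e) * normc (z + t%:C)))).
  by rewrite ler_wpM2r ?expR_ge0// ler_norm.
rewrite ler_wpM2l// ler_expR ler_wpM2l//; first by lra.
rewrite (le_trans (normcD _ _))// lerD2l normc_real.
move: tbc => /andP[bt tc].
have := ler_norm c; have := ler_norm (- b); rewrite normrN.
by move=> ? ?; have := normr_ge0 b; have := normr_ge0 c => ? ?; rewrite /s ler_norml; lra.
Qed.

Lemma integral_msq_segment F y b c : holo F ->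
  exists X : R, 0 <= X /\ (\int[leb R]_(t in `[b, c]) (msq F (t, y))%:E = X%:E)%E /\
    cint b c (fun t => (msq F (t, y))%:C) = X%:C.
Proof.
move=> hF; rewrite cint_real; exists (RI b c (fun t => msq F (t, y))); split; last split=> //.
  by apply: Rintegral_ge0 => t _; exact: msq_ge0.
rewrite /RI /Rintegral fineK//.
have : (leb R).-integrable `[b, c] (EFin \o (fun t => msq F (t, y))).
  apply: cont_integrable => t tbc.
  (* On a horizontal line the squared modulus is the product of [F] and of [sharp F] on the mirrored
     line, hence continuous. *)
  have -> : (fun t => msq F (t, y)) =
      (fun t => complex.Re (F (Complex 0 y + t%:C) * sharp F (Complex 0 (- y) + t%:C))).
    apply/funext => u; rewrite /sharp (_ : (_ + _)^* = Complex 0 y + u%:C); last by rewrite rmorphD /=; simpc.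
    by rewrite mul_conj_normc /msq /= (_ : _ + _ = u +i* y)//; simpc.
  exact: ccont_Re (ccontM (@ccont_row F (Complex 0 y) b c hF) (@ccont_row (sharp F) (Complex 0 (- y)) b c (holo_sharp hF))) t tbc.
by move/integrable_fin_num; exact.
Qed.

Lemma msqE F x y : msq F (x, y) = normc (F (x +i* y)) ^+ 2. Proof. by []. Qed.

Lemma measurable_normc_row (H : R[i] -> R[i]) (f : R -> R[i]) : holo H -> (forall t, f t = H t%:C) ->
  measurable_fun (T := mR) (U := mR) setT (fun t => normc (f t)).
Proof.
move=> hH fH.
have m1 : measurable_fun (T := mR) (U := mR) setT (fun t => msq H (t, 0)).
  by apply/measurable_EFinP; exact: measurable_row 0 (measurable_msq hH).
have m2 : measurable_fun (T := mR) (U := mR) setT (@Num.sqrt R).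
  by apply: continuous_measurable_fun; exact: sqrt_continuous.
have -> : (fun t => normc (f t)) = @Num.sqrt R \o (fun t => msq H (t, 0)).
  by apply/funext => t; rewrite /= fH msqE sqrtr_sqr ger0_norm// normc_ge0.
exact: measurableT_comp.
Qed.

Lemma integral_amgm F (f : R -> R) (c1 c2 x y b c : R) : holo F -> 0 <= c1 -> 0 <= c2 ->
  (forall t, f t <= c1 * msq F (t + x, 0) + c2 * msq F (t, y)) ->
  measurable_fun (T := mR) (U := mR) setT f -> (forall t, 0 <= f t) ->
  (\int[leb R]_(t in `[b, c]) (f t)%:E <=
   c1%:E * slice (msq F) 0 + c2%:E * \int[leb R]_(t in `[b, c]) (msq F (t, y))%:E)%E.
Proof.
move=> hF c10 c20 fle mf f0.
have mI : measurable (`[b, c]%classic : set mR) by exact: measurable_itv.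
have mF := measurable_msq hF.
have mB := measurable_row y mF.
have mA : measurable_fun (T := mR) setT (fun t => (msq F (t + x, 0))%:E).
  have m0 := measurable_row 0 mF.
  exact: (measurableT_comp m0 (leb_preserving_shift x).1).
have cA : measurable_fun (T := mR) setT (fun t => (c1%:E * (msq F (t + x, 0))%:E)%E) by exact: emeasurable_funM.
have cB : measurable_fun (T := mR) setT (fun t => (c2%:E * (msq F (t, y))%:E)%E) by exact: emeasurable_funM.
have A0 t : (0 <= (msq F (t + x, 0))%:E)%E by rewrite lee_fin msq_ge0.
have B0 t : (0 <= (msq F (t, y))%:E)%E by rewrite lee_fin msq_ge0.
apply: (@le_trans _ _ (\int[leb R]_(t in `[b, c]) (c1%:E * (msq F (t + x, 0))%:E + c2%:E * (msq F (t, y))%:E))%E).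
  apply: (@ge0_le_integral _ _ _ (leb R) _ mI).
  - by move=> t _; rewrite lee_fin.
  - by apply: measurable_funTS; exact: measurable_fin.
  - by apply: measurable_funTS; exact: emeasurable_funD.
  - by move=> t _; rewrite -!EFinM -EFinD lee_fin.
rewrite (ge0_integralD (leb R) mI); last 4 first.
- by move=> t _; apply: mule_ge0.
- exact: measurable_funTS.
- by move=> t _; apply: mule_ge0.
- exact: measurable_funTS.
rewrite (ge0_integralZl _ mI (measurable_funTS mA))//.
rewrite (ge0_integralZl _ mI (measurable_funTS mB))//.
apply: leeD => //; apply: lee_wpmul2l; first by rewrite lee_fin.
rewrite /slice; have <- := integral_shift x (measurable_row 0 mF) (fun u => msq_ge0 _ _ : (0 <= (msq F (u, 0))%:E)%E).
exact: (@ge0_subset_integral _ _ _ (leb R) _ _ mI measurableT _ mA (fun t _ => A0 t)).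
Qed.

(* [G (iy)] is the truncated integral X of |F|^2 over the line, while AM-GM bounds |G| on the real
   line by L / s + s X; with s of order e^{-a|y|} the X on the right is absorbed. *)
Lemma plancherel_polya F (a : R) y : holo F -> 0 <= a -> exp_type_le a F ->
  (slice (msq F) 0 < +oo)%E ->
  (slice (msq F) y <= (4 * expR (2 * a * `|y|))%:E * slice (msq F) 0)%E.
Proof.
move=> hF a0 Fa Lfin.
have mF := measurable_msq hF.
have L0 : (0 <= slice (msq F) 0)%E by apply: slice_ge0; exact: msq_ge0.
move: Lfin L0; case LE : (slice (msq F) 0) => [L| |] // _; rewrite lee_fin => L0.
apply: integral_le_centered; first exact: measurable_row.
  by move=> x; rewrite lee_fin msq_ge0.
(* Truncation to [[-n, n]] makes [X] finite, without which it could not be absorbed. *)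
move=> n; have [X [X0 [XE XC]]] := integral_msq_segment y (- n%:R) n%:R hF.
rewrite XE -EFinM lee_fin.
have nn : - n%:R <= n%:R :> R by have := ler0n R n; lra.
pose k t := sharp F (Complex 0 (- y) + t%:C).
have kc : ccont k (- n%:R) n%:R by apply: ccont_row; exact: holo_sharp.
have kE t : k t = (F (t +i* y))^*.
  by rewrite /k /sharp; congr (F _)^*; rewrite rmorphD /=; simpc.
pose G z := cint (- n%:R) n%:R (fun t => F (z + t%:C) * k t).
have hG : holo G by exact: holo_convolution.
have Ga : exp_type_le a G by exact: exp_type_le_convolution.
have GX : G (0 +i* y) = X%:C.
  rewrite -XC; apply: cint_eq => t _; rewrite kE (_ : 0 +i* y + t%:C = t +i* y); last by simpc.
  exact: mul_conj_normc.
have GM (s : R) : 0 < s -> forall x : R, normc (G x%:C) <= L / s + s * X.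
  move=> s0 x; rewrite -lee_fin.
  apply: (le_trans (normc_cint_int nn (ccontM (@ccont_row F x%:C _ _ hF) kc))).
  have -> : (L / s + s * X)%:E = (2%:E * ((s^-1 / 2)%:E * L%:E + (s / 2)%:E * X%:E))%E.
    rewrite (_ : L / s + s * X = 2 * (s^-1 / 2 * L + s / 2 * X)); last by field; rewrite gt_eqF.
    by rewrite EFinM EFinD !EFinM.
  apply: lee_wpmul2l; first by rewrite lee_fin.
  rewrite -XE -LE; apply: (@integral_amgm F (fun t => normc (F (x%:C + t%:C) * k t)) _ _ x y) => //.
  - by rewrite divr_ge0// invr_ge0 ltW.
  - by rewrite divr_ge0// ltW.
  - move=> t; rewrite kE normcM normcJ !msqE (_ : x%:C + t%:C = (t + x) +i* 0); last by simpc; rewrite addrC.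
    set p := normc (F _); set q := normc _.
    have := sqr_ge0 (p - s * q); rewrite sqrrB => H.
    have -> : s^-1 / 2 * p ^+ 2 + s / 2 * q ^+ 2 = (p ^+ 2 + (s * q) ^+ 2) / (2 * s) by field; rewrite gt_eqF.
    rewrite ler_pdivlMr ?mulr_gt0//; lra.
  - apply: measurable_normc_row.
    exact: (holoM (holo_shift x%:C hF) (holo_shift (Complex 0 (- y)) (holo_sharp hF))).
    by move=> t; rewrite /= [t%:C + x%:C]addrC /k [t%:C + _ in RHS]addrC.
  - by move=> t; exact: normc_ge0.
have E0 : 0 < expR (a * `|y|) := expR_gt0 _.
(* With this [s] the bound at height [y] reads [X <= 2 exp (2 a |y|) L + X / 2]. *)
have s0 : 0 < (2 * expR (a * `|y|))^-1 by rewrite invr_gt0 mulr_gt0.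
have := exp_type_bound hG a0 Ga (GM _ s0) y.
rewrite GX normc_real ger0_norm// invrK.
have -> : 2 * a * `|y| = a * `|y| + a * `|y| by ring.
rewrite expRD; move: (expR _) E0 => e e0.
rewrite (_ : (L * (2 * e) + (2 * e)^-1 * X) * e = 2 * (e * e) * L + X / 2); last first.
  by field; rewrite gt_eqF.
by move=> H; have -> : 4 * (e * e) * L = 2 * (2 * (e * e) * L); [ring|lra].
Qed.

End plancherel_polya.

(** * Equivalence of norms in terms of squared norms *)

Section norm_equivalence.
Context {R : realType}.
Implicit Types (A B : set (R[i] -> R[i])) (N : (R[i] -> R[i]) -> \bar R).
Local Open Scope ereal_scope.

Lemma sqrte_lty : (forall x : \bar R, sqrte x < +oo -> x < +oo) /\
  (forall x : \bar R, x < +oo -> sqrte x < +oo).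
Proof. by split=> -[r| |]//= _; rewrite ltry. Qed.

Lemma same_space_sqrt A B NA NB N1 N2 (C : R) : A = B -> (0 < C)%R ->
  (forall F, A F -> NA F = sqrte (N1 F) /\ NB F = sqrte (N2 F)) ->
  (forall F, A F -> [/\ 0 <= N1 F, 0 <= N2 F, N1 F <= C%:E * N2 F & N2 F <= C%:E * N1 F]) ->
  same_space A NA B NB.
Proof.
move=> AB C0 hN h; split=> //; exists (Num.sqrt C)^-1%R, (Num.sqrt C); split.
- by rewrite invr_gt0 sqrtr_gt0.
- by rewrite sqrtr_gt0.
move=> F AF; have [-> ->] := hN _ AF; have [n1 n2 h1 h2] := h _ AF.
have sC x : (Num.sqrt C)%:E * sqrte x = sqrte (C%:E * x) by rewrite sqrteM ?lee_fin// ltW.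
apply/andP; split; last by rewrite sC lee_sqrt// mule_ge0// lee_fin ltW.
rewrite muleC lee_pdivrMr ?sqrtr_gt0// muleC sC lee_sqrt// mule_ge0// lee_fin ltW//.
Qed.

Lemma same_space_trans A1 N1 A2 N2 A3 N3 : same_space A1 N1 A2 N2 ->
  same_space A2 N2 A3 N3 -> same_space A1 N1 A3 N3.
Proof.
move=> [<- [c [C [c0 C0 h]]]] [<- [c' [C' [c'0 C'0 h']]]]; split=> //.
exists (c' * c)%R, (C' * C)%R; split; rewrite ?mulr_gt0// => F AF.
have /andP[h1 h2] := h _ AF; have /andP[h3 h4] := h' _ AF.
rewrite !EFinM -!muleA; apply/andP; split.
  by apply: le_trans h3; apply: lee_wpmul2l => //; rewrite lee_fin ltW.
by apply: (le_trans h4); apply: lee_wpmul2l => //; rewrite lee_fin ltW.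
Qed.

End norm_equivalence.

(** * Elementary estimates for the Fock integral *)

Section fock_estimates.
Context {R : realType}.
Notation mR := (measurableTypeR R).
Implicit Types (v : R -> R) (F : R[i] -> R[i]).
Local Open Scope ereal_scope.

Lemma measurable_fock2_integrand v F : measurable_fun (T := mR) (U := mR) setT v -> holo F ->
  measurable_fun (T := mR) setT (fun y => (v y)%:E * slice (msq F) y).
Proof.
move=> mv hF; apply: emeasurable_funM; first exact: measurable_fin.
by apply: measurable_slice; [exact: measurable_msq|exact: msq_ge0].
Qed.

Lemma fock2_ge0 v F : (forall y, 0 <= v y)%R -> 0 <= fock2 v F.
Proof.
move=> v0; apply: integral_ge0 => y _.
by rewrite mule_ge0 ?lee_fin// slice_ge0//; exact: msq_ge0.
Qed.

Lemma strip_le_fock2 v F a b c : measurable_fun (T := mR) (U := mR) setT v -> (forall y, 0 <= v y)%R ->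
  holo F -> (0 <= c)%R -> (forall y, (a <= y <= b)%R -> (c <= v y)%R) ->
  c%:E * \int[leb R]_(y in `[a, b]) slice (msq F) y <= fock2 v F.
Proof.
move=> mv v0 hF c0 cv.
have mI : measurable (`[a, b]%classic : set mR) by exact: measurable_itv.
have s0 y : 0 <= slice (msq F) y by apply: slice_ge0; exact: msq_ge0.
have ms : measurable_fun (T := mR) setT (slice (msq F)) by apply: measurable_slice; [exact: measurable_msq|exact: msq_ge0].
have mvs := measurable_fock2_integrand mv hF.
rewrite -(ge0_integralZl (leb R) mI (measurable_funTS ms))//.
apply: (@le_trans _ _ (\int[leb R]_(y in `[a, b]) ((v y)%:E * slice (msq F) y))).
  apply: (@ge0_le_integral _ _ _ (leb R) _ mI).
  - by move=> y _; rewrite mule_ge0// lee_fin.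
  - by apply: measurable_funTS; apply: emeasurable_funM.
  - exact: measurable_funTS.
  - by move=> y; rewrite /= in_itv /= => yab; apply: lee_wpmul2r => //; rewrite lee_fin cv.
apply: (@ge0_subset_integral _ _ _ (leb R) _ _ mI measurableT _ mvs) => //.
by move=> y _; rewrite mule_ge0// lee_fin.
Qed.

Lemma measurable_plane (f : plane R -> mR) :
  measurable_fun (setT : set (mR * mR)) (f : mR * mR -> mR) -> measurable_fun setT f.
Proof. by move=> mf _ B mB; apply: caratheodory_measurable_mu_ext; exact: mf. Qed.

Lemma compact_Im_bounded (K : set R[i]^o) : compact K ->
  exists2 Y : R, (0 <= Y)%R & forall z, K z -> (`|complex.Im z| <= Y)%R.
Proof.
move=> cK.
have Imc : continuous (fun z : R[i]^o => complex.Im z).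
  move=> z A /= /nbhs_ballP[e /= e0 eA]; rewrite nbhs_simpl /=.
  apply/nbhs_ballP; exists (e%:C)%C%R => /=; first by rewrite ltc_real.
  move=> w; rewrite -ball_normE /= => zw; apply: eA; rewrite -ball_normE /=.
  have {}zw : ((normc (z - w : R[i]))%:C < e%:C)%C%R by rewrite -normcE.
  rewrite ltc_real in zw; apply: le_lt_trans zw.
  by have := normc_Im (z - w : R[i])%R; case: (z) (w) => [a b] [c d].
have := compact_bounded (continuous_compact (continuous_subspaceT Imc) cK).
rewrite /bounded_near; case/pinfty_ex_gt0 => M M0 hM.
by exists M; [exact: ltW|move=> z Kz; apply: hM; exists z].
Qed.

End fock_estimates.

(** * The Paley-Wiener space as a Fock space *)

Section paley_wiener_is_fock.
Context {R : realType}.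
Notation mR := (measurableTypeR R).
Context (a : R) (a0 : 0 < a).

(** The exponential cancels the growth in the Plancherel-Polya inequality, and the second factor
    makes the rest integrable. Its decay is only polynomial, so that finiteness of the norm still
    forces type at most [a]. *)
Definition pw_density (y : R) : R := expR (- (2 * a * `|y|)) * (oneDsqr y)^-1.

Lemma pw_density_gt0 y : 0 < pw_density y.
Proof. by rewrite mulr_gt0 ?expR_gt0// invr_gt0 oneDsqr_gt0. Qed.

Lemma measurable_pw_density : measurable_fun (T := mR) (U := mR) setT pw_density.
Proof.
apply: measurable_funM; apply: continuous_measurable_fun; last exact: continuous_oneDsqrV.
move=> y; apply: continuous_comp; last exact: continuous_expR.
by apply: cvgN; apply: cvgM; [exact: cvg_cst|exact: norm_continuous].
Qed.

Lemma pw_density_lower y Y : `|y| <= Y -> expR (- (2 * a * Y)) * (oneDsqr Y)^-1 <= pw_density y.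
Proof.
move=> yY; rewrite ler_pM ?expR_ge0 ?invr_ge0 ?(ltW (oneDsqr_gt0 _))//.
  by rewrite ler_expR lerN2 ler_wpM2l// mulr_ge0// ltW.
by rewrite lef_pV2 ?posrE ?oneDsqr_gt0// /oneDsqr lerD2l -(real_normK (num_real y)) lerXn2r// nnegrE// (le_trans _ yY).
Qed.

Definition pw_weight (z : R[i]) : R := Num.sqrt (pw_density (complex.Im z)).

Lemma weight_pw_weight : weight pw_weight.
Proof.
split.
- by move=> z; rewrite sqrtr_gt0 pw_density_gt0.
- apply: measurable_plane; have m2 : measurable_fun (T := mR) (U := mR) setT (@Num.sqrt R).
    by apply: continuous_measurable_fun; exact: sqrt_continuous.
  exact: (measurableT_comp m2 (measurableT_comp measurable_pw_density measurable_snd)).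
move=> K /compact_Im_bounded[Y Y0 hY].
apply: (@lt_le_trans _ _ (Num.sqrt (expR (- (2 * a * Y)) * (oneDsqr Y)^-1))%:E).
  by rewrite lte_fin sqrtr_gt0 mulr_gt0 ?expR_gt0// invr_gt0 oneDsqr_gt0.
apply: le_ereal_inf_tmp => _ [z Kz <-]; rewrite lee_fin ler_wsqrtr// pw_density_lower//.
exact: hY.
Qed.

Lemma fock_norm_pw_weight F : holo F -> fock_norm pw_weight F = sqrte (fock2 pw_density F).
Proof.
move=> hF; rewrite /fock_norm -area_integral//; last 2 first.
- exact: measurable_pw_density.
- by move=> y; apply: ltW; exact: pw_density_gt0.
congr sqrte; apply: eq_integral => p _; rewrite exprMn /pw_weight sqr_sqrtr//.
by apply: ltW; exact: pw_density_gt0.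
Qed.

Lemma integral_oneDsqrV : (\int[leb R]_y ((oneDsqr y)^-1)%:E = pi%:E)%E.
Proof.
rewrite ge0_symfun_integralT.
- rewrite (_ : [set x | _] = `[0, +oo[%classic).
    by rewrite integral0y_oneDsqr -EFinM; congr _%:E; field.
  by apply/seteqP; split => x/=; rewrite in_itv/= andbT.
- by move=> x; rewrite invr_ge0 ltW// oneDsqr_gt0.
- exact: continuous_oneDsqrV.
- by move=> x; rewrite /= /oneDsqr sqrrN.
Qed.

Lemma fock2_le_line F : holo F -> exp_type_le a F -> (slice (msq F) 0 < +oo)%E ->
  (fock2 pw_density F <= (4 * pi)%:E * slice (msq F) 0)%E.
Proof.
move=> hF Fa Lfin.
have s0 y : (0 <= slice (msq F) y)%E by apply: slice_ge0; exact: msq_ge0.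
have mi : measurable_fun (T := mR) setT (fun y : R => ((oneDsqr y)^-1)%:E).
  by apply: measurable_fin; apply: continuous_measurable_fun; exact: continuous_oneDsqrV.
have i0 y : (0 <= ((oneDsqr y)^-1)%:E :> \bar R)%E by rewrite lee_fin invr_ge0 ltW// oneDsqr_gt0.
rewrite mulrC EFinM -muleA -integral_oneDsqrV muleC.
rewrite -(ge0_integralZl (leb R) measurableT mi)//; last by rewrite mule_ge0// lee_fin.
apply: (@ge0_le_integral _ _ _ (leb R) _ measurableT).
- by move=> y _; rewrite mule_ge0// lee_fin ltW// pw_density_gt0.
- by apply: measurable_fock2_integrand => //; exact: measurable_pw_density.
- by apply: emeasurable_funM.
move=> y _; have PP := plancherel_polya y hF (ltW a0) Fa Lfin.
apply: (le_trans (lee_wpmul2l _ PP)); first by rewrite lee_fin ltW// pw_density_gt0.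
rewrite muleA [leRHS]muleAC; apply: lee_wpmul2r => //.
rewrite -EFinM (_ : pw_density y * _ = 4 * (oneDsqr y)^-1) ?EFinM//.
by rewrite /pw_density expRN; field; rewrite !gt_eqF ?expR_gt0 ?oneDsqr_gt0.
Qed.

Lemma line_le_fock2 : exists2 C : R, 0 < C & forall F, holo F ->
  (slice (msq F) 0 <= C%:E * fock2 pw_density F)%E.
Proof.
pose c : R := expR (- (2 * a * 2)) * (oneDsqr 2)^-1.
have c0 : 0 < c by rewrite mulr_gt0 ?expR_gt0// invr_gt0 oneDsqr_gt0.
exists (8 / c); first by rewrite divr_gt0.
move=> F hF; apply: (le_trans (slice_le_strip 0 hF)).
rewrite EFinM -muleA; apply: lee_wpmul2l; first by rewrite lee_fin.
rewrite muleC lee_pdivlMr// muleC; apply: strip_le_fock2 => //.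
- exact: measurable_pw_density.
- by move=> y; apply: ltW; exact: pw_density_gt0.
- exact: ltW.
- by move=> y y2; apply: pw_density_lower; rewrite ler_norml; lra.
Qed.

(** A point value is controlled by the strip of half-height 2 around it, on which the density is at
    least its value at [|y| + 2]. The polynomial loss is absorbed by
    [(1 + e s)^2 <= exp (2 e s)]. *)
Lemma exp_type_le_of_fock2 F : holo F -> (fock2 pw_density F < +oo)%E -> exp_type_le a F.
Proof.
move=> hF; have : (0 <= fock2 pw_density F)%E.
  by apply: fock2_ge0 => y; apply: ltW; exact: pw_density_gt0.
case NE : fock2 => [n| |] //; rewrite lee_fin => n0 _ e e0.
(* Inside [C1 (1 + e s)^2] the three summands dominate, one by one, the terms of
   [1 + (s + 2)^2 = 5 + 4 s + s^2]. *)
pose C1 : R := 5 + 2 / e + (e ^+ 2)^-1.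
pose C : R := 2 * n * expR (4 * a) * C1.
have e1 : 0 <= e^-1 by rewrite invr_ge0 ltW.
have C10 : 0 <= C1 by rewrite !addr_ge0// ?mulr_ge0// invr_ge0 exprn_ge0// ltW.
have C0 : 0 <= C by rewrite !mulr_ge0 ?expR_ge0.
exists (Num.sqrt C) => -[x y].
pose s := normc (x +i* y); pose Y := `|y| + 2.
have s0 : 0 <= s := normc_ge0 _.
have ys : `|y| <= s by exact: (normc_Im (x +i* y)).
pose c : R := expR (- (2 * a * Y)) * (oneDsqr Y)^-1.
have c0 : 0 < c by rewrite mulr_gt0 ?expR_gt0// invr_gt0 oneDsqr_gt0.
have H : msq F (x, y) * c <= 2 * n.
  rewrite -lee_fin [leLHS]EFinM [leRHS]EFinM.
  apply: (@le_trans _ _ (2%:E * \int[leb R]_(w in `[(y - 2)%R, (y + 2)%R]) slice (msq F) w * c%:E)%E).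
    by apply: lee_wpmul2r; [rewrite lee_fin ltW|exact: point_le_strip].
  rewrite -muleA; apply: lee_wpmul2l; first by rewrite lee_fin.
  rewrite muleC -NE; apply: strip_le_fock2 => //.
  - exact: measurable_pw_density.
  - by move=> w; apply: ltW; exact: pw_density_gt0.
  - exact: ltW.
  - move=> w wy; apply: pw_density_lower; rewrite /Y.
    have : `|w - y| <= 2 by rewrite ler_norml; lra.
    have := ler_normD (w - y) y; rewrite subrK; lra.
rewrite -(ler_pXn2r (n := 2))// ?nnegrE ?normc_ge0 ?mulr_ge0 ?sqrtr_ge0 ?expR_ge0//.
rewrite exprMn sqr_sqrtr// -expRM_natl -/s.
have {}H : normc (F (x +i* y)) ^+ 2 <= 2 * n * (expR (2 * a * Y) * oneDsqr Y).
  move: H; rewrite /c expRN -invfM ler_pdivrMr//.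
  by rewrite mulr_gt0 ?expR_gt0// oneDsqr_gt0.
apply: (le_trans H); rewrite /C -!mulrA; apply: ler_wpM2l => //; apply: ler_wpM2l => //.
have -> : 2%:R * ((a + e) * s) = 2 * a * s + (e * s + e * s) by ring.
have E1 : 1 + e * s <= expR (e * s) by exact: expR_ge1Dx.
have es : 0 <= e * s by rewrite mulr_ge0// ltW.
have E2 : (1 + e * s) ^+ 2 <= expR (e * s + e * s).
  by rewrite expRD -expr2 lerXn2r// nnegrE ?expR_ge0//; lra.
have A1 : expR (2 * (a * Y)) <= expR (4 * a) * expR (2 * a * s).
  rewrite -expRD ler_expR (_ : 4 * a + 2 * a * s = 2 * (a * (s + 2))); last by ring.
  by rewrite ler_wpM2l// ler_pM2l// /Y lerD2r.
have A2 : oneDsqr Y <= C1 * (1 + e * s) ^+ 2.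
  have Y2 : Y ^+ 2 <= (s + 2) ^+ 2 by rewrite lerXn2r// ?nnegrE /Y ?lerD2r// ?addr_ge0.
  rewrite /oneDsqr; apply: (@le_trans _ _ (1 + (s + 2) ^+ 2)); first by rewrite lerD2l.
  have -> : C1 * (1 + e * s) ^+ 2 = 1 + (s + 2) ^+ 2 +
     (2 / e + (e ^+ 2)^-1 + 5 * (2 * (e * s) + (e * s) ^+ 2) + 2 * (e * s ^+ 2) + 2 * (s / e)).
    by rewrite /C1; field; rewrite gt_eqF.
  by rewrite lerDl !addr_ge0 ?mulr_ge0 ?addr_ge0 ?mulr_ge0 ?invr_ge0 ?exprn_ge0 ?(ltW e0).
rewrite [in leRHS]expRD.
apply: (@le_trans _ _ (expR (4 * a) * expR (2 * a * s) * (C1 * (1 + e * s) ^+ 2))).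
  by apply: ler_pM => //; rewrite ?expR_ge0// ltW// oneDsqr_gt0.
rewrite [leRHS](_ : _ = expR (4 * a) * expR (2 * a * s) * (C1 * expR (e * s + e * s))); last by ring.
by apply: ler_wpM2l; [rewrite mulr_ge0 ?expR_ge0|apply: ler_wpM2l].
Qed.

Lemma paley_wiener_fock : same_space (paley_wiener a) (@L2_norm_on_line R) (fock pw_weight) (fock_norm pw_weight).
Proof.
have [C C0 HC] := line_le_fock2.
have v0 y : 0 <= pw_density y by apply: ltW; exact: pw_density_gt0.
have pip : 0 < pi :> R := pi_gt0 R.
have [sub sup] := @sqrte_lty R.
apply: (@same_space_sqrt _ _ _ _ _ (fun F => slice (msq F) 0) (fock2 pw_density) (C + 4 * pi)).
- apply/seteqP; split=> F.
    case=> /entireP hF Fa /sub Lfin; split; first exact/entireP.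
    rewrite fock_norm_pw_weight//; apply: sup; apply: (le_lt_trans (fock2_le_line hF Fa Lfin)).
    by rewrite lte_mul_pinfty// ?lee_fin ?mulr_ge0// ltW.
  case=> /entireP hF; rewrite fock_norm_pw_weight// => /sub Nfin.
  split; [exact/entireP|exact: exp_type_le_of_fock2|].
  apply: sup; apply: (le_lt_trans (HC _ hF)).
  by rewrite lte_mul_pinfty// ?lee_fin ?ltW// mulr_gt0.
- by rewrite addr_gt0 ?mulr_gt0.
- by move=> F [/entireP hF _ _]; rewrite fock_norm_pw_weight.
move=> F [/entireP hF Fa /sub Lfin].
have L0 : (0 <= slice (msq F) 0)%E by apply: slice_ge0; exact: msq_ge0.
have N0 : (0 <= fock2 pw_density F)%E by exact: fock2_ge0.
split=> //.
- by apply: (le_trans (HC _ hF)); apply: lee_wpmul2r => //; rewrite lee_fin lerDl mulr_ge0// ltW.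
- apply: (le_trans (fock2_le_line hF Fa Lfin)); apply: lee_wpmul2r => //.
  by rewrite lee_fin lerDr ltW.
Qed.

End paley_wiener_is_fock.

Lemma representing_fock_weight_of_paley_wiener (R : realType) (E : R[i] -> R[i]) (a : R) : 0 < a ->
  same_space (de_branges E) (de_branges_norm E) (paley_wiener a) (@L2_norm_on_line R) ->
  exists W : R[i] -> R, representing_fock_weight E W /\
    forall z w : R[i], complex.Im z = complex.Im w -> W z = W w.
Proof.
move=> a0 h; exists (pw_weight a); split; last by move=> z w zw; rewrite /pw_weight zw.
split; first exact: weight_pw_weight.
exact: same_space_trans h (paley_wiener_fock a0).
Qed.

(** * Fock spaces whose density depends on the imaginary part *)

Section fock_space.
Context {R : realType}.
Notation mR := (measurableTypeR R).
Implicit Types F G : R[i] -> R[i].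
Local Open Scope ereal_scope.

(** The properties of the squared weight that survive the passage to a Borel representative. *)
Definition density (v : R -> R) :=
  [/\ measurable_fun (T := mR) (U := mR) setT v, forall y, (0 < v y)%R &
    forall Y, exists2 c : R, (0 < c)%R & forall y, (`|y| <= Y)%R -> (c <= v y)%R].

(* A [Variant] rather than a conjunction, so that unification does not unfold it. *)
Variant inH v F : Prop := InH of holo F & fock2 v F < +oo.

Context (v : R -> R) (hv : density v).

Let mv : measurable_fun (T := mR) (U := mR) setT v. Proof. by case: hv. Qed.
Let v0 y : (0 <= v y)%R. Proof. by apply: ltW; case: hv. Qed.

Lemma slice_msq_ge0 F y : 0 <= slice (msq F) y.
Proof. by apply: slice_ge0; exact: msq_ge0. Qed.

(** A norm bound for pointwise limits, without completeness of the space: this is how derivatives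
    and Taylor series are shown to stay in it. *)
Lemma fock2_fatou (F_ : nat -> R[i] -> R[i]) F (B : \bar R) : (forall n, holo (F_ n)) -> holo F ->
  (forall z (e : R), (0 < e)%R -> exists N, forall n, (N <= n)%N -> (normc (F_ n z - F z) <= e)%R) ->
  (forall n, fock2 v (F_ n) <= B) -> fock2 v F <= B.
Proof.
move=> hF_ hF cvF FB; have [mF <-] := fock2_product mv v0 hF.
apply: (@fatou_le _ _ _ (borel_area R) (fun n p => (msq (F_ n) p * v p.2)%R%:E)) => //.
- by move=> n; have [] := fock2_product mv v0 (hF_ n).
- by move=> n p; rewrite lee_fin mulr_ge0// msq_ge0.
- by move=> p; rewrite lee_fin mulr_ge0// msq_ge0.
- move=> [x y] c; rewrite lte_fin /= => cF.
  have vy : (0 < v y)%R by case: hv.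
  pose M := normc (F (x +i* y)%C); have M0 : (0 <= M)%R := normc_ge0 _.
  have {}cF : (c / v y < M ^+ 2)%R by rewrite ltr_pdivrMr.
  (* This tolerance yields [(M - e)^2 >= M^2 - 2 M e >= c / v y]; the 1 in the denominator allows
     [M = 0]. *)
  have e0 : (0 < (M ^+ 2 - c / v y) / (2 * M + 1))%R by rewrite divr_gt0; lra.
  have [N HN] := cvF (x +i* y)%C _ e0.
  exists N => n /HN; set e := (_ / _)%R in e0 *; set w := F_ n _ => we.
  have H : (M - e <= normc w)%R.
    by have := normcD (F (x +i* y)%C - w)%R w; rewrite subrK normc_distC -/M; lra.
  rewrite lee_fin -ler_pdivrMr// /msq /= -/w.
  have ee : (e * (2 * M + 1) = M ^+ 2 - c / v y)%R by rewrite /e divfK// gt_eqF//; lra.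
  case: (lerP e M) => eM; last first.
    have : (c / v y <= 0)%R by have : (M * M <= e * M)%R; [rewrite ler_wpM2r// ltW|rewrite expr2 in ee *; lra].
    by move=> /le_trans; apply; rewrite exprn_ge0// normc_ge0.
  apply: (@le_trans _ _ ((M - e) ^+ 2)%R); last by rewrite lerXn2r// nnegrE ?normc_ge0// subr_ge0.
  have := sqr_ge0 e; rewrite sqrrB; lra.
- by move=> n; have [_ ->] := fock2_product mv v0 (hF_ n).
Qed.

Lemma fock2_le F G (k : R) : holo F -> holo G -> (0 <= k)%R ->
  (forall z, (normc (F z) ^+ 2 <= k * normc (G z) ^+ 2)%R) -> fock2 v F <= k%:E * fock2 v G.
Proof.
move=> hF hG k0 FG.
have [mF <-] := fock2_product mv v0 hF; have [mG <-] := fock2_product mv v0 hG.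
rewrite -(ge0_integralZl (borel_area R) measurableT mG).
- apply: (@ge0_le_integral _ _ _ (borel_area R) _ measurableT) => //.
  + by move=> p _; rewrite lee_fin mulr_ge0// msq_ge0.
  + exact: emeasurable_funM.
  + by move=> p _; rewrite -EFinM lee_fin mulrA ler_wpM2r// FG.
- by move=> p _; rewrite lee_fin mulr_ge0// msq_ge0.
- by rewrite lee_fin.
Qed.

Lemma sqr_le_double (s p q : R) : (0 <= s -> 0 <= p -> 0 <= q -> s <= p + q -> s ^+ 2 <= 2 * (p ^+ 2 + q ^+ 2))%R.
Proof.
move=> s0 p0 q0 h; apply: (@le_trans _ _ ((p + q) ^+ 2)%R); first by rewrite lerXn2r// nnegrE addr_ge0.
by have := sqr_ge0 (p - q)%R; rewrite sqrrB sqrrD; lra.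
Qed.

Lemma fock2D F G : holo F -> holo G ->
  fock2 v (fun z => F z + G z)%R <= 2%:E * (fock2 v F + fock2 v G).
Proof.
move=> hF hG; have hFG := holoD hF hG.
have [mF <-] := fock2_product mv v0 hF; have [mG <-] := fock2_product mv v0 hG.
have [mFG <-] := fock2_product mv v0 hFG.
have p0 (K : R[i] -> R[i]) p : (setT : set (mR * mR)) p -> 0 <= (msq K p * v p.2)%R%:E.
  by move=> _; rewrite lee_fin mulr_ge0// msq_ge0.
rewrite -(ge0_integralD (borel_area R) measurableT (p0 F) mF (p0 G) mG).
rewrite -(ge0_integralZl (borel_area R) measurableT (emeasurable_funD mF mG)).
- apply: (@ge0_le_integral _ _ _ (borel_area R) _ measurableT) => //.
  + exact: (p0 (fun z => F z + G z)%R).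
  + by apply: emeasurable_funM => //; exact: emeasurable_funD.
  + move=> p _; rewrite -EFinD -EFinM lee_fin -mulrDl mulrA ler_wpM2r// /msq.
    set a := F _; set b := G _.
    by apply: sqr_le_double (normcD a b); exact: normc_ge0.
- by move=> p _; rewrite adde_ge0// p0.
- by rewrite lee_fin.
Qed.

Lemma fock2Z F (k : R[i]) : holo F -> fock2 v (fun z => k * F z)%R <= (normc k ^+ 2)%:E * fock2 v F.
Proof.
move=> hF; apply: fock2_le => //; first by apply: holoM => //; exact: holo_cst.
  by rewrite exprn_ge0// normc_ge0.
by move=> z; rewrite normcM exprMn.
Qed.

Lemma slice_shift F (u y : R) : holo F -> slice (msq (fun z => F (z + u%:C)%C)%R) y = slice (msq F) y.
Proof.
move=> hF; rewrite /slice -[RHS](integral_shift u (measurable_row y (measurable_msq hF))).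
  apply: eq_integral => x _; rewrite !msqE (_ : (x +i* y + u%:C = (x + u)%R +i* y)%C%R)//.
  by apply/eqP; rewrite eq_complex /= addr0 !eqxx.
by move=> x; rewrite lee_fin msq_ge0.
Qed.

Lemma fock2_shift F (u : R) : holo F -> fock2 v (fun z => F (z + u%:C)%C)%R = fock2 v F.
Proof. by move=> hF; apply: eq_integral => y _; rewrite slice_shift. Qed.

Lemma slice_le_fock2 Y : exists2 C : R, (0 < C)%R & forall F y, holo F -> (`|y| <= Y)%R ->
  slice (msq F) y <= C%:E * fock2 v F /\ forall x, (msq F (x, y))%:E <= C%:E * fock2 v F.
Proof.
have [_ _ /(_ (Y + 2)%R)[c c0 hc]] := hv.
have st F y : holo F -> (`|y| <= Y)%R ->
    \int[leb R]_(w in `[(y - 2)%R, (y + 2)%R]) slice (msq F) w <= c^-1%:E * fock2 v F.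
  move=> hF yY; rewrite muleC lee_pdivlMr// muleC; apply: strip_le_fock2 => //; first exact: ltW.
  by move=> w wy; apply: hc; move: yY; rewrite !ler_norml; lra.
exists (8 * c^-1)%R; first by rewrite mulr_gt0 ?invr_gt0.
move=> F y hF yY; have {}st := st _ _ hF yY.
split=> [|x]; [apply: (le_trans (slice_le_strip y hF))|apply: (le_trans (point_le_strip x y hF))].
  by rewrite EFinM -muleA; apply: lee_wpmul2l st; rewrite lee_fin.
apply: (@le_trans _ _ (2%:E * (c^-1%:E * fock2 v F))).
  by apply: lee_wpmul2l st; rewrite lee_fin.
rewrite muleA -EFinM; apply: lee_wpmul2r; first exact: fock2_ge0.
by rewrite lee_fin ler_pM2r ?invr_gt0//; lra.
Qed.

(** The half-height 3 is that of the boxes in [derivative_le_box]. *)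
Lemma strip3_le_fock2 : exists2 C : R, (0 < C)%R & forall F, holo F ->
  \int[leb R]_(w in `[(0 - 3)%R, (0 + 3)%R]) slice (msq F) w <= C%:E * fock2 v F.
Proof.
have [_ _ /(_ 3%R)[c c0 hc]] := hv.
exists c^-1%R; first by rewrite invr_gt0.
move=> F hF; rewrite muleC lee_pdivlMr// muleC; apply: strip_le_fock2 => //; first exact: ltW.
by move=> w wy; apply: hc; rewrite !ler_norml; lra.
Qed.

End fock_space.

(** * Differentiation and small complex translations are bounded *)

Section translations.
Context {R : realType}.
Notation mR := (measurableTypeR R).
Implicit Types F G : R[i] -> R[i].
Local Open Scope ereal_scope.

Context (v : R -> R) (hv : density v) (C0 : R) (C00 : (0 < C0)%R)
  (line_norm : forall F, inH v F -> fock2 v F <= C0%:E * slice (msq F) 0).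

Let mv : measurable_fun (T := mR) (U := mR) setT v. Proof. by case: hv. Qed.
Let v0 y : (0 <= v y)%R. Proof. by apply: ltW; case: hv. Qed.

(** Only real steps are taken: horizontal invariance keeps these quotients in the space, while
    vertical translations are not yet available. *)
Definition diff_quotient F (n : nat) : R[i] -> R[i] :=
  fun z => (n.+1%:R%:C * (F (z + n.+1%:R^-1%:C) - F z))%C%R.

Lemma holo_diff_quotient F n : holo F -> holo (diff_quotient F n).
Proof.
by move=> hF; apply: holoM; [exact: holo_cst|apply: holoB => //; exact: holo_shift].
Qed.

Lemma inH_diff_quotient F n : inH v F -> inH v (diff_quotient F n).
Proof.
move=> [hF Nfin]; split; first exact: holo_diff_quotient.
have hS := holo_shift (n.+1%:R^-1%:C)%C hF; have hN : holo (fun z => (- 1) * F z)%R by apply: holoM => //; exact: holo_cst.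
rewrite /diff_quotient (_ : (fun z => _) = (fun z => n.+1%:R%:C * (F (z + n.+1%:R^-1%:C) + (- 1) * F z))%C%R); last first.
  by apply/funext => z; rewrite mulN1r.
apply: (le_lt_trans (fock2Z hv _ (holoD hS hN))).
apply: (@le_lt_trans _ _ ((normc (n.+1%:R%:C)%C ^+ 2)%:E * (2%:E * (fock2 v F + (normc (- 1)%R ^+ 2)%:E * fock2 v F)))).
  apply: lee_wpmul2l; first by rewrite lee_fin exprn_ge0// normc_ge0.
  apply: (le_trans (fock2D hv hS hN)); apply: lee_wpmul2l; first by rewrite lee_fin.
  by rewrite fock2_shift//; apply: leeD => //; exact: fock2Z.
have : 0 <= fock2 v F by exact: fock2_ge0.
by move: Nfin; case: fock2 => [r| |] // _ _; rewrite -!(EFinM, EFinD) ltry.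
Qed.

(** The step is at most 1, so one box bounds the derivative along the whole segment from [x] to
    [x + 1 / n.+1], uniformly in [n]. *)
Lemma diff_quotient_le_box : exists2 K : R, (0 < K)%R & forall F n x, holo F ->
  (msq (diff_quotient F n) (x, 0%R))%:E <= K%:E * box (msq F) x 0 3 4.
Proof.
have [K K0 HK] := @derivative_le_box R.
exists K => // F n x hF.
have k0 : (0 < n.+1%:R^-1 :> R)%R by rewrite invr_gt0.
have k1 : (n.+1%:R^-1 <= 1 :> R)%R by rewrite invf_le1// ler1n.
have box0 : 0 <= K%:E * box (msq F) x 0 3 4.
  by rewrite mule_ge0 ?lee_fin ?(ltW K0)// box_ge0//; exact: msq_ge0.
have HKs s := HK F x 0%R s hF.
move: box0 HKs; case: (K%:E * _) => [r| |]; [|by move=> *; rewrite leey|by []].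
rewrite lee_fin => r0 H; rewrite lee_fin msqE /diff_quotient.
have : (normc (F (x%:C + n.+1%:R^-1%:C) - F x%:C)%C <= Num.sqrt r * normc (n.+1%:R^-1%:C)%C)%R.
  apply: cmvt => // t /andP[t0 t1].
  have := H (t * n.+1%:R^-1)%R _; rewrite lee_fin msqE.
  rewrite (_ : Complex (x + t * n.+1%:R^-1)%R 0%R = (x%:C + t%:C * n.+1%:R^-1%:C)%C%R); last first.
    by apply/eqP; rewrite eq_complex /= !(mulr0, mul0r, subr0, addr0, oppr0) !eqxx.
  rewrite ger0_norm ?mulr_ge0// ?(ltW k0)// => /(_ (mulr_ile1 t0 (ltW k0) t1 k1)) h.
  by rewrite -[leLHS]ger0_norm ?normc_ge0// -sqrtr_sqr ler_wsqrtr.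
rewrite normc_real ger0_norm ?(ltW k0)// => h.
rewrite normcM exprMn normc_real ger0_norm//.
rewrite -(@ler_pM2l _ (n.+1%:R^-1 ^+ 2)%R) ?exprn_gt0// mulrA -exprMn mulVf// expr1n mul1r.
by rewrite -[X in (_ <= _ * X)%R](sqr_sqrtr r0) -exprMn mulrC lerXn2r// nnegrE ?normc_ge0// mulr_ge0// ?sqrtr_ge0// ltW.
Qed.

(* The difference quotients stay bounded in the space, so Fatou applies. *)
Lemma inH_derivative : exists2 k : R, (0 < k)%R & forall F, inH v F ->
  holo (dc F) /\ fock2 v (dc F) <= k%:E * fock2 v F.
Proof.
have [K K0 HK] := diff_quotient_le_box.
have [C C1 HC] := strip3_le_fock2 hv.
exists (C0 * (K * (2 * 4 * C)))%R; first by rewrite !mulr_gt0.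
move=> F HF; have [hF Nfin] := HF; split; first exact: holo_dc.
have [mb Eb] := @integral_box _ (msq F) 0%R 3%R 4%R (ltW (ltr0n _ 4)) (measurable_msq hF) (@msq_ge0 _ F).
apply: (@fock2_fatou _ v hv (diff_quotient F)).
- by move=> n; exact: holo_diff_quotient.
- exact: holo_dc.
- move=> z e e0; have [D D0 HD] := holo_cder z hF e0.
  exists (Num.bound D^-1)%R => n nD.
  have k0 : (0 < n.+1%:R^-1 :> R)%R by rewrite invr_gt0.
  have kD : (n.+1%:R^-1 < D)%R.
    rewrite invf_plt ?posrE// (lt_le_trans (archi_boundP _))// ?invr_ge0 ?(ltW D0)//.
    by rewrite ler_nat (leq_trans nD).
  have := HD (n.+1%:R^-1%:C)%C; rewrite normc_real ger0_norm ?(ltW k0)// => /(_ kD).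
  set d := dc F z; set w := F (_ + _)%R => h.
  have -> : (diff_quotient F n z - d = n.+1%:R%:C * (w - F z - d * n.+1%:R^-1%:C))%C%R.
    have pq : (n.+1%:R%:C * n.+1%:R^-1%:C = 1 :> R[i])%C%R by rewrite -rmorphM/= mulfV.
    by rewrite /diff_quotient -/w [RHS]mulrBr (mulrCA _ d) pq mulr1.
  rewrite normcM normc_real ger0_norm//.
  by rewrite mulrC -ler_pdivlMr// ltr0n.
move=> n; have hq := inH_diff_quotient n HF.
apply: (le_trans (line_norm hq)); rewrite EFinM -muleA; apply: lee_wpmul2l; first by rewrite lee_fin ltW.
apply: (@le_trans _ _ (\int[leb R]_x (K%:E * box (msq F) x 0 3 4))).
  apply: (@ge0_le_integral _ _ _ (leb R) _ measurableT).
  - by move=> x _; rewrite lee_fin msq_ge0.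
  - exact: measurable_row (measurable_msq (holo_diff_quotient n hF)).
  - exact: emeasurable_funM.
  - by move=> x _; exact: HK.
rewrite (ge0_integralZl (leb R) measurableT mb).
- rewrite Eb [(K * _)%:E]EFinM -muleA; apply: lee_wpmul2l; first by rewrite lee_fin ltW.
  by rewrite [(2 * 4 * C)%:E]EFinM -muleA; apply: lee_wpmul2l; [rewrite lee_fin|exact: HC].
- by move=> x _; apply: box_ge0; exact: msq_ge0.
- by rewrite lee_fin ltW.
Qed.

(** [fock2D] loses a factor 2 at each addition, and the ratio 1/4 more than compensates:
    [2 (B + 4 (B / 4)) = 4 B]. *)
Lemma fock2_geometric_sum n (b_ : nat -> R[i] -> R[i]) (B : R) : (forall k, holo (b_ k)) ->
  (forall k, fock2 v (b_ k) <= (B * 4^-1 ^+ k)%:E) ->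
  fock2 v (fun z => \sum_(k < n) b_ k z)%R <= (4 * B)%:E.
Proof.
elim: n b_ B => [|n IH] b_ B hb Bb.
  have B0 : (0 <= B)%R.
    by rewrite -lee_fin; have := Bb 0%N; rewrite expr0 mulr1; apply: le_trans; exact: fock2_ge0.
  rewrite (_ : (fun z => _) = (fun z => 0 * 0)%R); last by apply/funext => z; rewrite big_ord0 mul0r.
  apply: (le_trans (fock2Z hv _ (holo_cst _))).
  by rewrite Normc.normc0 expr0n mul0e lee_fin mulr_ge0.
rewrite (_ : (fun z => _) = (fun z => b_ 0%N z + \sum_(k < n) b_ k.+1 z)%R); last first.
  by apply/funext => z; rewrite big_ord_recl.
apply: (le_trans (fock2D hv (hb 0%N) (holo_sum _ (fun k => hb k.+1)))).
have Bb' k : fock2 v (b_ k.+1) <= (B / 4 * 4^-1 ^+ k)%:E by have := Bb k.+1; rewrite exprS mulrA.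
have h := IH (fun k => b_ k.+1) (B / 4)%R (fun k => hb k.+1) Bb'.
have -> : (4 * B = 2 * (B + 4 * (B / 4)))%R by field.
rewrite [leRHS]EFinM; apply: lee_wpmul2l; first by rewrite lee_fin.
by rewrite [leRHS]EFinD; apply: leeD => //; have := Bb 0%N; rewrite expr0 mulr1.
Qed.

Lemma inH_iter_dc : exists2 k : R, (0 < k)%R & forall F n, inH v F ->
  fock2 v (iter n dc F) <= (k ^+ n)%:E * fock2 v F.
Proof.
have [k k0 Hk] := inH_derivative; exists k; first exact: k0.
move=> F n HF; have [hF Nfin] := HF.
elim: n => [|n IH]; first by rewrite mul1e.
have N0 : 0 <= fock2 v F by exact: fock2_ge0.
have Hn : inH v (iter n dc F).
  split; first exact: holo_iter_dc.
  apply: (le_lt_trans IH); move: N0 Nfin; case: fock2 => [r| |] // _ _.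
  by rewrite -EFinM ltry.
have [_ h] := Hk _ Hn; apply: (le_trans h).
rewrite exprS EFinM -muleA; apply: lee_wpmul2l; first by rewrite lee_fin ltW.
exact: IH.
Qed.

(** The translate is the limit of its Taylor sums. Their terms have squared norm at most
    [(k |w|^2)^j] times that of [F], so the sums stay bounded, and point evaluations of the
    derivatives give the convergence. *)
Lemma inH_small_shift : exists2 s : R, (0 < s)%R & forall F w, inH v F -> (normc w <= s)%R ->
  inH v (fun z => F (z + w)%R) /\ fock2 v (fun z => F (z + w)%R) <= 4%:E * fock2 v F.
Proof.
have [k k0 Hk] := inH_iter_dc.
(* [s <= 1] and [k s <= 1/4] give [k |w|^2 <= 1/4], the ratio needed for the sums; [s <= 1] also
   keeps the segment from [z] to [z + w] in a fixed strip. *)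
pose s : R := Num.min 1%R ((4 * k)^-1)%R.
have s0 : (0 < s)%R by rewrite lt_min ltr01 invr_gt0 mulr_gt0.
have s1 : (s <= 1)%R by rewrite ge_min lexx.
have sk : (k * s <= 4^-1)%R.
  by rewrite -ler_pdivlMl// -invfM mulrC ge_min lexx orbT.
exists s; first exact: s0.
move=> F w HF ws; have [hF Nfin] := HF.
have N0 : 0 <= fock2 v F by exact: fock2_ge0.
have h : fock2 v (fun z => F (z + w)%R) <= 4%:E * fock2 v F; last first.
  split; last exact: h.
  split; first exact: holo_shift.
  apply: (le_lt_trans h); move: N0 Nfin; case: (fock2 v F) => [r| |] // _ _.
  by rewrite -EFinM ltry.
have := Nfin; move: N0; case NE : (fock2 v F) => [N| |] //; rewrite lee_fin => N0 _.
have kw : (k * normc w ^+ 2 <= 4^-1)%R.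
  apply: le_trans sk; rewrite ler_pM2l// expr2 (le_trans (ler_piMr _ _))// ?normc_ge0//.
  exact: le_trans s1.
have hb j : holo (fun z => w ^+ j / j`!%:R * iter j dc F z)%R.
  by apply: holoM; [exact: holo_cst|exact: holo_iter_dc].
have fact1 j : (normc (w ^+ j / j`!%:R)%R <= normc w ^+ j)%R.
  rewrite normcM normcV normcX -(rmorph_nat (real_complex R)) normc_real ger0_norm ?ler0n//.
  by rewrite ler_piMr ?exprn_ge0 ?normc_ge0// invf_le1 ?ltr0n ?fact_gt0// ler1n fact_gt0.
apply: (@fock2_fatou _ v hv (fun n z => taylor n F z w)).
- by move=> n; exact: (holo_sum n hb).
- exact: holo_shift.
- move=> z e e0.
  have [C C1 HC] := slice_le_fock2 hv (`|complex.Im z| + 1)%R.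
  have dn n t : (0 <= t <= 1)%R -> (normc (iter n dc F (z + t%:C * w)%C%R) <= Num.sqrt (C * N * k ^+ n))%R.
    move=> /andP[t0 t1]; set u := (z + _)%R.
    have uz : (`|complex.Im u| <= `|complex.Im z| + 1)%R.
      have := normc_Im (t%:C * w)%C%R; rewrite normcM normc_real [`|t|%R]ger0_norm//.
      have tw : (t * normc w <= 1)%R by rewrite mulr_ile1 ?normc_ge0//; exact: le_trans s1.
      have -> : complex.Im u = (complex.Im z + complex.Im (t%:C * w)%C)%R by rewrite /u; case: (z) => a b; case: (_ * w)%R.
      by move=> h; rewrite (le_trans (ler_normD _ _))// lerD2l (le_trans h).
    have [_ /(_ (complex.Re u))] := HC _ _ (holo_iter_dc n hF) uz.
    have -> : msq (iter n dc F) (complex.Re u, complex.Im u) = (normc (iter n dc F u) ^+ 2)%R by rewrite msqE; case: (u).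
    move=> h; rewrite -[leLHS]ger0_norm ?normc_ge0// -sqrtr_sqr ler_wsqrtr// -lee_fin.
    apply: (le_trans h); rewrite -mulrA EFinM; apply: lee_wpmul2l; first by rewrite lee_fin ltW.
    by rewrite mulrC EFinM -NE; exact: Hk.
  (* The [n]-th derivative is at most [sqrt (C N k^n)], and [sqrt k |w| <= 1/2]. *)
  have err n : (normc (taylor n F z w - F (z + w)) <= Num.sqrt (C * N) * 2^-1 ^+ n)%R.
    rewrite normc_distC; apply: (le_trans (taylor_remainder hF (dn n))).
    rewrite sqrtrM ?mulr_ge0 ?(ltW C1)// -mulrA ler_wpM2l ?sqrtr_ge0//.
    rewrite -[leLHS]ger0_norm ?mulr_ge0 ?sqrtr_ge0 ?exprn_ge0 ?normc_ge0// -sqrtr_sqr.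
    rewrite -[leRHS]ger0_norm ?exprn_ge0 ?invr_ge0// -sqrtr_sqr ler_wsqrtr//.
    rewrite exprMn sqr_sqrtr ?exprn_ge0 ?(ltW k0)// -!exprM [(n * 2)%N]mulnC !exprM -exprMn.
    rewrite lerXn2r ?nnegrE ?mulr_ge0 ?exprn_ge0 ?invr_ge0 ?normc_ge0 ?(ltW k0)//.
    by rewrite (le_trans kw)// expr2 -invfM -natrM.
  pose q := Num.sqrt (C * N); have q0 : (0 <= q)%R := sqrtr_ge0 _.
  have qe0 : (0 <= q / e)%R by rewrite divr_ge0// ltW.
  exists (Num.bound (q / e)) => n nn; apply: (le_trans (err n)); rewrite -/q.
  rewrite exprVn ler_pdivrMr ?exprn_gt0// mulrC -ler_pdivrMr//.
  apply: (@le_trans _ _ n%:R); first by rewrite (le_trans (ltW (archi_boundP qe0)))// ler_nat.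
  by rewrite -natrX ler_nat ltnW// ltn_expl.
move=> n; rewrite /taylor -EFinM.
apply: (@fock2_geometric_sum n (fun j z => w ^+ j / j`!%:R * iter j dc F z)%R N) => // j.
apply: (le_trans (fock2Z hv _ (holo_iter_dc j hF))).
apply: (@le_trans _ _ ((normc w ^+ j ^+ 2)%:E * ((k ^+ j)%:E * N%:E))).
  apply: lee_pmul.
  - by rewrite lee_fin exprn_ge0// normc_ge0.
  - exact: fock2_ge0.
  - by rewrite lee_fin lerXn2r// nnegrE ?normc_ge0// exprn_ge0// normc_ge0.
  - by rewrite -NE; exact: Hk.
rewrite -!EFinM lee_fin mulrA mulrC ler_wpM2l// -!exprM mulnC exprM -exprMn.
by rewrite lerXn2r ?nnegrE ?mulr_ge0 ?exprn_ge0 ?normc_ge0 ?(ltW k0)// mulrC.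
Qed.

End translations.

(** * The growth rate under vertical translations, and the comparison with the Paley-Wiener space *)

Section growth.
Context {R : realType}.
Notation mR := (measurableTypeR R).
Implicit Types F G : R[i] -> R[i].

Context (v : R -> R) (hv : density v) (C0 : R) (C00 : 0 < C0)
  (line_norm : forall F, inH v F -> (fock2 v F <= C0%:E * slice (msq F) 0)%E)
  (sharp_inH : forall F, inH v F -> inH v (sharp F))
  (K : R[i] -> R[i]) (HK : inH v K) (K0 : K 0 != 0).

Let mv : measurable_fun (T := mR) (U := mR) setT v. Proof. by case: hv. Qed.
Let v0 y : 0 <= v y. Proof. by apply: ltW; case: hv. Qed.

Definition vshift (t : R) F : R[i] -> R[i] := fun z => F (z + 0 +i* t).

(* [fine +oo = 0], but all slices of functions in the space are finite, see [sliceE]. *)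
Definition slicef F (y : R) : R := fine (slice (msq F) y).

Lemma slice_vshift t F y : slice (msq (vshift t F)) y = slice (msq F) (y + t).
Proof.
apply: eq_integral => x _; rewrite !msqE /vshift (_ : x +i* y + 0 +i* t = x +i* (y + t))//.
by apply/eqP; rewrite eq_complex /= addr0 !eqxx.
Qed.

Lemma slicef_vshift t F y : slicef (vshift t F) y = slicef F (y + t).
Proof. by rewrite /slicef slice_vshift. Qed.

Lemma slice_sharp F y : slice (msq (sharp F)) y = slice (msq F) (- y).
Proof. by apply: eq_integral => x _; rewrite !msqE /sharp normcJ. Qed.

Lemma slicef_sharp F y : slicef (sharp F) y = slicef F (- y).
Proof. by rewrite /slicef slice_sharp. Qed.

Lemma slicef_ge0 F y : 0 <= slicef F y.
Proof. by rewrite fine_ge0// slice_msq_ge0. Qed.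

Lemma fock2_fin F : inH v F -> exists2 N : R, 0 <= N & fock2 v F = N%:E.
Proof.
case=> hF; have : (0 <= fock2 v F)%E by exact: fock2_ge0.
by case: fock2 => [N| |] //; rewrite lee_fin => N0 _; exists N.
Qed.

Lemma sliceE F y : inH v F -> slice (msq F) y = (slicef F y)%:E.
Proof.
move=> HF; have [hF _] := HF; have [N _ NE] := fock2_fin HF.
have [C C1 HC] := slice_le_fock2 hv `|y|.
have [h _] := HC _ _ hF (lexx _).
by rewrite /slicef fineK// ge0_fin_numE ?slice_msq_ge0// (le_lt_trans h)// NE -EFinM ltry.
Qed.

Lemma vshift_iter (s c : R) : 0 <= c -> (forall F t, inH v F -> `|t| <= s ->
    inH v (vshift t F) /\ (fock2 v (vshift t F) <= c%:E * fock2 v F)%E) ->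
  forall n F t, inH v F -> `|t| <= n%:R * s ->
    inH v (vshift t F) /\ (fock2 v (vshift t F) <= (c ^+ n)%:E * fock2 v F)%E.
Proof.
move=> c0 step; elim=> [|n IH] F t HF tn.
  have -> : t = 0 by apply/eqP; rewrite -normr_le0; move: tn; rewrite mul0r.
  have -> : vshift 0 F = F by apply/funext => z; rewrite /vshift addr0.
  by rewrite mul1e.
have n0 : 0 < n.+1%:R :> R by [].
pose t1 := t / n.+1%:R.
have t1s : `|t1| <= s by rewrite normrM normfV [`|n.+1%:R|]ger0_norm// ler_pdivrMr// mulrC.
have [H1 N1] := step F t1 HF t1s.
have t2n : `|n%:R * t1| <= n%:R * s by rewrite normrM ger0_norm// ler_wpM2l.
have [H2 N2] := IH _ _ H1 t2n.
have E : vshift t F = vshift (n%:R * t1) (vshift t1 F).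
  apply/funext => z; rewrite /vshift -addrA; congr (F (z + _)).
  apply/eqP; rewrite eq_complex /= addr0 eqxx /=; apply/eqP.
  by rewrite /t1 -natr1; field; rewrite natr1.
rewrite E; split=> //; apply: (le_trans N2); rewrite exprSr EFinM -muleA.
by apply: lee_wpmul2l => //; rewrite lee_fin exprn_ge0.
Qed.

Lemma vshift_small : exists2 s : R, 0 < s & forall F t, inH v F -> `|t| <= s ->
    inH v (vshift t F) /\ (fock2 v (vshift t F) <= 4%:E * fock2 v F)%E.
Proof.
have [s s0 Hs] := inH_small_shift hv C00 line_norm.
exists s => // F t HF ts; apply: Hs => //.
by rewrite /= expr0n add0r sqrtr_sqr.
Qed.

Lemma vshift_inH F t : inH v F -> inH v (vshift t F).
Proof.
move=> HF; have [s s0 Hs] := vshift_small.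
have [] // := vshift_iter (ltW (ltr0n R 4)) Hs (n := Num.bound (`|t| / s)) (t := t) HF.
by rewrite -ler_pdivrMr// ltW// archi_boundP// divr_ge0// ltW.
Qed.

(** Move the line at height [y] to the real line and translate by [t] in small steps, passing
    through N: L <= C N at the new height, N grows by at most [4 ^ n], and N <= C0 L at the old
    height. The 1 added to the constant makes its powers monotone. *)
Lemma slicef_local : exists2 B : R, 1 <= B & forall F y t, inH v F -> `|t| <= 1 ->
  slicef F (y + t) <= B * slicef F y.
Proof.
have [s s0 Hs] := vshift_small; pose n := Num.bound s^-1.
have [C C1 HC] := slice_le_fock2 hv 0.
pose b : R := C * (4 ^+ n * C0).
have b0 : 0 <= b by rewrite !mulr_ge0 ?exprn_ge0// ltW.
exists (b + 1); first by rewrite lerDr.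
move=> F y t HF t1.
have HG := vshift_inH y HF; set G := vshift y F in HG.
have [] // := vshift_iter (ltW (ltr0n R 4)) Hs (n := n) (t := t) HG.
  apply: (le_trans t1); rewrite -ler_pdivrMr// mul1r ltW// archi_boundP// invr_ge0 ltW//.
move=> H1 N1; have [h1 _] := H1.
apply: (@le_trans _ _ (b * slicef F y)); last by rewrite ler_wpM2r ?slicef_ge0// lerDl.
have [|h _] := HC (vshift t G) 0 h1; first by rewrite normr0.
have GE : slice (msq G) 0 = (slicef F y)%:E by rewrite slice_vshift add0r sliceE.
rewrite -lee_fin -sliceE// addrC -(slice_vshift y F t).
have -> : slice (msq (vshift y F)) t = slice (msq (vshift t G)) 0 by rewrite [RHS]slice_vshift add0r.
apply: (le_trans h); rewrite EFinM -GE /b EFinM -muleA; apply: lee_wpmul2l; first by rewrite lee_fin ltW.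
apply: (le_trans N1); rewrite EFinM -muleA; apply: lee_wpmul2l; first by rewrite lee_fin exprn_ge0.
exact: line_norm.
Qed.

(** [C] depends on [l] but not on [F]. Upward integer steps are enough: [slicef_local] fills the
    gaps and [sharp] reverses the direction. *)
Definition growth (l : R) := exists2 C : R, 0 <= C & forall F (n : nat), inH v F ->
  slicef F n%:R <= C * expR (2 * l * n%:R) * slicef F 0.

Lemma growthW l l' : l <= l' -> growth l -> growth l'.
Proof.
move=> ll [C C1 HC]; exists C => // F n HF; apply: (le_trans (HC F n HF)).
rewrite ler_wpM2r ?slicef_ge0// ler_wpM2l// ler_expR ler_wpM2r// ler_wpM2l//.
Qed.

Lemma slicef_nat B F n : 1 <= B -> (forall F y t, inH v F -> `|t| <= 1 -> slicef F (y + t) <= B * slicef F y) ->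
  inH v F -> slicef F n%:R <= B ^+ n * slicef F 0.
Proof.
move=> B1 HB HF; elim: n => [|n IH]; first by rewrite mul1r.
rewrite -natr1 (le_trans (HB _ _ _ HF _)) ?normr1// exprS -mulrA ler_wpM2l//.
exact: le_trans B1.
Qed.

Lemma growth_ex : exists l, growth l.
Proof.
have [B B1 HB] := slicef_local; have B0 : 0 < B by exact: lt_le_trans B1.
exists (ln B / 2); exists 1 => // F n HF; rewrite mul1r.
rewrite (_ : 2 * (ln B / 2) * n%:R = n%:R * ln B); last by field.
by rewrite expRM_natl lnK ?posrE//; exact: slicef_nat.
Qed.

Lemma slice_lower F (b c y : R) : holo F -> 0 <= b -> 0 <= c -> (forall x, `|x| <= b -> c <= msq F (x, y)) ->
  ((2 * b * c)%:E <= slice (msq F) y)%E.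
Proof.
move=> hF b0 c0 cF.
have mI : measurable (`[- b, b]%classic : set mR) by exact: measurable_itv.
have mF := measurable_row y (measurable_msq hF).
have F0 x : (0 <= (msq F (x, y))%:E)%E by rewrite lee_fin msq_ge0.
apply: (@le_trans _ _ (\int[leb R]_(x in `[(- b)%R, b]) (msq F (x, y))%:E)%E); last first.
  exact: (@ge0_subset_integral _ _ _ (leb R) _ _ mI measurableT _ mF (fun x _ => F0 x)).
have -> : (2 * b * c)%:E = (\int[leb R]_(x in `[(- b)%R, b]) (c%:E : \bar R))%E.
  rewrite integral_cst//= lebesgue_measure_itv /= lte_fin muleC; case: ifPn => h.
    by rewrite -EFinD -EFinM; congr _%:E; ring.
  by have -> : b = 0; [rewrite -leNgt in h; lra|rewrite mul0e mulr0 mul0r].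
apply: (@ge0_le_integral _ _ _ (leb R) _ mI).
- by move=> x _; rewrite lee_fin.
- exact: measurable_cst.
- exact: measurable_funTS.
- by move=> x; rewrite /= in_itv /= -ler_norml => xb; rewrite lee_fin cF.
Qed.

Lemma slicef_gt0 F : inH v F -> F 0 != 0 -> 0 < slicef F 0.
Proof.
move=> HF F0; have [hF _] := HF.
have c0 : 0 < normc (F 0) / 2 by rewrite divr_gt0// normc_gt0.
have [D D0 HD] := cder_cont (holo_cder 0 hF) c0.
have D2 : 0 <= D / 2 by rewrite divr_ge0// ltW.
apply: (@lt_le_trans _ _ (2 * (D / 2) * (normc (F 0) / 2) ^+ 2)).
  by rewrite mulr_gt0 ?exprn_gt0//; lra.
rewrite -lee_fin -sliceE//; apply: slice_lower => //; first by rewrite exprn_ge0// ltW.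
move=> x xD; rewrite msqE lerXn2r ?nnegrE ?normc_ge0 ?(ltW c0)//.
have xD' : `|x| < D by lra.
have := HD x%:C; rewrite normc_real add0r => /(_ xD').
by have := normcD (F 0 - F x%:C) (F x%:C); rewrite subrK normc_distC; lra.
Qed.

(* Go up by n, then down by n with the sharp involution. *)
Lemma growth_ge0 l : growth l -> 0 <= l.
Proof.
move=> [C C1 HC]; rewrite leNgt; apply/negP => l0.
have k0 := slicef_gt0 HK K0; set k := slicef K 0 in k0.
have H n : 1 <= C ^+ 2 * expR (4 * l * n%:R).
  have h1 := HC _ n (vshift_inH (- n%:R) HK); rewrite !slicef_vshift addrN add0r -/k in h1.
  have h2 := HC _ n (sharp_inH HK); rewrite !slicef_sharp oppr0 -/k in h2.
  rewrite -(ler_pM2r k0) mul1r (le_trans h1)//.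
  rewrite (_ : 4 * l * n%:R = 2 * l * n%:R + 2 * l * n%:R); last by ring.
  rewrite expRD (_ : C ^+ 2 * _ * k = C * expR (2 * l * n%:R) * (C * expR (2 * l * n%:R) * k)); last by ring.
  by rewrite ler_wpM2l// mulr_ge0// expR_ge0.
have l4 : 0 < - (4 * l) by lra.
pose n := Num.bound (C ^+ 2 / (- (4 * l))).
have nb : C ^+ 2 < n%:R * - (4 * l).
  by rewrite -ltr_pdivrMr// archi_boundP// divr_ge0 ?sqr_ge0// ltW.
have := H n; have := expR_ge1Dx (- (4 * l * n%:R)); rewrite expRN => e1.
have E0 := expR_gt0 (4 * l * n%:R); rewrite -ler_pdivrMr// => h.
have : (expR (4 * l * n%:R))^-1 <= C ^+ 2 by rewrite -[leLHS]mul1r.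
lra.
Qed.

Definition growth_rate : R := inf [set l | growth l].

Lemma growth_rate_ge0 : 0 <= growth_rate.
Proof.
by apply: lb_le_inf; [exact: growth_ex|move=> l; exact: growth_ge0].
Qed.

Lemma growth_above l : growth_rate < l -> growth l.
Proof.
move=> rl.
have hi : has_inf [set l | growth l] by split; [exact: growth_ex|exists 0 => l'; exact: growth_ge0].
have [|l' gl' l'l] := inf_adherent (eps := l - growth_rate) _ hi; first by rewrite subr_gt0.
by apply: growthW gl'; rewrite ltW// (lt_le_trans l'l)// subrKC.
Qed.

Lemma growth_below l : growth l -> growth_rate <= l.
Proof. by move=> gl; apply: ge_inf => //; exists 0 => l'; exact: growth_ge0. Qed.

Lemma slicef_growth l : growth_rate < l -> exists2 C : R, 0 <= C & forall F y, inH v F ->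
  slicef F y <= C * expR (2 * l * `|y|) * slicef F 0.
Proof.
move=> rl; have l0 : 0 <= l := le_trans growth_rate_ge0 (ltW rl).
have [C C1 HC] := growth_above rl; have [B B1 HB] := slicef_local.
have B0 : 0 <= B by exact: le_trans B1.
exists (B * C); first exact: mulr_ge0.
have pos F y : inH v F -> 0 <= y -> slicef F y <= B * C * expR (2 * l * y) * slicef F 0.
  move=> HF y0; pose n := Num.truncn y.
  have /andP[n1 n2] := truncn_itv y0.
  have := HB F n%:R (y - n%:R) HF _; rewrite subrKC => h.
  rewrite (le_trans (h _))//.
    rewrite ger0_norm ?subr_ge0// lerBlDl ltW//.
    by rewrite -natr1 in n2.
  rewrite -!mulrA ler_wpM2l// mulrA (le_trans (HC F n HF))// ler_wpM2r ?slicef_ge0// ler_wpM2l//.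
  by rewrite ler_expR mulrA ler_wpM2l// mulr_ge0.
move=> F y HF; have [y0|y0] := leP 0 y; first by rewrite ger0_norm//; exact: pos.
rewrite ltr0_norm// -[in leLHS](opprK y) -slicef_sharp.
have -> : slicef F 0 = slicef (sharp F) 0 by rewrite slicef_sharp oppr0.
by apply: pos; [exact: sharp_inH|rewrite oppr_ge0 ltW].
Qed.

(* Otherwise each G grows slowly at some step j <= J, and repeating the argument for the
   translate of G by ij makes l a growth rate. *)
Lemma extremal_growth l (J : nat) : l < growth_rate -> exists2 G, inH v G & 0 < slicef G 0 /\
  forall j, (j <= J)%N -> expR (2 * l * j%:R) * slicef G 0 <= slicef G j%:R.
Proof.
move=> lr; apply: contrapT => nG.
have HG G : inH v G -> 0 < slicef G 0 -> exists2 j, (0 < j <= J)%N &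
    slicef G j%:R <= expR (2 * l * j%:R) * slicef G 0.
  move=> HG G0; apply: contrapT => nj; apply: nG; exists G => //; split=> // j jJ.
  case: (posnP j) => [->|j0]; first by rewrite mulr0 expR0 mul1r.
  rewrite leNgt; apply/negP => h; apply: nj; exists j; [by rewrite j0|exact: ltW].
have [B B1 HB] := slicef_local; have B0 : 0 <= B by exact: le_trans B1.
have BJ : 0 <= B ^+ J by exact: exprn_ge0.
suff gl : growth l by have := growth_below gl; rewrite leNgt lr.
(* [B ^ J] covers a final stretch of at most [J] steps; the exponential compensates
   [exp (2 l n) < 1] when [l] is negative. *)
exists (B ^+ J * expR (2 * `|l| * J%:R)); first by rewrite mulr_ge0// expR_ge0.
move=> F n; elim/ltn_ind: n F => n IH F HF.
have [F0|F0] := lerP (slicef F 0) 0.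
  have e0 : slicef F 0 = 0 by apply/eqP; rewrite eq_le F0 slicef_ge0.
  by rewrite e0 mulr0; have := slicef_nat n B1 HB HF; rewrite e0 mulr0.
have [nJ|Jn] := leqP n J.
  apply: (le_trans (slicef_nat n B1 HB HF)); rewrite ler_wpM2r ?slicef_ge0// -mulrA.
  rewrite -[leLHS]mulr1 ler_pM ?exprn_ge0//; first by rewrite ler_weXn2l.
  rewrite -expRD -[leLHS]expR0 ler_expR.
  have : - (`|l| * n%:R) <= l * n%:R by rewrite -mulNr ler_wpM2r// lerNl -normrN ler_norm.
  have : `|l| * n%:R <= `|l| * J%:R by rewrite ler_wpM2l// ler_nat.
  by rewrite -!mulrA; lra.
have [j /andP[j0 jJ] hj] := HG F HF F0.
have jn : (j <= n)%N by rewrite (leq_trans jJ)// ltnW.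
have := IH (n - j)%N _ _ (vshift_inH j%:R HF); rewrite !slicef_vshift add0r -natrD subnK// => h.
apply: (le_trans (h _)); first by rewrite ltn_subrL j0 (leq_trans j0).
rewrite -!mulrA ler_wpM2l// ler_wpM2l ?expR_ge0//.
apply: (@le_trans _ _ (expR (2 * (l * (n - j)%:R)) * (expR (2 * l * j%:R) * slicef F 0))).
  by rewrite ler_wpM2l ?expR_ge0.
rewrite mulrA -expRD natrB// (_ : 2 * (l * (n%:R - j%:R)) + 2 * l * j%:R = 2 * (l * n%:R))//; ring.
Qed.

Lemma measurable_exp_weight l :
  measurable_fun (T := mR) setT (fun y => (v y * expR (2 * l * `|y|))%:E).
Proof.
apply: measurable_fin; apply: measurable_funM => //; apply: continuous_measurable_fun => y.
apply: continuous_comp; last exact: continuous_expR.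
by apply: cvgM; [exact: cvg_cst|exact: norm_continuous].
Qed.

(** For an extremal G, L(G) times the integral is at most a constant times N(G) + N([sharp] G),
    hence at most a constant times L(G), which cancels. As [v] need not be even, [sharp G] supplies
    the growth for negative [y]. The bound does not depend on [J]. *)
Lemma extremal_weight_bound : exists2 M : R, 0 <= M & forall (l : R) (J : nat), l < growth_rate ->
  (\int[leb R]_(y in `[(- J%:R)%R, J%:R]) (v y * expR (2 * l * `|y|))%:E <= (M * expR (2 * `|l|))%:E)%E.
Proof.
have [B B1 HB] := slicef_local; have B0 : 0 <= B by exact: le_trans B1.
exists (B * (2 * C0)); first by rewrite !mulr_ge0// ltW.
move=> l J lr; have [G HG [G0 hG]] := extremal_growth J lr.
have HGs := sharp_inH HG.
(* [|y|] is rounded down to an integer: [exp (2 |l|)] pays for this in the exponential, [B] in the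
   slices. *)
have pt y : `|y| <= J%:R -> expR (2 * l * `|y|) * slicef G 0 <= B * expR (2 * `|l|) * (slicef G y + slicef (sharp G) y).
  move=> yJ; set s := `|y|; have s0 : 0 <= s := normr_ge0 y.
  pose n := Num.truncn s; have /andP[n1 n2] := truncn_itv s0.
  have nJ : (n <= J)%N by rewrite -(ler_nat R) (le_trans n1).
  have sE : slicef G s <= slicef G y + slicef (sharp G) y.
    rewrite slicef_sharp /s; case: (leP 0 y) => y0; first by rewrite ger0_norm// lerDl slicef_ge0.
    by rewrite ltr0_norm// lerDr slicef_ge0.
  apply: (@le_trans _ _ (B * expR (2 * `|l|) * slicef G s)); last first.
    by rewrite ler_wpM2l// mulr_ge0// expR_ge0.
  have h1 : slicef G n%:R <= B * slicef G s.
    have := HB G s (n%:R - s) HG; rewrite subrKC; apply.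
    by rewrite ler_norml -natr1 in n2 *; lra.
  apply: (@le_trans _ _ (expR (2 * `|l|) * (expR (2 * l * n%:R) * slicef G 0))).
    rewrite mulrA -expRD ler_wpM2r ?slicef_ge0// ler_expR.
    have : l * (s - n%:R) <= `|l|.
      rewrite (le_trans (ler_norm _))// normrM ler_piMr// ger0_norm ?subr_ge0// lerBlDl ltW//.
      by rewrite -natr1 in n2.
    by rewrite mulrBr; lra.
  rewrite [leRHS](_ : _ = expR (2 * `|l|) * (B * slicef G s)); last by ring.
  apply: ler_wpM2l; first exact: expR_ge0.
  exact: le_trans (hG n nJ) h1.
have mI : measurable (`[- J%:R, J%:R]%classic : set mR) by exact: measurable_itv.
have mG : measurable_fun (T := mR) setT (fun y => ((v y)%:E * slice (msq G) y)%E).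
  by case: HG => h _; exact: measurable_fock2_integrand.
have mGs : measurable_fun (T := mR) setT (fun y => ((v y)%:E * slice (msq (sharp G)) y)%E).
  by case: HGs => h _; exact: measurable_fock2_integrand.
rewrite -(@lee_pmul2r _ (slicef G 0)%:E)// ?lte_fin// muleC.
have me := measurable_exp_weight l.
rewrite -(ge0_integralZl (leb R) mI (measurable_funTS me)); last 2 first.
- by move=> y _; rewrite lee_fin mulr_ge0// expR_ge0.
- by rewrite lee_fin ltW.
pose c : R := B * expR (2 * `|l|).
have c0 : 0 <= c by rewrite mulr_ge0// expR_ge0.
pose h y := (c%:E * ((v y)%:E * slice (msq G) y + (v y)%:E * slice (msq (sharp G)) y))%E.
have vs0 H y : (0 <= (v y)%:E * slice (msq H) y)%E by rewrite mule_ge0 ?lee_fin// slice_msq_ge0.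
have h0 y : (0 <= h y)%E by rewrite mule_ge0 ?lee_fin// adde_ge0.
have mh : measurable_fun (T := mR) setT h by apply: emeasurable_funM => //; exact: emeasurable_funD.
apply: (@le_trans _ _ (\int[leb R]_y h y)%E).
  apply: (@le_trans _ _ (\int[leb R]_(y in `[(- J%:R)%R, J%:R]) h y)%E); last first.
    exact: (@ge0_subset_integral _ _ _ (leb R) _ _ mI measurableT _ mh (fun y _ => h0 y)).
  apply: (@ge0_le_integral _ _ _ (leb R) _ mI).
  - by move=> y _; rewrite -EFinM lee_fin !mulr_ge0 ?expR_ge0// ltW.
  - by apply: measurable_funTS; exact: emeasurable_funM.
  - exact: measurable_funTS.
  - move=> y; rewrite /= in_itv /= -ler_norml => yJ.
    rewrite /h (sliceE y HG) (sliceE y HGs) -EFinM.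
    rewrite -[leRHS]/((c * (v y * slicef G y + v y * slicef (sharp G) y))%:E).
    rewrite lee_fin -mulrDr mulrCA [leRHS]mulrCA.
    by rewrite ler_wpM2l// mulrC pt.
have Nle H : inH v H -> (fock2 v H <= C0%:E * (slicef H 0)%:E)%E.
  by move=> HH; rewrite -(sliceE 0 HH); exact: line_norm.
have vD := emeasurable_funD mG mGs.
rewrite (ge0_integralZl (leb R) measurableT vD); last 2 first.
- by move=> y _; rewrite adde_ge0.
- by rewrite lee_fin.
rewrite (ge0_integralD (leb R) measurableT (fun y _ => vs0 G y) mG (fun y _ => vs0 (sharp G) y) mGs).
apply: (@le_trans _ _ (c%:E * (C0%:E * (slicef G 0)%:E + C0%:E * (slicef (sharp G) 0)%:E))%E).
  by apply: lee_wpmul2l; [rewrite lee_fin|apply: leeD; exact: Nle].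
rewrite slicef_sharp oppr0 -[leLHS]/((c * (C0 * slicef G 0 + C0 * slicef G 0))%:E) -EFinM.
by rewrite lee_fin /c le_eqVlt; apply/orP; left; apply/eqP; ring.
Qed.

(** On [[-J, J]] the rate [l = r - 1 / J.+1] differs from [r] by at most a factor [exp 2] in the
    integrand, so the bounds for [l < r] carry over to [r] itself, uniformly in [J]. *)
Lemma weight_integral : exists2 M : R, 0 <= M &
  (\int[leb R]_y (v y * expR (2 * growth_rate * `|y|))%:E <= M%:E)%E.
Proof.
have [M M0 HM] := extremal_weight_bound; set r := growth_rate; have r0 : 0 <= r := growth_rate_ge0.
have pos l y : (0 <= (v y * expR (2 * l * `|y|))%:E)%E by rewrite lee_fin mulr_ge0// expR_ge0.
exists (expR 2 * (M * expR (2 * (r + 1)))); first by rewrite !mulr_ge0// expR_ge0.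
apply: integral_le_centered => //; first exact: measurable_exp_weight.
move=> J; have J0 : 0 < J.+1%:R :> R by [].
pose l := r - J.+1%:R^-1; have J1 : 0 < J.+1%:R^-1 :> R by rewrite invr_gt0.
have lr : l < r by rewrite /l ltrBlDr ltrDl.
have nl : `|l| <= r + 1.
  have : J.+1%:R^-1 <= 1 :> R by rewrite invf_le1// ler1n.
  by rewrite ler_norml /l; move: (J.+1%:R^-1) J1 => k k0 k1; lra.
have mI : measurable (`[- J%:R, J%:R]%classic : set mR) by exact: measurable_itv.
have ml := measurable_exp_weight l.
apply: (@le_trans _ _ (\int[leb R]_(y in `[(- J%:R)%R, J%:R]) ((expR 2)%:E * (v y * expR (2 * l * `|y|))%:E))%E).
  apply: (@ge0_le_integral _ _ _ (leb R) _ mI) => //.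
  - by apply: measurable_funTS; exact: measurable_exp_weight.
  - by apply: measurable_funTS; exact: emeasurable_funM.
  - move=> y; rewrite /= in_itv /= -ler_norml => yJ.
    rewrite -EFinM lee_fin mulrCA ler_wpM2l// -expRD ler_expR.
    have : J.+1%:R^-1 * `|y| <= 1.
      by rewrite mulrC ler_pdivrMr// mul1r (le_trans yJ)// ler_nat.
    by rewrite /l -/r; set k := _^-1; rewrite mulrBr mulrBl -!mulrA; lra.
rewrite (ge0_integralZl (leb R) mI (measurable_funTS ml)); [|by move=> y _; exact: pos|by rewrite lee_fin expR_ge0].
rewrite EFinM; apply: lee_wpmul2l; first by rewrite lee_fin expR_ge0.
apply: (le_trans (HM l J lr)); rewrite lee_fin ler_wpM2l// ler_expR ler_wpM2l//.
Qed.

Lemma inH_exp_type F : inH v F -> exp_type_le growth_rate F.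
Proof.
move=> HF e e0; set r := growth_rate; have r0 : 0 <= r := growth_rate_ge0.
have [hF _] := HF; pose l := r + e; have rl : r < l by rewrite ltrDl.
have [C C1 HC] := slicef_growth rl; pose m := slicef F 0; have m0 : 0 <= m := slicef_ge0 F 0.
have l0 : 0 <= l by rewrite addr_ge0// ltW.
(* 8 is the 2 of the mean value inequality times the height 4 of the strip, which reaches up to
   [|y| + 2]; hence [exp (4 l)]. *)
pose D := 8 * C * expR (4 * l) * m.
have D0 : 0 <= D by rewrite !mulr_ge0// expR_ge0.
exists (Num.sqrt D) => -[x y]; pose s := normc (x +i* y); rewrite -/s.
have s0 : 0 <= s := normc_ge0 _.
have ys : `|y| <= s by exact: (normc_Im (x +i* y)).
have H : msq F (x, y) <= 2 * (4 * (C * expR (2 * l * (`|y| + 2)) * m)).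
  rewrite -lee_fin [leRHS]EFinM; apply: (le_trans (point_le_strip x y hF)).
  apply: lee_wpmul2l; first by rewrite lee_fin.
  set c := C * _ * m; have mI : measurable (`[y - 2, y + 2]%classic : set mR) by exact: measurable_itv.
  apply: (@le_trans _ _ (\int[leb R]_(w in `[(y - 2)%R, (y + 2)%R]) (c%:E : \bar R))%E).
    apply: (@ge0_le_integral _ _ _ (leb R) _ mI).
    - by move=> w _; exact: slice_msq_ge0.
    - by apply: measurable_funTS; apply: measurable_slice; [exact: measurable_msq|exact: msq_ge0].
    - exact: measurable_cst.
    - move=> w; rewrite /= in_itv /= => wy; rewrite (sliceE w HF) lee_fin.
      apply: (le_trans (HC F w HF)); rewrite ler_wpM2r// ler_wpM2l// ler_expR ler_wpM2l ?mulr_ge0//.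
      have : `|w - y| <= 2 by rewrite ler_norml; lra.
      by have := ler_normD (w - y) y; rewrite subrK; lra.
  rewrite integral_cst//= lebesgue_measure_itv /= lte_fin ifT; last by lra.
  by rewrite -EFinD -EFinM lee_fin le_eqVlt; apply/orP; left; apply/eqP; ring.
rewrite -(ler_pXn2r (n := 2))// ?nnegrE ?normc_ge0 ?mulr_ge0 ?sqrtr_ge0 ?expR_ge0//.
rewrite exprMn sqr_sqrtr// -expRM_natl.
rewrite msqE in H; apply: (le_trans H).
rewrite (_ : 2 * (4 * _) = 8 * C * m * expR (2 * l * (`|y| + 2))); last by ring.
rewrite (_ : D * _ = 8 * C * m * (expR (4 * l) * expR (2%:R * ((r + e) * s)))); last by rewrite /D; ring.
rewrite ler_wpM2l ?mulr_ge0// -expRD ler_expR -/l.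
have : l * `|y| <= l * s by rewrite ler_wpM2l.
by lra.
Qed.

Lemma inH_of_paley_wiener F : holo F -> exp_type_le growth_rate F -> (slice (msq F) 0 < +oo)%E -> inH v F.
Proof.
move=> hF Fr Lfin; split=> //; have [M M0 HM] := weight_integral.
have r0 := growth_rate_ge0; set r := growth_rate in r0 HM Fr.
have mexp := measurable_exp_weight r.
have L0 := slice_msq_ge0 F 0; set L := slice (msq F) 0 in L0 Lfin.
apply: (@le_lt_trans _ _ (\int[leb R]_y ((4%:E * L) * (v y * expR (2 * r * `|y|))%:E))%E).
  apply: (@ge0_le_integral _ _ _ (leb R) _ measurableT).
  - by move=> y _; rewrite mule_ge0 ?lee_fin// slice_msq_ge0.
  - exact: measurable_fock2_integrand.
  - exact: emeasurable_funM.
  - move=> y _; have := plancherel_polya y hF r0 Fr Lfin => h.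
    apply: (@le_trans _ _ ((v y)%:E * ((4 * expR (2 * r * `|y|))%:E * L))%E).
      by apply: lee_wpmul2l; [rewrite lee_fin|exact: h].
    rewrite muleA [leRHS]muleAC -!EFinM; apply: lee_wpmul2r => //.
    by rewrite lee_fin le_eqVlt; apply/orP; left; apply/eqP; ring.
have l4 : (0 <= 4%:E * L)%E by rewrite mule_ge0// lee_fin.
rewrite (ge0_integralZl (leb R) measurableT mexp)//; last first.
  by move=> y _; rewrite lee_fin mulr_ge0// expR_ge0.
apply: (@le_lt_trans _ _ (4%:E * L * M%:E)%E); first exact: lee_wpmul2l.
by move: L0 Lfin; case: L {l4} => [l| |] // _ _; rewrite -!EFinM ltry.
Qed.

(** At rate 0 the Plancherel-Polya inequality bounds all slices of [K] uniformly, hence [K] itself.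
    By Liouville [K] would be a nonzero constant, which is not square integrable on the line. *)
Lemma growth_rate_gt0 : 0 < growth_rate.
Proof.
have r0 := growth_rate_ge0; rewrite lt_neqAle r0 andbT eq_sym; apply/eqP => re.
have [hK _] := HK; have KT := inH_exp_type HK; rewrite re in KT.
have LE := sliceE 0 HK; have m0 := slicef_ge0 K 0; set m := slicef K 0 in LE m0.
have Lfin : (slice (msq K) 0 < +oo)%E by rewrite LE ltry.
have slb y : (slice (msq K) y <= (4 * m)%:E)%E.
  have := plancherel_polya y hK (lexx 0) KT Lfin.
  by rewrite mulr0 mul0r expR0 mulr1 LE -EFinM.
have bK z : normc (K z) <= Num.sqrt (32 * m).
  rewrite -[leLHS]ger0_norm ?normc_ge0// -sqrtr_sqr ler_wsqrtr//.
  case: z => x y; rewrite -msqE -lee_fin; apply: (le_trans (point_le_strip x y hK)).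
  have mI : measurable (`[y - 2, y + 2]%classic : set mR) by exact: measurable_itv.
  rewrite (_ : 32 * m = 2 * (4 * (4 * m))); last by ring.
  rewrite [leRHS]EFinM; apply: lee_wpmul2l; first by rewrite lee_fin.
  apply: (@le_trans _ _ (\int[leb R]_(w in `[(y - 2)%R, (y + 2)%R]) ((4 * m)%:E : \bar R))%E).
    apply: (@ge0_le_integral _ _ _ (leb R) _ mI).
    - by move=> w _; exact: slice_msq_ge0.
    - by apply: measurable_funTS; apply: measurable_slice; [exact: measurable_msq|exact: msq_ge0].
    - exact: measurable_cst.
    - by [].
  rewrite integral_cst//= lebesgue_measure_itv /= lte_fin ifT; last by lra.
  by rewrite -EFinD -EFinM lee_fin le_eqVlt; apply/orP; left; apply/eqP; ring.
have dK0 z : normc (dc K z) = 0.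
  apply/eqP; rewrite eq_le normc_ge0 andbT; apply/ler_addgt0Pr => e e0; rewrite add0r.
  set b := Num.sqrt _ in bK; have b0 : 0 <= b := sqrtr_ge0 _.
  have r1 : 0 < 20 * b / e + 1 by rewrite ltr_wpDl// divr_ge0 ?mulr_ge0// ltW.
  apply: (le_trans (cauchy_estimate hK r1 (fun w _ => bK w))).
  rewrite ler_pdivrMr// mulrDr mulr1 (_ : e * (20 * b / e) = 20 * b); last by field; rewrite gt_eqF.
  by rewrite lerDl ltW.
have Kc x : K x%:C = K 0.
  have h : normc (K (0 + x%:C) - K 0) <= 0 * normc x%:C by apply: cmvt => // t _; rewrite dK0.
  rewrite add0r mul0r in h; apply/eqP; rewrite -subr_eq0; apply/eqP/Normc.eq0_normc.
  by apply/eqP; rewrite eq_le h normc_ge0.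
have n0 : 0 < normc (K 0) ^+ 2 by rewrite exprn_gt0// normc_gt0.
(* The interval of half-length [b] alone would contribute [2 m], twice the integral over the whole
   line. *)
pose b := m / normc (K 0) ^+ 2.
have b0 : 0 <= b by rewrite divr_ge0// ltW.
have mgt0 : 0 < m by exact: slicef_gt0.
have h : ((2 * b * normc (K 0%R) ^+ 2)%:E <= slice (msq K) 0)%E.
  apply: slice_lower => //; first exact: ltW.
  by move=> x _; rewrite msqE -[x +i* 0]/(x%:C) Kc.
have := h; rewrite LE lee_fin /b -mulrA divfK ?gt_eqF//; lra.
Qed.

End growth.

(** * Averages over horizontal translations *)

Section averaging.
Context {R : realType}.
Notation mR := (measurableTypeR R).
Local Open Scope ereal_scope.

(** Substitute [t = x + u] and exchange the integrals: the average becomes the integral of [p t]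
    times the mass of [q] in the window of half-width [d] around [t]. It is applied with [p] the
    squared modulus of F on the line and [q] that of 1/E. *)
Lemma averaging (p q : R -> R) (d C : R) : measurable_fun (T := mR) (U := mR) setT p ->
  measurable_fun (T := mR) (U := mR) setT q -> (forall x, 0 <= p x)%R -> (forall x, 0 <= q x)%R -> (0 <= C)%R ->
  (forall t, \int[leb R]_x (ind (- d) d (t - x) * q x)%:E <= C%:E) ->
  measurable_fun (T := mR) setT (fun u => (ind (- d) d u)%:E * \int[leb R]_x (p (x + u) * q x)%:E) /\
  \int[leb R]_u ((ind (- d) d u)%:E * \int[leb R]_x (p (x + u) * q x)%:E) <= C%:E * \int[leb R]_x (p x)%:E.
Proof.
move=> mp mq p0 q0 C0 HC; have mi := measurable_ind (- d) d.
pose G (x : mR * mR) : \bar R := (ind (- d) d x.1 * (p x.2 * q (x.2 - x.1)))%:E.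
have mG : measurable_fun setT G.
  apply: measurable_fin; apply: measurable_funM; first exact: (measurableT_comp mi measurable_fst).
  apply: measurable_funM; first exact: (measurableT_comp mp measurable_snd).
  by apply: (measurableT_comp mq); apply: measurable_funB; [exact: measurable_snd|exact: measurable_fst].
have G0 x : 0 <= G x by rewrite lee_fin; apply: mulr_ge0; [exact: ind_ge0|exact: mulr_ge0].
have [mI _ GE] := tonelli (leb R) (leb R) mG G0.
have mGy : measurable_fun (T := mR) setT (fun t => \int[leb R]_u G (u, t)).
  exact: (measurable_fun_fubini_tonelli_G (m1 := leb R) G).
have iG0 t : 0 <= \int[leb R]_u G (u, t) by exact: integral_ge0.
have GyE t : \int[leb R]_u G (u, t) = \int[leb R]_u (ind (- d) d u * (p t * q (t - u)))%:E by [].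
have GuE u : \int[leb R]_t G (u, t) = \int[leb R]_t (ind (- d) d u * (p t * q (t - u)))%:E by [].
move: G {mG G0} mI GE mGy iG0 GyE GuE => G mI GE mGy iG0 GyE GuE.
have inner u : \int[leb R]_t G (u, t) = (ind (- d) d u)%:E * \int[leb R]_x (p (x + u) * q x)%:E.
  have mfu : measurable_fun (T := mR) setT (fun t => (p t * q (t - u))%:E).
    apply: measurable_fin; apply: measurable_funM; first exact: mp.
    exact: (measurableT_comp mq (leb_preserving_shift (- u)%R).1).
  have f0 t : 0 <= (p t * q (t - u))%:E by rewrite lee_fin mulr_ge0.
  rewrite GuE; under eq_integral do rewrite EFinM.
  rewrite (ge0_integralZl (leb R) measurableT mfu); [|by move=> t _; exact: f0|by rewrite lee_fin ind_ge0].
  congr (_ * _); rewrite -(integral_shift u mfu f0); apply: eq_integral => x _.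
  by rewrite addrK.
under [X in measurable_fun _ X]eq_fun do rewrite -inner.
under eq_integral do rewrite -inner.
split; first exact: mI.
have mpE := measurable_fin mp.
rewrite GE -(ge0_integralZl (leb R) measurableT mpE); last 2 first.
- by move=> t _; rewrite lee_fin.
- by rewrite lee_fin.
apply: (@ge0_le_integral _ _ _ (leb R) _ measurableT).
- by move=> t _; exact: iG0.
- exact: mGy.
- by apply: emeasurable_funM; [exact: measurable_cst|exact: mpE].
move=> t _.
have mk : measurable_fun (T := mR) setT (fun u => (ind (- d) d u * q (t - u))%:E).
  apply: measurable_fin; apply: measurable_funM; first exact: mi.
  exact: (measurableT_comp mq (leb_preserving_reflect t).1).
have k0 u : 0 <= (ind (- d) d u * q (t - u))%:E by rewrite lee_fin mulr_ge0// ind_ge0.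
rewrite GyE; under eq_integral do rewrite mulrCA EFinM.
rewrite (ge0_integralZl (leb R) measurableT mk); [|by move=> u _; exact: k0|by rewrite lee_fin].
rewrite muleC; apply: lee_wpmul2r; first by rewrite lee_fin.
rewrite (integral_leb_preserving (leb_preserving_reflect t) measurableT mk k0) preimage_setT.
by under eq_integral do rewrite subKr.
Qed.

End averaging.

(** * The de Branges space: its reproducing kernel and its line weight *)

Section hardy.
Context {R : realType}.
Notation mR := (measurableTypeR R).

(** A majorant that is integrable in [x] and independent of [y] suffices for the kernel, whose
    quotient by [E] decays like [1 / |x|]. *)
Lemma hardy2_decay (f : R[i] -> R[i]) (C : R) : 0 <= C ->
  (forall z, 0 < complex.Im z -> exists k, cder f z k) ->
  (forall x y : R, 0 < y -> normc (f (x +i* y)) ^+ 2 <= C * (oneDsqr x)^-1) -> hardy2 f.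
Proof.
move=> C0 df fC; split; first by move=> z z0; apply/cdifferentiableP; exact: df.
apply: (@le_lt_trans _ _ (C * pi)%:E); last exact: ltry.
have mi : measurable_fun (T := mR) setT (fun x : R => ((oneDsqr x)^-1)%:E).
  by apply: measurable_fin; apply: continuous_measurable_fun; exact: continuous_oneDsqrV.
apply: ge_ereal_sup => _ [y /= y0 <-].
rewrite EFinM -integral_oneDsqrV -(ge0_integralZl (leb R) measurableT mi); last 2 first.
- by move=> x _; rewrite lee_fin invr_ge0 ltW// oneDsqr_gt0.
- by rewrite lee_fin.
apply: (@ge0_le_integral _ _ _ (leb R) _ measurableT).
- by move=> x _; rewrite lee_fin exprn_ge0// normc_ge0.
- apply: measurable_fin.
  have fc t : ccont (fun t => f (t +i* y)) t t.
    apply: ccont_comp; first by move=> u _; exact: df.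
    apply: (@ccont_ext _ (fun u => 0 +i* y + u%:C * 1)) => [u|]; last exact: ccont_segment.
    by apply/eqP; rewrite eq_complex /= !(mulr1, mulr0, mul0r, subr0, addr0, add0r, oppr0) !eqxx.
  have tt (t : R) : t <= t <= t by rewrite lexx.
  rewrite (_ : (fun x => _) = (fun x => complex.Re (f (x +i* y)) ^+ 2 + complex.Im (f (x +i* y)) ^+ 2)); last first.
    by apply/funext => x; rewrite sqr_normcE.
  apply: measurable_funD; apply: measurable_funX; apply: continuous_measurable_fun => t.
    exact: ccont_Re (fc t) t (tt t).
  exact: ccont_Im (fc t) t (tt t).
- exact: emeasurable_funM.
- by move=> x _; rewrite -EFinM lee_fin; exact: fC.
Qed.

(** Bisection again stands in for compactness: take the minimum of four bounds after a bisection,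
    and use continuity locally. *)
Lemma nonvanishing_rectangle (E : R[i] -> R[i]) a b c d : a <= b -> c <= d -> holo E ->
  (forall x y, a <= x <= b -> c <= y <= d -> E (x +i* y) != 0) ->
  exists2 m : R, 0 < m & forall x y, a <= x <= b -> c <= y <= d -> m <= normc (E (x +i* y)).
Proof.
move=> ab cd hE E0.
pose P a b c d := exists2 m : R, 0 < m & forall x y, a <= x <= b -> c <= y <= d -> m <= normc (E (x +i* y)).
apply: (@rectangle_induction _ P) => //.
  move=> {E0 ab cd}a {}b {}c {}d ab cd [m1 m10 H1] [m2 m20 H2] [m3 m30 H3] [m4 m40 H4].
  exists (Num.min (Num.min m1 m2) (Num.min m3 m4)); first by rewrite !lt_min m10 m20 m30.
  move=> x y /andP[x1 x2] /andP[y1 y2]; rewrite !ge_min.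
  case: (leP x ((a + b) / 2)) => x3; case: (leP y ((c + d) / 2)) => y3.
  - by rewrite H1 ?x1 ?y1.
  - by rewrite H3 ?x1 ?y2 ?(ltW y3)// ?orbT.
  - by rewrite H2 ?x2 ?y1 ?(ltW x3)// ?orbT.
  - by rewrite H4 ?x2 ?y2 ?(ltW x3) ?(ltW y3)// ?orbT.
move=> x y xab ycd; set z := x +i* y; have z0 : 0 < normc (E z) / 2.
  by rewrite divr_gt0//; apply: normc_gt0; exact: E0.
have [D D0 HD] := cder_cont (holo_cder z hE) z0.
exists (D / 2); first by rewrite divr_gt0.
move=> a' b' c' d' _ ax xb _ _ cy yd _ ba dc'; exists (normc (E z) / 2) => // x' y' /andP[x1 x2] /andP[y1 y2].
have h : normc ((x' - x) +i* (y' - y)) < D.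
  have hx : `|x' - x| <= b' - a' by rewrite ler_norml; lra.
  have hy : `|y' - y| <= d' - c' by rewrite ler_norml; lra.
  by apply: (le_lt_trans (normc_le_ReIm _)) => /=; lra.
have := HD _ h; rewrite (_ : z + _ = x' +i* y'); last first.
  by apply/eqP; rewrite eq_complex /= !subrKC !eqxx.
by have := normcD (E z - E (x' +i* y')) (E (x' +i* y')); rewrite subrK normc_distC; lra.
Qed.

Context (E : R[i] -> R[i]) (hE : hermite_biehler E) (E_real_neq0 : forall x : R, E x%:C != 0).

Lemma holo_hermite_biehler : holo E.
Proof. by apply/entireP; case: hE. Qed.

Lemma hermite_biehler_lt z : 0 < complex.Im z -> normc (sharp E z) < normc (E z).
Proof. by move=> z0; have [_ /(_ z z0)] := hE; rewrite !normcE ltc_real. Qed.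

Lemma hermite_biehler_neq0 z : 0 < complex.Im z -> E z != 0.
Proof.
move=> /hermite_biehler_lt h; apply/eqP => e; move: h; rewrite e Normc.normc0.
by rewrite ltNge normc_ge0.
Qed.

Lemma sharp_sharp (F : R[i] -> R[i]) : sharp (sharp F) = F.
Proof. by apply/funext => z; rewrite /sharp !conjcK. Qed.

Lemma normc_sharp_real (F : R[i] -> R[i]) (x : R) : normc (sharp F x%:C) = normc (F x%:C).
Proof. by rewrite /sharp normcJ conjc_real. Qed.

Lemma sharp_de_branges F : de_branges E F -> de_branges E (sharp F).
Proof.
case=> /entireP hF h1 h2; split=> //; first by apply/entireP; exact: holo_sharp.
by rewrite sharp_sharp.
Qed.

Lemma cder_div (F : R[i] -> R[i]) z : holo F -> 0 < complex.Im z -> exists k, cder (fun z => F z / E z) z k.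
Proof.
move=> hF z0; eexists; apply: cderM; first exact: holo_cder.
exact: (cder_comp (holo_cder z holo_hermite_biehler) (cderV (hermite_biehler_neq0 z0))).
Qed.

(* The reproducing kernel of H(E) at the point i, up to a constant factor. *)
Lemma de_branges_kernel : exists2 K, de_branges E K & forall x : R, K x%:C != 0.
Proof.
have hEh := holo_hermite_biehler; have hEs := holo_sharp hEh.
pose i : R[i] := 0 +i* 1.
(* The numerator of the kernel at [i]. It vanishes at [- i], where each product equals [E (- i)]
   times the conjugate of [E i]. *)
pose A z := E z * conjc (E i) - sharp E z * conjc (sharp E i).
have hA : holo A by apply: holoB; apply: holoM => //; exact: holo_cst.
have iJ : conjc i = - i by rewrite /i; simpc.
have A0 : A (- i) = 0.
  by rewrite -iJ /A /sharp !conjcK mulrC subrr.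
have [K hK KE] := removable (- i) hA.
have {}KE z : A z = (z + i) * K z by have := KE z; rewrite A0 subr0 opprK.
pose c := normc (E i) + normc (sharp E i).
have c0 : 0 <= c by rewrite addr_ge0// normc_ge0.
have nE : normc (conjc (E i)) = normc (E i) := normcJ _.
have nEs : normc (conjc (sharp E i)) = normc (sharp E i) := normcJ _.
have bA (p q s t u : R) : 0 <= p -> 0 <= q -> s <= u -> t <= u -> s * p + t * q <= (p + q) * u.
  by move=> p0 q0 su tu; rewrite mulrDl lerD// [leLHS]mulrC ler_wpM2l.
have Kb z : 0 < complex.Im z -> normc (z + i) * normc (K z) <= c * normc (E z).
  move=> z0; rewrite -normcM -KE (le_trans (normcB _ _))// !normcM nE nEs.
  by apply: bA; rewrite ?normc_ge0// ltW// hermite_biehler_lt.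
have Ksb z : 0 < complex.Im z -> normc (z - i) * normc (sharp K z) <= c * normc (E z).
  move=> z0; rewrite /sharp normcJ.
  have -> : normc (z - i) = normc (conjc z + i).
    rewrite -normcJ; congr (normc _); case: (z) => a b.
    by apply/eqP; rewrite eq_complex /=; apply/andP; split; apply/eqP; ring.
  rewrite -normcM -KE (le_trans (normcB _ _))// !normcM nE nEs.
  have e1 : normc (E (conjc z)) = normc (sharp E z) by rewrite /sharp normcJ.
  have e2 : normc (sharp E (conjc z)) = normc (E z) by rewrite /sharp normcJ conjcK.
  by rewrite e1 e2; apply: bA; rewrite ?normc_ge0// ltW// hermite_biehler_lt.
exists K; last first.
  (* At a real zero the two products in [A] have equal modulus. As [E] and [sharp E] have the same
     nonzero modulus at [x], they would have the same modulus at [i], against the Hermite-Biehler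
     inequality. *)
  move=> x; apply/eqP => Kx; have := KE x%:C; rewrite Kx mulr0 => /eqP.
  rewrite subr_eq0 => /eqP /(congr1 (@normc R)); rewrite !normcM nE nEs normc_sharp_real.
  move=> /(mulfI _) e; have := @hermite_biehler_lt i ltr01; rewrite -/i e ?ltxx//.
  by rewrite gt_eqF//; apply: normc_gt0; exact: E_real_neq0.
split; first exact/entireP.
- apply: (@hardy2_decay _ (c ^+ 2)); first exact: exprn_ge0.
    by move=> z; exact: cder_div.
  move=> x y y0; have z0 : 0 < complex.Im (x +i* y) by [].
  have E0 : 0 < normc (E (x +i* y)) by apply: normc_gt0; exact: hermite_biehler_neq0.
  have := Kb _ z0; rewrite normcM normcV; set k := normc (K _); set e := normc (E _) in E0 *; set n := normc _ => h.
  rewrite ler_pdivlMr ?oneDsqr_gt0//.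
  have n1 : oneDsqr x <= n ^+ 2.
    rewrite /n sqr_normcE /= addr0 /oneDsqr addrC lerD2l.
    by apply: exprn_ege1; lra.
  apply: (@le_trans _ _ ((k / e) ^+ 2 * n ^+ 2)); first by rewrite ler_wpM2l// exprn_ge0// divr_ge0 ?normc_ge0.
  rewrite -exprMn lerXn2r ?nnegrE// ?mulr_ge0 ?invr_ge0 ?normc_ge0//.
  by rewrite mulrAC ler_pdivrMr// mulrC.
have hKs := holo_sharp hK.
(* [sharp K] is controlled only after multiplication by [z - i], which vanishes inside the upper
   half-plane. Near [i] a lower bound for [E] and an upper bound for [sharp K] take over. *)
have h12 : - (2^-1) <= 2^-1 :> R by lra.
have h32 : 2^-1 <= 3 / 2 :> R by lra.
have [m m0 Hm] := nonvanishing_rectangle h12 h32 hEh (fun x y _ yy => hermite_biehler_neq0 (z := x +i* y) ltac:(rewrite /=; lra)).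
have [B B0 HB] := holo_bounded 3 hKs.
(* The first term serves away from [i], where [1 + x^2 <= 8 |z - i|^2]; the second serves on the
   square of half-side 1/2 around [i], where [1 + x^2 <= 2]. *)
pose C := 8 * c ^+ 2 + 2 * (B / m) ^+ 2.
apply: (@hardy2_decay _ C); first by rewrite /C addr_ge0 ?mulr_ge0 ?exprn_ge0 ?invr_ge0 ?(ltW m0).
  by move=> z; exact: cder_div.
move=> x y y0; have z0 : 0 < complex.Im (x +i* y) by [].
have E0 : 0 < normc (E (x +i* y)) by apply: normc_gt0; exact: hermite_biehler_neq0.
have := Ksb _ z0; have := HB (x +i* y); have := Hm x y.
rewrite normcM normcV; set k := normc (sharp K _); set e := normc (E _) in E0 *; set n := normc (_ - i) => H1 H2 h.
have k0 : 0 <= k := normc_ge0 _.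
have n0 : 0 <= n := normc_ge0 _.
have n2E : n ^+ 2 = x ^+ 2 + (y - 1) ^+ 2 by rewrite /n sqr_normcE /= subr0.
rewrite ler_pdivlMr ?oneDsqr_gt0//.
have ke0 : 0 <= k / e by rewrite divr_ge0// ltW.
have [near|far] := pselect (- 2^-1 <= x <= 2^-1 /\ 2^-1 <= y <= 3 / 2).
  have {}H1 := H1 near.1 near.2.
  have {}H2 : k <= B.
    apply: H2; apply: (le_trans (normc_le_ReIm _)) => /=.
    have : `|x| <= 2^-1 by rewrite ler_norml; case: near.
    have : `|y| <= 3 / 2 by rewrite ler_norml; case: near => _; lra.
    by lra.
  have kB : k / e <= B / m.
    by rewrite ler_pM ?invr_ge0 ?(ltW E0)// lef_pV2// posrE.
  have x2 : oneDsqr x <= 2.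
    have : x ^+ 2 <= 1 by rewrite -real_normK ?num_real// exprn_ile1// ler_norml; case: near; lra.
    by rewrite /oneDsqr; lra.
  apply: (@le_trans _ _ ((B / m) ^+ 2 * 2)); last by rewrite /C mulrC lerDr mulr_ge0// exprn_ge0.
  by rewrite ler_pM ?exprn_ge0 ?(ltW (oneDsqr_gt0 _))// lerXn2r// nnegrE// divr_ge0// ltW.
have n1 : oneDsqr x <= 8 * n ^+ 2.
  rewrite n2E /oneDsqr; have := sqr_ge0 x; have := sqr_ge0 (y - 1) => y2 x2.
  have [xx|xx] := leP (4^-1) (x ^+ 2); first by lra.
  have [yy|yy] := leP (4^-1) ((y - 1) ^+ 2); first by lra.
  exfalso; apply: far.
  have hs (w : R) : w ^+ 2 < 4^-1 -> - 2^-1 <= w <= 2^-1.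
    rewrite -ler_norml => w2; rewrite leNgt; apply/negP => w3.
    have : 2^-1 * 2^-1 <= `|w| * `|w| by rewrite ler_pM// ltW.
    by rewrite -normrM -expr2 ger0_norm ?sqr_ge0//; lra.
  by have := hs _ xx; have := hs _ yy; split; lra.
apply: (@le_trans _ _ ((k / e) ^+ 2 * (8 * n ^+ 2))); first by rewrite ler_wpM2l// exprn_ge0.
apply: (@le_trans _ _ (8 * c ^+ 2)); last by rewrite lerDl mulr_ge0// exprn_ge0// divr_ge0// ltW.
rewrite mulrCA ler_wpM2l// -exprMn lerXn2r ?nnegrE ?(mulr_ge0 ke0 n0)//.
by rewrite mulrAC ler_pdivrMr// mulrC.
Qed.

Definition line_weight (x : R) : R := (normc (E x%:C) ^+ 2)^-1.

Lemma line_weight_gt0 x : 0 < line_weight x.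
Proof. by rewrite invr_gt0 exprn_gt0//; apply: normc_gt0. Qed.

Lemma measurable_line_weight : measurable_fun (T := mR) (U := mR) setT line_weight.
Proof.
have hEh := holo_hermite_biehler.
apply: continuous_measurable_fun => x; rewrite /line_weight.
apply: cvgV; first by rewrite gt_eqF// exprn_gt0//; apply: normc_gt0.
have tt (t : R) : t <= t <= t by rewrite lexx.
have fc : ccont (fun t : R => E t%:C) x x.
  apply: (@ccont_ext _ (fun t : R => E (0 + t%:C))) => [t|]; first by rewrite add0r.
  exact: ccont_row.
rewrite (_ : (fun x => _) = (fun x => complex.Re (E x%:C) * complex.Re (E x%:C) + complex.Im (E x%:C) * complex.Im (E x%:C))); last first.
  by apply/funext => u; rewrite sqr_normcE !expr2.
rewrite sqr_normcE !expr2.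
by apply: cvgD; apply: cvgM; first [exact: ccont_Re fc x (tt x)|exact: ccont_Im fc x (tt x)].
Qed.

Definition dbnorm2 (F : R[i] -> R[i]) : \bar R := (\int[leb R]_x (msq F (x, 0) * line_weight x)%:E)%E.

Lemma de_branges_normE F : de_branges_norm E F = sqrte (dbnorm2 F).
Proof.
congr sqrte; apply: eq_integral => x _; rewrite normcM normcV exprMn exprVn.
by rewrite msqE.
Qed.

Lemma measurable_dbnorm2 F : holo F ->
  measurable_fun (T := mR) setT (fun x => (msq F (x, 0) * line_weight x)%:E).
Proof.
move=> hF; apply: measurable_fin; apply: measurable_funM; last exact: measurable_line_weight.
by apply/measurable_EFinP; exact: measurable_row 0 (measurable_msq hF).
Qed.

Context (v : R -> R) (hv : density v) (c0 : R) (c00 : 0 < c0)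
  (HdB : forall F, de_branges E F <-> inH v F)
  (dbN : forall F, inH v F -> (dbnorm2 F <= c0%:E * fock2 v F)%E)
  (Ndb : forall F, inH v F -> (fock2 v F <= c0%:E * dbnorm2 F)%E).

Let mv : measurable_fun (T := mR) (U := mR) setT v. Proof. by case: hv. Qed.
Let v0 y : 0 <= v y. Proof. by apply: ltW; case: hv. Qed.

Lemma inH_shift F (u : R) : inH v F -> inH v (fun z => F (z + u%:C)).
Proof. by case=> hF Nfin; split; [exact: holo_shift|rewrite fock2_shift]. Qed.

(* Test the norm equivalence on the translates of a kernel without real zeros. *)
Lemma line_weight_local : exists2 d : R, 0 < d & exists2 C : R, 0 <= C & forall t,
  (\int[leb R]_x (ind (- d) d (t - x) * line_weight x)%:E <= C%:E)%E.
Proof.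
have [K /HdB HK Kn0] := de_branges_kernel; have [hK _] := HK.
have nK0 : 0 < normc (K 0) / 2 by rewrite divr_gt0//; apply: normc_gt0; exact: Kn0 0.
have [D D0 HD] := cder_cont (holo_cder 0 hK) nK0.
pose m := (normc (K 0) / 2) ^+ 2; have m0 : 0 < m by rewrite exprn_gt0.
have [N N0 NE] := fock2_fin hv HK.
exists (D / 2); first by rewrite divr_gt0.
exists (m^-1 * (c0 * N)); first by rewrite mulr_ge0 ?invr_ge0 ?(ltW m0)// mulr_ge0// ltW.
move=> t; have HT := inH_shift (- t) HK; have [hT _] := HT.
have := dbN HT; rewrite fock2_shift// NE -EFinM => h.
have mT := measurable_dbnorm2 hT.
rewrite [leRHS]EFinM lee_pdivlMl//; apply: le_trans h.
have ml : measurable_fun (T := mR) setT (fun x => (ind (- (D / 2)) (D / 2) (t - x) * line_weight x)%:E).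
  apply: measurable_fin; apply: measurable_funM; last exact: measurable_line_weight.
  exact: (measurableT_comp (measurable_ind _ _) (leb_preserving_reflect t).1).
have l0 x : 0 <= line_weight x by apply: ltW; exact: line_weight_gt0.
rewrite -(ge0_integralZl (leb R) measurableT ml); last 2 first.
- by move=> x _; rewrite lee_fin mulr_ge0// ind_ge0.
- by rewrite lee_fin ltW.
apply: (@ge0_le_integral _ _ _ (leb R) _ measurableT) => //.
- move=> x _; rewrite -EFinM lee_fin; apply: mulr_ge0; first exact: ltW.
  by apply: mulr_ge0; [exact: ind_ge0|exact: l0].
- exact: emeasurable_funM.
move=> x _; rewrite -EFinM lee_fin mulrA ler_wpM2r//.
rewrite /ind; case: ifP => tx; last by rewrite mulr0 msq_ge0.
rewrite mulr1 msqE /m lerXn2r ?nnegrE ?normc_ge0 ?(ltW nK0)//.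
rewrite (_ : x +i* 0 + (- t)%:C = (x - t)%:C); last by rewrite rmorphB /= rmorphN.
have xt : normc (x - t)%:C < D.
  by rewrite normc_real; apply: (@le_lt_trans _ _ (D / 2)); [rewrite ler_norml; lra|lra].
have := HD _ xt; rewrite add0r.
by have := normcD (K 0 - K (x - t)%:C) (K (x - t)%:C); rewrite subrK normc_distC; lra.
Qed.

(* Averaging over horizontal translations, under which the Fock norm is invariant. *)
Lemma line_norm_bound : exists2 C : R, 0 < C & forall F, inH v F ->
  (fock2 v F <= C%:E * slice (msq F) 0)%E.
Proof.
have [d d0 [C C0 HC]] := line_weight_local.
have d2 : 0 < 2 * d by rewrite mulr_gt0.
(* The length [2 d] of the averaging window is divided out; [C + 1] replaces [C] to make the
   constant positive. *)
exists ((2 * d)^-1 * (c0 * (C + 1))).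
  by rewrite !mulr_gt0 ?invr_gt0//; lra.
move=> F HF; have [hF _] := HF; have [N N0 NE] := fock2_fin hv HF.
have lw0 x : 0 <= line_weight x by apply: ltW; exact: line_weight_gt0.
have mF0 : measurable_fun (T := mR) (U := mR) setT (fun t => msq F (t, 0)).
  by apply/measurable_EFinP; exact: measurable_row 0 (measurable_msq hF).
have [mJ le2] := averaging mF0 measurable_line_weight (fun t => msq_ge0 _ _) lw0 C0 HC.
(* Integrate N(F) <= c0 times the squared norm in H(E) of the translate by [u], over [u] in
   [[-d, d]]; the left side does not depend on [u]. *)
have le1 : ((2 * d)%:E * N%:E <= c0%:E * \int[leb R]_u ((ind (- d) d u)%:E * \int[leb R]_x (msq F ((x + u)%R, 0%R) * line_weight x)%:E))%E.
  rewrite -(integral_ind_const 0 (ltW d0) N0).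
  rewrite -(ge0_integralZl (leb R) measurableT mJ); last 2 first.
  - move=> u _; apply: mule_ge0; first by rewrite lee_fin ind_ge0.
    by apply: integral_ge0 => x _; rewrite lee_fin mulr_ge0// msq_ge0.
  - by rewrite lee_fin ltW.
  apply: (@ge0_le_integral _ _ _ (leb R) _ measurableT).
  - by move=> u _; rewrite lee_fin mulr_ge0// ind_ge0.
  - apply: measurable_fin; apply: measurable_funM; last exact: measurable_cst.
    exact: (measurableT_comp (measurable_ind _ _) (leb_preserving_reflect 0).1).
  - by apply: emeasurable_funM; [exact: measurable_cst|exact: mJ].
  move=> u _; rewrite sub0r.
  have -> : ind (- d) d (- u) = ind (- d) d u by rewrite /ind; congr (if _ then _ else _); apply/idP/idP; lra.
  have := Ndb (inH_shift u HF); rewrite fock2_shift// NE => h.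
  rewrite EFinM muleCA; apply: lee_wpmul2l; first by rewrite lee_fin ind_ge0.
  suff -> : (\int[leb R]_x (msq F ((x + u)%R, 0%R) * line_weight x)%:E)%E = dbnorm2 (fun z => F (z + u%:C)) by exact: h.
  apply: eq_integral => x _; rewrite !msqE (_ : x +i* 0 + u%:C = (x + u) +i* 0)//.
  by apply/eqP; rewrite eq_complex /= addr0 !eqxx.
have S0 := slice_msq_ge0 F 0.
rewrite NE EFinM -muleA lee_pdivlMl//.
apply: (le_trans le1); rewrite EFinM -muleA; apply: lee_wpmul2l; first by rewrite lee_fin ltW.
apply: (le_trans le2); apply: lee_wpmul2r; first exact: S0.
by rewrite lee_fin lerDl.
Qed.

End hardy.

Lemma paley_wiener_of_representing_fock_weight (R : realType) (E : R[i] -> R[i])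
    (hE : hermite_biehler E) (E_real_neq0 : forall x : R, E x%:C != 0) (W : R[i] -> R) :
  representing_fock_weight E W -> (forall z w : R[i], complex.Im z = complex.Im w -> W z = W w) ->
  exists a : R, 0 < a /\
     same_space (de_branges E) (de_branges_norm E) (paley_wiener a) (@L2_norm_on_line R).
Proof.
move=> [wW [dbF [c [C [c0 C0 hN]]]]] WIm.
have [v [mv vpos vlow vN]] := fock_norm_reduce wW WIm.
have hv : density v by split.
have [finE Efin] := @sqrte_lty R.
have HdB F : de_branges E F <-> inH v F.
  rewrite dbF; split=> [[/entireP hF]|[hF Nfin]].
    by rewrite vN// => /finE Nfin; split.
  by split; [exact/entireP|rewrite vN//; exact: Efin].
have v0 y : 0 <= v y by apply: ltW; exact: vpos.
have D0 F : (0 <= dbnorm2 E F)%E.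
  by apply: integral_ge0 => x _; rewrite lee_fin mulr_ge0 ?msq_ge0// ltW// line_weight_gt0.
have N0 F : (0 <= fock2 v F)%E by exact: fock2_ge0.
have sqr_le (k : R) (x y : \bar R) : 0 < k -> (0 <= y -> sqrte x <= k%:E * sqrte y -> x <= (k ^+ 2)%:E * y)%E.
  move=> k0 y0; have -> : (k%:E * sqrte y = sqrte ((k ^+ 2)%:E * y))%E.
    by rewrite sqrteM ?lee_fin ?sqr_ge0//= sqrtr_sqr ger0_norm// ltW.
  by rewrite lee_sqrt// mule_ge0// lee_fin sqr_ge0.
(* The constants are squared because the estimates concern squared norms; the sum serves both
   directions. *)
pose k := (c^-1) ^+ 2 + C ^+ 2.
have k0 : 0 < k by rewrite addr_gt0 ?exprn_gt0 ?invr_gt0.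
have dbN F : inH v F -> (dbnorm2 E F <= k%:E * fock2 v F)%E.
  move=> HF; have [hF _] := HF; have /HdB/hN/andP[h _] := HF.
  move: h; rewrite de_branges_normE vN// => h.
  apply: (@le_trans _ _ ((c^-1 ^+ 2)%:E * fock2 v F)%E).
    by apply: sqr_le; rewrite ?invr_gt0// muleC lee_pdivlMr// muleC.
  by apply: lee_wpmul2r; [exact: N0|rewrite lee_fin lerDl exprn_ge0// ltW].
have Ndb F : inH v F -> (fock2 v F <= k%:E * dbnorm2 E F)%E.
  move=> HF; have [hF _] := HF; have /HdB/hN/andP[_ h] := HF.
  move: h; rewrite de_branges_normE vN// => h.
  apply: (@le_trans _ _ ((C ^+ 2)%:E * dbnorm2 E F)%E); first exact: sqr_le.
  by apply: lee_wpmul2r; [exact: D0|rewrite lee_fin lerDr exprn_ge0// invr_ge0 ltW].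
have [C1 C10 lineN] := line_norm_bound hE E_real_neq0 hv k0 HdB dbN Ndb.
have [K /HdB HK K0] := de_branges_kernel hE E_real_neq0.
have sharpH F : inH v F -> inH v (sharp F) by move=> /HdB/sharp_de_branges/HdB.
have r0 := growth_rate_gt0 hv C10 lineN sharpH HK (K0 0).
exists (growth_rate v); split=> //.
have [C2 C20 HC2] := slice_le_fock2 hv 0.
have Nline F : inH v F -> (slice (msq F) 0 <= C2%:E * fock2 v F)%E.
  by case=> hF _; have [|h _] := HC2 F 0 hF; first by rewrite normr0.
pose M := k * C1 + C2 * k.
have M0 : 0 < M by rewrite addr_gt0 ?mulr_gt0.
apply: (@same_space_sqrt _ _ _ _ _ (dbnorm2 E) (fun F => slice (msq F) 0) M) => //.
- apply/seteqP; split=> F.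
    move=> /HdB HF; have [hF _] := HF; split; first exact/entireP.
      exact: (inH_exp_type hv C10 lineN sharpH HK (K0 0) HF).
    by apply: Efin; rewrite -[X in (X < _)%E]/(slice (msq F) 0) (sliceE hv 0 HF) ltry.
  case=> /entireP hF Fr /finE Lfin; apply/HdB.
  exact: (inH_of_paley_wiener hv C10 lineN sharpH HK (K0 0) hF Fr Lfin).
- by move=> F _; split; first exact: de_branges_normE.
move=> F /HdB HF; have S0 := slice_msq_ge0 F 0; split=> //.
- apply: (le_trans (dbN F HF)); apply: (@le_trans _ _ (k%:E * (C1%:E * slice (msq F) 0))%E).
    by apply: lee_wpmul2l; [rewrite lee_fin ltW|exact: lineN].
  by rewrite muleA -EFinM; apply: lee_wpmul2r => //; rewrite lee_fin lerDl ltW// mulr_gt0.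
- apply: (le_trans (Nline F HF)); apply: (@le_trans _ _ (C2%:E * (k%:E * dbnorm2 E F))%E).
    by apply: lee_wpmul2l; [rewrite lee_fin ltW|exact: Ndb].
  by rewrite muleA -EFinM; apply: lee_wpmul2r => //; rewrite lee_fin lerDr ltW// mulr_gt0.
Qed.

Theorem theorem2p4 (R : realType) (E : R[i] -> R[i])
    (hE : hermite_biehler E) (E_real_neq0 : forall x : R, E x%:C != 0) :
  (exists W : R[i] -> R, representing_fock_weight E W /\
     forall z w : R[i], complex.Im z = complex.Im w -> W z = W w)
  <->
  (exists a : R, 0 < a /\
     same_space (de_branges E) (de_branges_norm E)
                (paley_wiener a) (@L2_norm_on_line R)).
Proof.
split=> [[W [hW WIm]]|[a [a0 h]]].
  exact: paley_wiener_of_representing_fock_weight hW WIm.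
exact: representing_fock_weight_of_paley_wiener h.
Qed.
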